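(* Let $\alpha\in(0,1)$, $\lambda\in\mathbb{R}$, $n\in\mathbb{N}$, and let $f$ be any function such that ${}^{TC}\mathcal{D}^{k\alpha,\lambda}_{\Psi}f$ exists and is continuous for all $k=0,1,2,\ldots,n+1$. Then, for all $t\in[0,b]$, we have $$f(t)=e^{-\lambda(\Psi(t)-\Psi(0))}\Bigg\{\sum_{k=0}^{n}\frac{(\Psi(t)-\Psi(0))^{k\alpha}}{\Gamma(k\alpha+1)}\cdot{}^{TC}\mathcal{D}^{k\alpha,\lambda}_{\Psi}f(0)+(\Psi(t)-\Psi(0))^{(n+1)\alpha}E_{1,(n+1)\alpha+1}\big(\lambda(\Psi(t)-\Psi(0))\big)\cdot\left({}^{TC}\mathcal{D}^{\alpha,\lambda}_{\Psi}\right)^{n+1}f(c)\Bigg\}$$ for some $c\in(0,t)$.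
   Context: Throughout, $b>0$ is fixed and $\Psi$ is a smooth monotonic real function on $[0,b]$ with $\Psi'>0$ almost everywhere. For $\beta>0$ and $\lambda\in\mathbb{R}$, the $\Psi$-tempered fractional integral is $${}^{T}\mathcal{I}^{\beta,\lambda}_{\Psi}y(t)=\frac{1}{\Gamma(\beta)}\int_0^t\Psi'(s)(\Psi(t)-\Psi(s))^{\beta-1}e^{-\lambda(\Psi(t)-\Psi(s))}y(s)\,\mathrm{d}s.$$ For $m\in\mathbb{N}$ and $\beta\in(m-1,m)$, the $\Psi$-tempered fractional derivative of Caputo type of order $\beta$ is $${}^{TC}\mathcal{D}^{\beta,\lambda}_{\Psi}y(t)={}^{T}\mathcal{I}^{m-\beta,\lambda}_{\Psi}\left(\frac{1}{\Psi'(t)}\frac{\mathrm{d}}{\mathrm{d}t}+\lambda\right)^{m}y(t).$$ For integer order $m$ the derivative is $\left(\frac{1}{\Psi'(t)}\frac{\mathrm{d}}{\mathrm{d}t}+\lambda\right)^{m}y(t)$, and for order $0$ it is $y$ itself. Thus ${}^{TC}\mathcal{D}^{k\alpha,\lambda}_{\Psi}$ denotes the single derivative of order $k\alpha$, and ${}^{TC}\mathcal{D}^{k\alpha,\lambda}_{\Psi}f(0)$ its value at $t=0$, whereas $\left({}^{TC}\mathcal{D}^{\alpha,\lambda}_{\Psi}\right)^{n+1}$ denotes the $(n+1)$-fold composition of ${}^{TC}\mathcal{D}^{\alpha,\lambda}_{\Psi}$ with itself. $E_{p,q}(z)=\sum_{j=0}^\infty \frac{z^j}{\Gamma(pj+q)}$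 is the two-parameter Mittag-Leffler function.
   Formalization: The (n+1)-fold composition of the order-α derivative is additionally assumed to exist on (0,b]; existence and continuity of the single derivatives of order kα do not imply it (Ψ=id, λ=0, α=0.4, n=3, f(t)=t). *)

(* Defs.v *)
From HB Require Import structures.
From mathcomp Require Import all_boot all_order all_algebra.
From mathcomp Require Import all_classical all_reals all_analysis.

Set Implicit Arguments.
Unset Strict Implicit.
Unset Printing Implicit Defensive.

Import Order.TTheory GRing.Theory Num.Theory.
Import numFieldNormedType.Exports.

Local Open Scope classical_set_scope.
Local Open Scope ring_scope.

Section TemperedCalculus.
Context {R : realType}.
Implicit Types (b lambda alpha beta : R) (Psi y w g : R -> R).

Local Notation mu := (@lebesgue_measure R).

Definition Gamma (x : R) : R :=
  \int[mu]_(t in `]0, +oo[) (t `^ (x - 1) * expR (- t)).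

Definition mittag_leffler (p q z : R) : R :=
  limn (series (fun j : nat => z ^+ j / Gamma (p * j%:R + q))).

(* C^oo on the closed interval: every derivative exists on ]0, b[ and extends
   continuously to [0, b]; the values of Psi outside [0, b] play no role. *)
Definition smooth_on b Psi : Prop :=
  {within `[0, b], continuous Psi} /\
  forall k : nat,
    (forall t, t \in `]0, b[ -> derivable (derive1n k Psi) t 1) /\
    exists2 g, {within `[0, b], continuous g} &
               {in `]0, b[, g =1 derive1n k Psi}.

(* Psi' may vanish on a null set, where (1 / Psi') d/dt is undefined. *)
Definition admissible b Psi : Prop :=
  [/\ smooth_on b Psi,
      {in `[0, b] &, {homo Psi : s t / s <= t}} &
      {ae mu, forall t, t \in `]0, b[ -> 0 < derive1 Psi t}].

Definition tempered_kernel Psi lambda beta (t s : R) : R :=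
  derive1 Psi s * (Psi t - Psi s) `^ (beta - 1) * expR (- lambda * (Psi t - Psi s)).

Definition tempered_integral Psi lambda beta y (t : R) : R :=
  (Gamma beta)^-1 *
  \int[mu]_(s in `[0, t]) (tempered_kernel Psi lambda beta t s * y s).

(* [tempered_integral] is total: this is its domain of definition. *)
Definition tempered_integrable Psi lambda beta y (t : R) : Prop :=
  mu.-integrable `[0, t]
    (fun s => (tempered_kernel Psi lambda beta t s * y s)%:E).

(* Absolutely continuous functions on [0, b], described as the primitives of
   their (almost everywhere defined, Lebesgue integrable) derivatives. *)
Definition abs_continuous b y : Prop :=
  [/\ {ae mu, forall t, t \in `]0, b[ -> derivable y t 1},
      mu.-integrable `[0, b] (EFin \o derive1 y) &
      forall t, t \in `[0, b] ->
        y t - y 0 = \int[mu]_(s in `[0, t]) derive1 y s].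

(* [is_tempered_derivn b Psi lambda m y z]: the m-th iterate
   ((1 / Psi') d/dt + lambda)^m y exists on [0, b] and z is a version of it.
   Each function that is differentiated must be absolutely continuous: mere
   a.e. differentiability would admit Cantor-like functions.  The operator is
   only defined a.e., but each intermediate w is continuous, hence determined
   on the whole of [0, b]. *)
Fixpoint is_tempered_derivn b Psi lambda (m : nat) y (z : R -> R) : Prop :=
  match m with
  | 0 => {in `[0, b], z =1 y}
  | m'.+1 => abs_continuous b y /\
      exists2 w,
        {ae mu, forall t, t \in `]0, b[ ->
           w t = (derive1 Psi t)^-1 * derive1 y t + lambda * y t} &
        is_tempered_derivn b Psi lambda m' w z
  end.

(* [is_tc_derive b Psi lambda beta y g]: the Caputo-type derivative of order
   beta >= 0 of y exists and is g.  For non-integer beta the defining integral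
   is only meaningful at t > 0, so g 0 is left free: when g is continuous on
   [0, b], g 0 is the limit of the derivative at 0+ (e.g. Gamma (beta + 1) for
   y = t^beta, Psi = id, lambda = 0, 0 < beta < 1). *)
Definition is_tc_derive b Psi lambda beta y g : Prop :=
  (exists2 m : nat, beta = m%:R & is_tempered_derivn b Psi lambda m y g) \/
  (exists m : nat, m%:R < beta < m.+1%:R /\
     exists2 z, is_tempered_derivn b Psi lambda m.+1 y z &
       forall t, t \in `]0, b] ->
         tempered_integrable Psi lambda (m.+1%:R - beta) z t /\
         g t = tempered_integral Psi lambda (m.+1%:R - beta) z t).

(* [is_tc_derive_iter b Psi lambda alpha k y h]: the k-fold composition with
   itself of the Caputo-type derivative of order alpha is defined at y, and its
   value is h. *)
Fixpoint is_tc_derive_iter b Psi lambda alpha (k : nat) y (h : R -> R) : Prop :=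
  match k with
  | 0 => {in `[0, b], h =1 y}
  | k'.+1 => exists2 w, is_tc_derive b Psi lambda alpha y w &
                        is_tc_derive_iter b Psi lambda alpha k' w h
  end.

End TemperedCalculus.

(* Main.v *)
(** Take [X t = Psi t - Psi 0] as a clock and [E t = exp (lambda * X t)] as a weight.
    On functions multiplied by [E], the tempered integral becomes the Riemann-Liouville
    integral [I^a] with respect to [X], and [(1 / Psi') d/dt + lambda] becomes
    [(1 / Psi') d/dt].  The derivative of order [k alpha] then gives
      [E f = sum_(j < k alpha) a_j X^j / j! + I^(k alpha) (E D_k)],
    with a polynomial of integer powers, while the iterates give
      [E f = sum_(i <= k) W_i X^(i alpha) / Gamma (i alpha + 1) + I^(k alpha + 1) zeta_k],
    where [I^(1 - alpha) zeta_n = E h] at the last step.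
    Comparing the coefficients of [X^(k alpha)] at [0] yields [W_k = D_k 0] for [k <= n].
    At order [(n + 1) alpha] the powers below [n alpha] must cancel, and left
    differentiation of what remains shows that [E h], which is not assumed to be
    continuous, is continuous on [0 < t < b], with
      [E f = sum_(k <= n) D_k(0) X^(k alpha) / Gamma (k alpha + 1) + I^((n + 1) alpha) (E h)].
    The mean value theorem for the positive kernel extracts [h c], and expanding the
    exponential gives
      [I^((n + 1) alpha) E = X^((n + 1) alpha) E_(1, (n + 1) alpha + 1) (lambda X)]. *)

Require Import Defs.
From mathcomp Require Import all_boot all_order all_algebra.
From mathcomp Require Import all_classical all_reals all_analysis.
From mathcomp Require Import measurable_realfun ring lra.

Import Order.TTheory GRing.Theory Num.Theory.
Import numFieldNormedType.Exports.

Set Implicit Arguments.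
Unset Strict Implicit.
Unset Printing Implicit Defensive.

Local Open Scope classical_set_scope.
Local Open Scope ring_scope.

(** * Substitution on open intervals *)

Section substitution.
Context {R : realType}.
Implicit Types (X G : R -> R) (r t : R).
Local Notation mu := (@lebesgue_measure R).

(** Two obstacles shape the proof. As [Psi'] may vanish on a null set, the inverse of the clock need
    not be differentiable; identities are therefore proved between integrals, and difference
    quotients are taken in [X], whose increments are positive. Moreover [h] is not the single
    derivative [D n.+1] and may be unbounded at 0: for [Psi = id], [lambda = 0], [alpha = 3/5],
    [n = 1], [f t = t], the derivative of order [6/5] is 0 while the second iterate is
    [t^(-1/5) / Gamma (4/5)]. The cancellation at order [(n + 1) alpha] has this cause: the integral
    of order [(n + 1) alpha] of a bounded function and that of order [n alpha + 1] of an integrable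
    one are both [o(X^(n alpha))], and a finite sum of powers with exponents at most [n alpha] that
    is [o(X^(n alpha))] vanishes. The surviving integers [j] lie strictly between [n alpha] and
    [(n + 1) alpha]; they contribute to [E h] powers [X^(j - (n + 1) alpha)], integrable since the
    exponent exceeds -1, but singular at 0. Hence only continuity away from 0 is available to the
    mean value theorem. *)

Lemma itvoo_bigcup_itvcc r t : r < t ->
  exists u v : nat -> R,
    [/\ forall n, r < u n /\ u n < v n < t,
        forall n, u n.+1 <= u n /\ v n <= v n.+1 &
        forall x, r < x < t -> exists n, u n <= x <= v n].
Proof.
move=> rt; have d0 : 0 < t - r by rewrite subr_gt0.
(* The offset [n.+3] keeps [q n] at most a third of the length, so that [r + q n < t - q n] already
   for [n = 0]. *)
pose q (n : nat) := (t - r) / n.+3%:R.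
have q0 n : 0 < q n by rewrite divr_gt0.
have q3 n : q n * 3 <= t - r.
  have -> : t - r = q n * n.+3%:R by rewrite mulfVK// pnatr_eq0.
  by rewrite ler_pM2l// (ler_nat _ 3).
exists (fun n => r + q n), (fun n => t - q n); split => [n|n|x /andP[rx xt]].
- by have := q0 n; have := q3 n; lra.
- have : q n.+1 <= q n by rewrite /q ler_pM2l// lef_pV2 ?posrE// ?ler_nat.
  by lra.
- pose e := Num.min (x - r) (t - x).
  have e0 : 0 < e by rewrite lt_min !subr_gt0 rx xt.
  exists (Num.truncn ((t - r) / e)).
  suff : q (Num.truncn ((t - r) / e)) <= e by rewrite le_min; lra.
  rewrite /q ler_pdivrMr// mulrC -ler_pdivrMr//.
  apply: le_trans (ltW (truncnS_gt _)) _.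
  by rewrite ler_nat ltnS; do 2 apply: leqW.
Qed.

Lemma ge0_integral_itvoo_cvg (f : R -> \bar R) r t (u v : nat -> R) :
  (forall n, r < u n /\ u n < v n < t) ->
  (forall n, u n.+1 <= u n /\ v n <= v n.+1) ->
  (forall x, r < x < t -> exists n, u n <= x <= v n) ->
  measurable_fun `]r, t[ f -> (forall x, r < x < t -> (0 <= f x)%E) ->
  (\int[mu]_(x in `[u n, v n]) f x)%E @[n --> \oo] -->
  (\int[mu]_(x in `]r, t[) f x)%E.
Proof.
move=> uv nd cov mf f0.
have sub n : `[u n, v n] `<=` `]r, t[.
  by have := uv n; move=> + x /=; rewrite !in_itv/=; lra.
have -> : `]r, t[%classic = \bigcup_n `[u n, v n]%classic.
  apply/seteqP; split => [x /=|x [n _ /(sub n)]//].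
  by rewrite in_itv/= => /cov[n unx]; exists n => //=; rewrite in_itv.
apply: ge0_nondecreasing_set_cvg_integral.
- apply/nondecreasing_seqP => n; rewrite subsetEset => x /=.
  by have := nd n; rewrite !in_itv/=; lra.
- by move=> n; exact: measurable_itv.
- by move=> n; apply: measurable_funS mf => //; exact: measurable_itv.
- by move=> n x /sub/=; rewrite in_itv/= => /f0.
Qed.

(** The kernels to be substituted are singular at the endpoints, and the derivative of [X] is
    controlled only inside. The formula on compact subintervals passes to the limit by monotone
    convergence, the integrands being nonnegative. *)
Lemma ge0_integration_by_substitution_itvoo X G r t : r < t ->
  {within `[r, t], continuous X} ->
  {in `[r, t] &, {homo X : x y / x < y}} ->
  {in `]r, t[, forall x, derivable X x 1} ->
  {in `]r, t[, continuous (derive1 X)} ->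
  {in `]X r, X t[, continuous G} ->
  {in `]X r, X t[, forall x, 0 <= G x} ->
  (\int[mu]_(x in `]r, t[) (G (X x) * derive1 X x)%:E =
   \int[mu]_(x in `]X r, X t[) (G x)%:E)%E.
Proof.
move=> rt cX incX dX cdX cG G0.
have [u [v [uv nd cov]]] := itvoo_bigcup_itvcc rt.
have oo_cc : {subset `]r, t[ <= `[r, t]} by exact: subset_itv_oo_cc.
have Xitv x : x \in `]r, t[ -> X r < X x < X t.
  move=> xrt; have := xrt; rewrite in_itv/= => /andP[rx xt].
  by apply/andP; split; apply: incX => //; rewrite in_itv/=; lra.
have uoo n : u n \in `]r, t[ by rewrite in_itv/=; have := uv n; lra.
have voo n : v n \in `]r, t[ by rewrite in_itv/=; have := uv n; lra.
have cXx x : x \in `]r, t[ -> {for x, continuous X}.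
  by move=> xrt; apply/differentiable_continuous/derivable1_diffP/dX.
have mG : measurable_fun `]X r, X t[ (EFin \o G).
  apply/measurable_EFinP; apply: open_continuous_measurable_fun => // x.
  by rewrite inE => /cG.
have mGX : measurable_fun `]r, t[ (fun x => (G (X x) * derive1 X x)%:E).
  apply/measurable_EFinP; apply: open_continuous_measurable_fun => // x.
  rewrite inE /= => xrt; apply: cvgM; last exact: cdX.
  apply: continuous_comp; first exact: cXx.
  by apply: cG; rewrite in_itv/= Xitv.
have L := @ge0_integral_itvoo_cvg _ _ _ _ _ uv nd cov mGX.
(* The images of the exhausting intervals exhaust []X r, X t[], because every intermediate value is
   attained at an interior point. *)
have Q : (\int[mu]_(x in `[X (u n), X (v n)]) (EFin \o G) x)%E @[n --> \oo] -->
    (\int[mu]_(x in `]X r, X t[) (EFin \o G) x)%E.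
  apply: ge0_integral_itvoo_cvg => //.
  - move=> n; have /Xitv := uoo n; have /Xitv := voo n.
    have : X (u n) < X (v n) by rewrite incX ?oo_cc//; have := uv n; lra.
    lra.
  - move=> n; have [un vn] := nd n; split.
    + by move: un; rewrite le_eqVlt => /predU1P[->//|un]; apply/ltW/incX => //;
        rewrite oo_cc.
    + by move: vn; rewrite le_eqVlt => /predU1P[->//|vn]; apply/ltW/incX => //;
        rewrite oo_cc.
  - move=> y /andP[ry yt].
    have Xrt : X r < X t by lra.
    have [x xrt Xxy] : exists2 x, x \in `[r, t] & X x = y.
      apply: IVT => //; first exact: ltW.
      by rewrite minElt Xrt maxElt Xrt; lra.
    have rx : r < x.
      rewrite lt_neqAle; move: xrt; rewrite in_itv/= => /andP[-> _]; rewrite andbT.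
      by apply/eqP => rx; move: ry; rewrite -Xxy rx ltxx.
    have xt : x < t.
      rewrite lt_neqAle; move: xrt; rewrite in_itv/= => /andP[_ ->]; rewrite andbT.
      by apply/eqP => rx'; move: yt; rewrite -Xxy rx' ltxx.
    have [|n /andP[unx xvn]] := cov x; first by rewrite rx xt.
    exists n; rewrite -Xxy; apply/andP; split.
    + by move: unx; rewrite le_eqVlt => /predU1P[->//|un]; apply/ltW/incX => //;
        rewrite oo_cc.
    + by move: xvn; rewrite le_eqVlt => /predU1P[->//|un]; apply/ltW/incX => //;
        rewrite oo_cc.
apply: cvg_unique Q => //.
have -> : (fun n => \int[mu]_(x in `[X (u n), X (v n)]) (EFin \o G) x)%E =
   (fun n => \int[mu]_(x in `[u n, v n]) (G (X x) * derive1 X x)%:E)%E.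
  apply/funext => n.
  have [ru /andP[un vt]] := uv n.
  have sub x : x \in `[u n, v n] -> x \in `]r, t[.
    by rewrite !in_itv/=; lra.
  have cXuv : {within `[u n, v n], continuous X}.
    by apply: derivable_within_continuous => x /sub/dX.
  rewrite (integration_by_substitution_increasing (ltW un)); first by [].
  - by move=> x y /sub/oo_cc xrt /sub/oo_cc yrt; exact: incX.
  - move=> x /subset_itv_oo_cc/sub; exact: cdX.
  - apply/cvg_ex; exists (derive1 X (u n)); apply: cvg_at_right_filter; exact/cdX.
  - apply/cvg_ex; exists (derive1 X (v n)); apply: cvg_at_left_filter; exact/cdX.
  - split; first by move=> x /subset_itv_oo_cc/sub/dX.
    + exact/cvg_at_right_filter/cXx.
    + exact/cvg_at_left_filter/cXx.
  - apply: continuous_in_subspaceT => y; rewrite inE/= in_itv/= => yuv.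
    apply: cG; rewrite in_itv/=.
    by have /Xitv := uoo n; have /Xitv := voo n; lra.
apply: L => x xrt; rewrite lee_fin mulr_ge0//.
  by rewrite G0// in_itv/= Xitv.
apply: (@incr_derive1_ge0_itv R X true false r t x _ incX); last first.
  by rewrite in_itv/= xrt.
by move=> y; rewrite inE/=; exact: dX.
Qed.

End substitution.

(** * The Gamma function *)

Section gamma_function.
Context {R : realType}.
Implicit Types (a c u v x : R) (f g : R -> R).
Local Notation mu := (@lebesgue_measure R).

Lemma eq_continuous_itvoo f g u v : {in `]u, v[, f =1 g} ->
  {in `]u, v[, continuous g} -> {in `]u, v[, continuous f}.
Proof.
move=> fg cg x xuv; rewrite /continuous_at fg//.
apply: cvg_trans (cg x xuv); apply: near_eq_cvg.
near=> y; rewrite fg//; near: y; exact: near_in_itvoo.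
Unshelve. all: by end_near. Qed.

Lemma continuous_powRl a x : 0 < x -> {for x, continuous (fun y : R => y `^ a)}.
Proof.
move=> x0; apply/differentiable_continuous/derivable1_diffP.
by apply: derivable_powR; rewrite in_itv/= andbT.
Qed.

(** A vanishing integral would force [f = 0] almost everywhere, and the interval would be a null
    set. *)
Lemma integral_gt0_itvoo f u v : u < v ->
  measurable_fun `]u, v[ f -> (forall x, u < x < v -> 0 <= f x) ->
  {ae mu, forall x, x \in `]u, v[ -> 0 < f x} ->
  (0 < \int[mu]_(x in `]u, v[) (f x)%:E)%E.
Proof.
move=> uv mf f0 aef; rewrite lt_neqAle integral_ge0 ?andbT; last first.
  by move=> x /=; rewrite in_itv/= lee_fin => /f0.
apply/eqP => int0.
have mfE : measurable_fun `]u, v[ (EFin \o f) by exact/measurable_EFinP.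
have [+ _] := ae_eq_integral_abs mu (measurable_itv `]u, v[) mfE.
have -> : (\int[mu]_(x in `]u, v[) `|(EFin \o f) x|)%E = 0%E.
  rewrite int0; apply: eq_integral => x; rewrite inE/= in_itv/= => /f0 fx.
  by rewrite ger0_norm.
move=> /(_ erefl) ae0; have : mu `]u, v[%classic = 0%E.
  apply/negligibleP; first exact: measurable_itv.
  apply: negligibleS (negligibleU ae0 aef).
  move=> x /= xuv; have [fx0|fx0] := pselect (0 < f x).
    by left => /(_ xuv)[fx]; move: fx0; rewrite fx ltxx.
  by right => /(_ xuv).
rewrite lebesgue_measure_itv/= lte_fin uv.
by move/eqP; rewrite -EFinB eqe subr_eq0 gt_eqF.
Qed.

(** Substitution [q = y^a] in the integral of the constant 1. For [a < 1] the integrand is unbounded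
    at 0, which is where the version on open intervals is needed. *)
Lemma integral_powR01 a : 0 < a ->
  (\int[mu]_(x in `]0%R, 1%R[) (x `^ (a - 1))%:E)%E = a^-1%:E.
Proof.
move=> a0; pose q (y : R) := y `^ a.
have dp x : x \in `]0, 1[ -> is_derive x 1 q (a * x `^ (a - 1)).
  by rewrite in_itv/= => /andP[x0 _]; exact: is_derive1_powR.
have dE x : x \in `]0, 1[ -> derive1 q x = a * x `^ (a - 1).
  by move=> /dp dx; rewrite derive1E; apply: derive_val.
have q0 : q 0 = 0 by rewrite /q powR0 ?gt_eqF.
have q1 : q 1 = 1 by rewrite /q powR1.
have : (\int[mu]_(x in `]0%R, 1%R[) (cst 1%R (q x) * derive1 q x)%:E =
   \int[mu]_(x in `]q 0%R, q 1%R[) (cst 1%R x)%:E)%E.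
  apply: ge0_integration_by_substitution_itvoo.
  - by [].
  - apply/continuous_within_itvP => //; split.
    + by move=> x; rewrite in_itv/= => /andP[x0 _]; exact: continuous_powRl.
    + by rewrite q0; exact: powR_cvg0.
    + exact/cvg_at_left_filter/continuous_powRl.
  - move=> x y; rewrite !in_itv/= => /andP[x0 _] /andP[y0 _] xy.
    by rewrite /q gt0_ltr_powR.
  - by move=> x /dp[].
  - apply: (eq_continuous_itvoo dE) => x; rewrite in_itv/= => /andP[x0 _].
    by apply: cvgM; [exact: cvg_cst|exact: continuous_powRl].
  - by move=> x _; exact: cvg_cst.
  - by move=> x _; exact: ler01.
have -> : (\int[mu]_(x in `]q 0%R, q 1%R[) (cst 1%R x)%:E = 1%:E)%E.
  transitivity (\int[mu]_(x in `]0%R, 1%R[) cst 1%E x)%E; first by rewrite q0 q1.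
  by rewrite integral_cst//= lebesgue_measure_itv/= lte_fin ltr01 oppr0 adde0 mule1.
under eq_integral => x /[!inE]/= x01 do rewrite mul1r dE// EFinM.
rewrite ge0_integralZl//=; last 3 first.
- by apply/measurable_EFinP; apply: measurable_funTS; exact: measurable_powR.
- by move=> x _; rewrite lee_fin powR_ge0.
- by rewrite lee_fin ltW.
move=> /(congr1 (mule a^-1%:E)); rewrite muleA -EFinM mulVf ?gt_eqF//.
by rewrite mul1e mule1.
Qed.

Definition gammaf a x : R := x `^ (a - 1) * expR (- x).

Lemma measurable_gammaf a D : measurable_fun D (gammaf a).
Proof.
apply: measurable_funTS; apply: measurable_funM; first exact: measurable_powR.
by apply: measurableT_comp => //; exact: oppr_measurable.
Qed.

Lemma gammaf_ge0 a x : 0 <= gammaf a x.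
Proof. by rewrite mulr_ge0 ?powR_ge0 ?expR_ge0. Qed.

(** Half of the exponential decay pays for the power: one term of the series of [expR (x / 2)]
    dominates [x ^+ n.+1] up to a constant. *)
Lemma gammaf_le_exp a : exists2 C : R, 0 <= C &
  forall x, 1 <= x -> gammaf a x <= C * exponential_pdf 2^-1 x.
Proof.
pose n := Num.truncn a.
(* The leading 2 undoes the normalising factor [1/2] of the exponential density of rate [1/2]. *)
exists (2 * (n.+1`!%:R * 2 ^+ n.+1)) => [|x x1]; first by rewrite !mulr_ge0.
have x0 : 0 <= x by lra.
rewrite exponential_pdfE//=.
have le1 : x `^ (a - 1) <= x ^+ n.+1.
  rewrite -powR_mulrn// ler_powR//.
  by have := truncnS_gt a; rewrite -/n; lra.
have le2 : x ^+ n.+1 <= n.+1`!%:R * 2 ^+ n.+1 * expR (x / 2).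
  have := @expR_ge1Dxn _ (x / 2) n; rewrite divr_ge0// => /(_ isT).
  rewrite expr_div_n -lerBrDl; move/le_trans => /(_ (expR (x / 2))).
  rewrite gerBl ler01 => /(_ isT).
  by rewrite ler_pdivrMr ?ltr0n ?fact_gt0// ler_pdivrMr ?exprn_gt0// -mulrA mulrC.
rewrite /gammaf; apply: le_trans (ler_wpM2r (expR_ge0 _) (le_trans le1 le2)) _.
rewrite -(mulrA _ (expR _)) -expRD; have -> : x / 2 + - x = - 2^-1 * x by lra.
by move: (_ * _ ^+ _) (expR _) => A E; lra.
Qed.

(** On []0, 1[] the comparison is with [x^(a - 1)], on [[1, +oo[] with an exponential density. *)
Lemma integrable_gammaf a : 0 < a ->
  mu.-integrable `]0, +oo[ (EFin \o gammaf a).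
Proof.
move=> a0; apply/integrableP; split.
  by apply/measurable_EFinP; exact: measurable_gammaf.
under eq_integral do rewrite /= ger0_norm ?gammaf_ge0//.
rewrite (@set_interval.itv_bndbnd_setU _ _ _ (BLeft 1%R)) ?bnd_simp//.
rewrite ge0_integral_setU//=; last 3 first.
- by apply/measurable_EFinP; exact: measurable_gammaf.
- by move=> x _; rewrite lee_fin gammaf_ge0.
- apply/disj_setPS => x [/=]; rewrite !in_itv/= andbT => /andP[_ x1].
  by rewrite leNgt x1.
apply: lte_add_pinfty.
  apply: (@le_lt_trans _ _ (a^-1%:E)%E); last exact: ltry.
  rewrite -integral_powR01//; apply: ge0_le_integral => //=.
  - by move=> x _; rewrite lee_fin gammaf_ge0.
  - by apply/measurable_EFinP; exact: measurable_gammaf.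
  - by apply/measurable_EFinP; apply: measurable_funTS; exact: measurable_powR.
  - move=> x; rewrite in_itv/= => /andP[x0 _].
    by rewrite lee_fin ler_piMr ?powR_ge0// expR_le1; lra.
have [C C0 HC] := gammaf_le_exp a.
apply: (@le_lt_trans _ _ (\int[mu]_(x in `[1%R, +oo[) (C%:E * (exponential_pdf 2^-1 x)%:E)))%E.
  apply: ge0_le_integral => //=.
  - by move=> x _; rewrite lee_fin gammaf_ge0.
  - by apply/measurable_EFinP; exact: measurable_gammaf.
  - apply/measurable_EFinP/measurable_funM => //.
    by apply: measurable_funTS; exact: measurable_exponential_pdf.
  - by move=> x; rewrite in_itv/= andbT => x1; rewrite -EFinM lee_fin HC.
apply: integrable_lty => //; apply: integrableZl => //.
apply: integrableS (integrable_exponential_pdf _) => //.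
Qed.

Lemma Gamma_EFin a : 0 < a ->
  (\int[mu]_(x in `]0%R, +oo[) (gammaf a x)%:E)%E = (Gamma a)%:E.
Proof.
by move=> /integrable_gammaf ia; rewrite /Gamma/= fineK//; exact: integrable_fin_num.
Qed.

Lemma Gamma_gt0 a : 0 < a -> 0 < Gamma a.
Proof.
move=> a0; rewrite -lte_fin -Gamma_EFin//.
apply: (@lt_le_trans _ _ (\int[mu]_(x in `]0%R, 1%R[) (gammaf a x)%:E)%E).
  apply: integral_gt0_itvoo => //; first exact: measurable_gammaf.
  - by move=> x _; exact: gammaf_ge0.
  - by apply/aeW => x; rewrite in_itv/= => /andP[x0 _]; rewrite mulr_gt0 ?powR_gt0 ?expR_gt0.
apply: ge0_subset_integral => //=.
- by apply/measurable_EFinP; exact: measurable_gammaf.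
- by move=> x _; rewrite lee_fin gammaf_ge0.
- by move=> x/=; rewrite !in_itv/= andbT => /andP[].
Qed.

Lemma Gamma1 : Gamma 1 = 1 :> R.
Proof.
apply: EFin_inj; rewrite -Gamma_EFin//.
rewrite -(@integral_exponential_pdf R 1)//.
transitivity (\int[mu]_(x in `[0%R, +oo[) (gammaf 1 x)%:E)%E.
  rewrite integral_itv_obnd_cbnd//.
  by apply/measurable_EFinP; exact: measurable_gammaf.
rewrite integral_mkcond; apply: eq_integral => x _.
rewrite /exponential_pdf !patchE; case: ifPn => // _.
by rewrite /gammaf subrr powRr0 !mul1r mulN1r.
Qed.

End gamma_function.

(** * The Beta integral *)

Section beta_integral.
Context {R : realType}.
Implicit Types (a c u v x s : R) (G : R -> R).
Local Notation mu := (@lebesgue_measure R).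

Lemma derive1_affine (k l : R) : derive1 (fun x => l + k * x) = cst k.
Proof.
apply/funext => x; rewrite derive1E.
by rewrite deriveD// derive_cst add0r deriveM// derive_cst scaler0 addr0 derive_id /GRing.scale/= mulr1.
Qed.

Lemma ge0_integral_affine_itvoo G (k l u v : R) : 0 < k -> u < v ->
  {in `]l + k * u, l + k * v[, continuous G} ->
  {in `]l + k * u, l + k * v[, forall x, 0 <= G x} ->
  (\int[mu]_(x in `]u, v[) (G (l + k * x) * k)%:E =
   \int[mu]_(x in `](l + k * u)%R, (l + k * v)%R[) (G x)%:E)%E.
Proof.
move=> k0 uv cG G0.
have cX : continuous (fun x => l + k * x).
  move=> x; apply: cvgD; first exact: cvg_cst.
  by apply: cvgM; [exact: cvg_cst|exact: cvg_id].
rewrite -(@ge0_integration_by_substitution_itvoo R (fun x => l + k * x) G u v)//.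
- by rewrite derive1_affine.
- exact: continuous_subspaceT.
- by move=> x y _ _ xy; rewrite ltrD2l ltr_pM2l.
- by rewrite derive1_affine => x _; exact: cvg_cst.
Qed.

(** The affine substitution applies to bounded intervals; []s, s + n + 1[] increases to the
    half-line and monotone convergence concludes. *)
Lemma ge0_integral_shift_itvoy G s :
  {in `]0, +oo[, continuous G} -> {in `]0, +oo[, forall x, 0 <= G x} ->
  (\int[mu]_(x in `]s, +oo[) (G (x - s))%:E =
   \int[mu]_(x in `]0%R, +oo[) (G x)%:E)%E.
Proof.
move=> cG G0.
have itvE (r : R) : `]r, +oo[%classic = \bigcup_n `]r, r + n.+1%:R[%classic.
  apply/seteqP; split => [x /=|x [n _] /=].
    rewrite in_itv/= andbT => rx; exists (Num.truncn (x - r)) => //=.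
    by rewrite in_itv/= rx/=; have := truncnS_gt (x - r); lra.
  by rewrite !in_itv/= andbT => /andP[].
have cvgI (F : R -> R) (r : R) : measurable_fun `]r, +oo[ F ->
    {in `]r, +oo[, forall x, 0 <= F x} ->
    (\int[mu]_(x in `]r, (r + n.+1%:R)%R[) (F x)%:E)%E @[n --> \oo] -->
    (\int[mu]_(x in `]r, +oo[) (F x)%:E)%E.
  move=> mF F0; rewrite itvE; apply: ge0_nondecreasing_set_cvg_integral.
  - apply/nondecreasing_seqP => n; rewrite subsetEset => x /=.
    have : n.+1%:R <= n.+2%:R :> R by rewrite ler_nat.
    by rewrite !in_itv/=; lra.
  - by move=> n; exact: measurable_itv.
  - move=> n; apply/measurable_EFinP; apply: measurable_funS mF => // x/=.
    by rewrite !in_itv/= andbT => /andP[].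
  - by move=> n x /=; rewrite in_itv/= => /andP[rx _]; rewrite lee_fin F0// in_itv/= rx.
have mG : measurable_fun (`]0, +oo[ : set R) G.
  by apply: open_continuous_measurable_fun => // x; rewrite inE => /cG.
have cGs : {in `]s, +oo[, continuous (fun x => G (x - s))}.
  move=> x; rewrite in_itv/= andbT => sx; apply: continuous_comp.
    by apply: cvgB; [exact: cvg_id|exact: cvg_cst].
  by apply: cG; rewrite in_itv/= andbT subr_gt0.
have mGs : measurable_fun (`]s, +oo[ : set R) (fun x => G (x - s)).
  by apply: open_continuous_measurable_fun => // x; rewrite inE => /cGs.
have G0s : {in `]s, +oo[, forall x, 0 <= G (x - s)}.
  by move=> x; rewrite in_itv/= andbT => sx; rewrite G0// in_itv/= andbT subr_gt0.
have := cvgI _ _ mGs G0s; have := cvgI _ _ mG G0.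
move=> L1 L2; apply: cvg_unique L2 _ => //.
apply: cvg_trans L1; apply: near_eq_cvg; apply: nearW => n.
have := @ge0_integral_affine_itvoo G 1 (- s) s (s + n.+1%:R) ltr01.
have n0 : 0 < n.+1%:R :> R by rewrite ltr0n.
rewrite !mul1r addNr (addrA (- s)) addNr add0r ltrDl n0 => /(_ isT) E.
rewrite -E.
- by apply: eq_integral => x _; rewrite mulr1 mul1r addrC.
- by move=> x; rewrite in_itv/= => /andP[x0 _]; apply: cG; rewrite in_itv/= x0.
- by move=> x; rewrite in_itv/= => /andP[x0 _]; apply: G0; rewrite in_itv/= x0.
Qed.

(** Euler's Beta integral, kept in the extended reals so that its finiteness need not be known in
    advance: it follows from [Gamma_mul_betae]. *)
Definition betae a c : \bar R :=
  (\int[mu]_(y in `]0%R, 1%R[) ((1 - y) `^ (a - 1) * y `^ (c - 1))%:E)%E.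

Lemma measurable_fun_powR d (T : measurableType d) (D : set T) (f : T -> R) a :
  measurable_fun D f -> measurable_fun D (fun t => f t `^ a).
Proof.
by move=> mf; exact: (measurableT_comp (measurable_powR a) mf).
Qed.

Lemma measurable_powRB v a D : measurable_fun D (fun y : R => (v - y) `^ a).
Proof. by apply: measurable_fun_powR; exact: measurable_funB. Qed.

Lemma measurable_powRs u a D : measurable_fun D (fun y : R => (y - u) `^ a).
Proof. by apply: measurable_fun_powR; exact: measurable_funB. Qed.

Lemma integral_beta_scale a c u v : u < v ->
  (\int[mu]_(z in `]u, v[) ((v - z) `^ (a - 1) * (z - u) `^ (c - 1))%:E =
   ((v - u) `^ (a + c - 1))%:E * betae a c)%E.
Proof.
move=> uv; have d0 : 0 < v - u by rewrite subr_gt0.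
have := @ge0_integral_affine_itvoo
  (fun z => (v - z) `^ (a - 1) * (z - u) `^ (c - 1)) (v - u) u 0 1 d0 ltr01.
rewrite mulr0 addr0 mulr1 (addrC u) subrK => <-; last 2 first.
- move=> z; rewrite in_itv/= => /andP[uz zv].
  have cB : {for z, continuous (fun z : R => (v - z) `^ (a - 1))}.
    apply: (@continuous_comp _ _ _ (fun z => v - z) (fun y => y `^ (a - 1))).
      by apply: cvgB; [exact: cvg_cst|exact: cvg_id].
    by apply: continuous_powRl; rewrite subr_gt0.
  have cs : {for z, continuous (fun z : R => (z - u) `^ (c - 1))}.
    apply: (@continuous_comp _ _ _ (fun z => z - u) (fun y => y `^ (c - 1))).
      by apply: cvgB; [exact: cvg_id|exact: cvg_cst].
    by apply: continuous_powRl; rewrite subr_gt0.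
  exact: cvgM.
- by move=> z _; rewrite mulr_ge0 ?powR_ge0.
rewrite /betae -ge0_integralZl//=; last 3 first.
- apply/measurable_EFinP/measurable_funM; first exact: measurable_powRB.
  by apply: measurable_funTS; exact: measurable_powR.
- by move=> y _; rewrite lee_fin mulr_ge0 ?powR_ge0.
- by rewrite lee_fin powR_ge0.
apply: eq_integral => y; rewrite inE/= in_itv/= => /andP[y0 y1].
rewrite -EFinM; congr EFin.
have -> : v - (u + (v - u) * y) = (v - u) * (1 - y) by ring.
have -> : u + (v - u) * y - u = (v - u) * y by ring.
rewrite !powRM ?subr_ge0 ?(ltW uv) ?(ltW y0) ?(ltW y1)//.
have -> : a + c - 1 = (a - 1) + (c - 1) + 1 by ring.
have dn : v - u != 0 by rewrite gt_eqF.
rewrite (@powRD _ _ (a - 1 + (c - 1))) ?dn ?implybT//.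
rewrite (@powRD _ _ (a - 1)) ?dn ?implybT// powRr1 ?(ltW d0)//.
by ring.
Qed.

(** Tonelli for [(x - s)^(a - 1) s^(c - 1) exp (- x)] on the region [0 < s < x]. Integrating in [x]
    first, a shift by [s] splits off both Gamma integrals; integrating in [s] first, scaling by [x]
    produces the Beta integral times the integrand of [Gamma (a + c)]. *)
Lemma Gamma_mul_betae a c : 0 < a -> 0 < c ->
  ((Gamma a)%:E * (Gamma c)%:E = betae a c * (Gamma (a + c))%:E)%E.
Proof.
move=> a0 c0.
pose F (z : R * R) : \bar R := (if 0 < z.1 then if z.1 < z.2 then
  (z.2 - z.1) `^ (a - 1) * z.1 `^ (c - 1) * expR (- z.2) else 0 else 0)%:E.
have F0 z : (0 <= F z)%E.
  by rewrite /F lee_fin; do 2 case: ifP => // _; rewrite !mulr_ge0 ?powR_ge0 ?expR_ge0.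
have mF : measurable_fun setT F.
  apply/measurable_EFinP; apply: measurable_fun_ifT => //.
    by apply: measurable_fun_ltr => //; exact: measurable_fst.
  apply: measurable_fun_ifT => //.
    by apply: measurable_fun_ltr; [exact: measurable_fst|exact: measurable_snd].
  apply: measurable_funM; first apply: measurable_funM.
  - apply: measurable_fun_powR; apply: measurable_funB.
    + exact: measurable_snd.
    + exact: measurable_fst.
  - by apply: measurable_fun_powR; exact: measurable_fst.
  - apply: measurableT_comp; first exact: measurable_expR.
    by apply: measurableT_comp; [exact: oppr_measurable|exact: measurable_snd].
have := fubini_tonelli (m1 := mu) (m2 := mu) F mF F0.
have -> : (\int[mu]_s \int[mu]_x F (s, x) = (Gamma a)%:E * (Gamma c)%:E)%E.
  rewrite -[X in (_ * X)%E]Gamma_EFin// -ge0_integralZl//=; last 3 first.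
  - by apply/measurable_EFinP; exact: measurable_gammaf.
  - by move=> x _; rewrite lee_fin gammaf_ge0.
  - by rewrite lee_fin ltW ?Gamma_gt0.
  rewrite [RHS]integral_mkcond; apply: eq_integral => s _.
  rewrite patchE mem_setE in_itv/= andbT; case: ifPn => s0; last first.
    by apply: integral0_eq => x _; rewrite /F/= (negPf s0).
  transitivity (\int[mu]_(x in `]s, +oo[) (gammaf c s * gammaf a (x - s))%:E)%E.
    rewrite [RHS]integral_mkcond; apply: eq_integral => x _.
    rewrite patchE mem_setE in_itv/= andbT /F/= s0; case: ifPn => // sx.
    congr EFin; rewrite /gammaf.
    have -> : expR (- x) = expR (- s) * expR (- (x - s)) by rewrite -expRD; congr expR; ring.
    by ring.
  under eq_integral do rewrite EFinM.
  rewrite ge0_integralZl//=; last 3 first.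
  - apply/measurable_EFinP; apply: (measurable_funTS); apply: measurableT_comp.
      exact: measurable_gammaf.
    exact: measurable_funB.
  - by move=> x _; rewrite lee_fin gammaf_ge0.
  - by rewrite lee_fin gammaf_ge0.
  rewrite ge0_integral_shift_itvoy ?Gamma_EFin// 1?muleC//.
  - move=> x; rewrite in_itv/= andbT => x0; apply: cvgM; first exact: continuous_powRl.
    by apply: continuous_comp; [exact: cvgN|exact: continuous_expR].
  - by move=> x _; exact: gammaf_ge0.
move=> ->; rewrite -Gamma_EFin ?addr_gt0// -ge0_integralZl//=; last 3 first.
- by apply/measurable_EFinP; exact: measurable_gammaf.
- by move=> x _; rewrite lee_fin gammaf_ge0.
- by apply: integral_ge0 => y _; rewrite lee_fin mulr_ge0 ?powR_ge0.
rewrite [RHS]integral_mkcond; apply: eq_integral => x _.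
rewrite patchE mem_setE in_itv/= andbT; case: ifPn => x0; last first.
  apply: integral0_eq => s _; rewrite /F/=; do 2 case: ifPn => //.
  by move=> sx s0; rewrite (lt_trans s0 sx) in x0.
transitivity (\int[mu]_(s in `]0%R, x[)
    ((expR (- x))%:E * ((x - s) `^ (a - 1) * (s - 0) `^ (c - 1))%:E))%E.
  rewrite [RHS]integral_mkcond; apply: eq_integral => s _.
  rewrite patchE mem_setE in_itv/= /F/= subr0; case: ifPn => //= s0.
  by case: ifPn => // sx; rewrite -EFinM mulrC.
rewrite ge0_integralZl//=; last 2 first.
- by apply/measurable_EFinP; apply: measurable_funM;
    [exact: measurable_powRB|exact: measurable_powRs].
- by move=> s _; rewrite lee_fin mulr_ge0 ?powR_ge0.
by rewrite integral_beta_scale// subr0 /gammaf EFinM [RHS]muleC muleCA muleA.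
Qed.

Lemma integral_beta a c u v : 0 < a -> 0 < c -> u < v ->
  (\int[mu]_(z in `]u, v[) ((v - z) `^ (a - 1) * (z - u) `^ (c - 1))%:E =
   (Gamma a * Gamma c / Gamma (a + c) * (v - u) `^ (a + c - 1))%:E)%E.
Proof.
move=> a0 c0 uv; rewrite integral_beta_scale// muleC [in RHS]EFinM; congr (_ * _)%E.
have g0 : Gamma (a + c) != 0 by rewrite gt_eqF// Gamma_gt0// addr_gt0.
rewrite EFinM EFinM Gamma_mul_betae// -muleA -EFinM divff// mule1//.
Qed.

(** The Beta formula with first parameter 1, where the integral is that of [y^(a - 1)] and equals
    [1 / a]. *)
Lemma GammaD1 a : 0 < a -> Gamma (a + 1) = a * Gamma a.
Proof.
move=> a0; have := @integral_beta 1 a 0 1 ltr01 a0 ltr01.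
rewrite Gamma1 mul1r subr0 powR1 mulr1 (addrC 1 a).
under eq_integral do rewrite subr0 subrr powRr0 mul1r.
rewrite integral_powR01// => -[] /esym/eqP.
have g0 : Gamma (a + 1) != 0 by rewrite gt_eqF// Gamma_gt0// addr_gt0.
have an0 : a != 0 by rewrite gt_eqF.
rewrite -[a^-1]mul1r eqr_div// ?mul1r => /eqP <-.
by rewrite mulrC.
Qed.

End beta_integral.

(** * Riemann-Liouville integrals with respect to a clock *)

Section kernel_fubini.
Context {R : realType}.
Local Notation mu := (@lebesgue_measure R).

(** No integrability is assumed: Tonelli treats the positive and negative parts apart, and [fine] is
    measurable. *)
Lemma measurable_Rintegral_fst (g : R * R -> R) : measurable_fun setT g ->
  measurable_fun setT (fun s => \int[mu]_r (g (s, r))).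
Proof.
move=> mg; have mge : measurable_fun setT (EFin \o g) by exact/measurable_EFinP.
rewrite /Rintegral; apply: (@measurableT_comp _ _ _ _ _ _ fine).
  exact: fine_measurable.
have -> : (fun s => \int[mu]_r (g (s, r))%:E)%E =
  (fun s => \int[mu]_r ((EFin \o g)^\+ (s, r)) - \int[mu]_r ((EFin \o g)^\- (s, r)))%E.
  apply/funext => s; rewrite [LHS]integralE.
  by congr (_ - _)%E; apply: eq_integral => r _; rewrite ?funeposE ?funenegE.
apply: emeasurable_funB.
- by apply: measurable_fun_fubini_tonelli_F => //; exact: measurable_funepos.
- by apply: measurable_fun_fubini_tonelli_F => //; exact: measurable_funeneg.
Qed.

(** Nonnegative kernels allow Tonelli with [|y|] in place of [y], so integrability against the
    composed kernel [C] alone justifies the exchange. The inner integral may diverge for some [s];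
    the identity needs it only almost everywhere. *)
Lemma kernel_fubini (A C y : R -> R) (B : R -> R -> R) :
  measurable_fun setT A -> measurable_fun setT (fun z : R * R => B z.1 z.2) ->
  measurable_fun setT y -> (forall s, 0 <= A s) -> (forall s r, 0 <= B s r) ->
  (forall r, (\int[mu]_s (A s * B s r)%:E = (C r)%:E)%E) ->
  mu.-integrable setT (fun r => (C r * y r)%:E) ->
  mu.-integrable setT (fun s => (A s * \int[mu]_r (B s r * y r))%:E) /\
  \int[mu]_s (A s * \int[mu]_r (B s r * y r)) = \int[mu]_r (C r * y r).
Proof.
move=> mA mB my A0 B0 CE iCy.
have C0 r : 0 <= C r.
  by rewrite -lee_fin -CE; apply: integral_ge0 => s _; rewrite lee_fin mulr_ge0.
have mBy : measurable_fun setT (fun z : R * R => B z.1 z.2 * y z.2).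
  by apply: measurable_funM => //; apply: measurableT_comp => //; exact: measurable_snd.
pose f (z : R * R) := (A z.1 * (B z.1 z.2 * y z.2))%:E.
have mf : measurable_fun setT f.
  apply/measurable_EFinP/measurable_funM => //.
  by apply: measurableT_comp => //; exact: measurable_fst.
have mAB r : measurable_fun setT (fun s => (A s * B s r)%:E).
  apply/measurable_EFinP/measurable_funM => //.
  exact: (measurableT_comp mB (pair2_measurable r)).
have inner r : (\int[mu]_s `|f (s, r)| = `|C r * y r|%:E)%E.
  rewrite normrM (ger0_norm (C0 r)) EFinM -CE muleC -ge0_integralZl//=.
    by apply: eq_integral => s _; rewrite -EFinM /=; congr EFin; rewrite !normrM (ger0_norm (A0 s)) (ger0_norm (B0 s r)); ring.
    exact: mAB.
  by move=> s _; rewrite lee_fin mulr_ge0.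
have imf : (mu \x mu)%E.-integrable setT f.
  apply/integrable21ltyP => //; under eq_integral do rewrite inner.
  by case/integrableP : iCy.
have mG : measurable_fun setT (fun s => A s * \int[mu]_r (B s r * y r)).
  by apply: measurable_funM => //; exact: (measurable_Rintegral_fst mBy).
pose F s := (\int[mu]_r f (s, r))%E.
have aeFG : ae_eq mu setT F (fun s => (A s * \int[mu]_r (B s r * y r))%:E).
  apply: filterS (ae_integrable1 imf) => s ifs _; rewrite /F /f/=.
  (* Where [A] vanishes nothing is known about the inner integrand, but both sides are 0. *)
  have [As0|As0] := eqVneq (A s) 0.
    by rewrite As0 mul0r; apply: integral0_eq => r _; rewrite mul0r.
  have iBy : mu.-integrable setT (fun r => (B s r * y r)%:E).
    have -> : (fun r => (B s r * y r)%:E) = (fun r => (A s)^-1%:E * f (s, r))%E.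
      by apply/funext => r; rewrite -EFinM mulKf.
    exact: integrableZl.
  under eq_integral do rewrite EFinM.
  by rewrite integralZl// EFinM fineK//; exact: integrable_fin_num.
have iF : mu.-integrable setT F := integrable_fubini_F imf.
have mF : measurable_fun setT F by exact: measurable_int iF.
have mGe : measurable_fun setT (fun s => (A s * \int[mu]_r (B s r * y r))%:E).
  exact/measurable_EFinP.
split.
  apply/integrableP; split => //.
  have -> : (\int[mu]_s `|(A s * \int[mu]_r (B s r * y r))%:E| = \int[mu]_s `|F s|)%E.
    apply: ge0_ae_eq_integral => //.
    - exact: measurableT_comp.
    - exact: measurableT_comp.
    - by apply: ae_eq_abse; exact: ae_eq_sym.
  by case/integrableP : iF.
rewrite /Rintegral; congr fine.
have <- : (\int[mu]_s F s = \int[mu]_s (A s * \int[mu]_r (B s r * y r))%:E)%E.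
  exact: ae_eq_integral.
rewrite /F (Fubini imf).
apply: eq_integral => r _; rewrite /f/=.
under eq_integral do rewrite mulrA EFinM.
rewrite integralZr//; first by rewrite CE -EFinM.
apply/integrableP; split; first exact: mAB.
have -> : (\int[mu]_s `|(A s * B s r)%:E| = \int[mu]_s (A s * B s r)%:E)%E.
  by apply: eq_integral => s _; rewrite gee0_abs// lee_fin mulr_ge0.
by rewrite CE ltry.
Qed.

End kernel_fubini.

(* What the proof needs of [X = Psi - Psi 0] and [p = Psi'], both continued outside
   [0, b] so that kernels and integrals can be taken over the whole line. *)
Record time_change {R : realType} (b : R) (X p : R -> R) : Prop := TimeChange {
  tc_b_gt0 : 0 < b;
  tc_X0 : X 0 = 0;
  tc_incr : {in `[0, b] &, {homo X : s t / s < t}};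
  tc_cont : continuous X;
  tc_measurable : measurable_fun setT p;
  tc_ge0 : forall s, 0 <= p s;
  tc_out : forall s, ~~ (0 < s < b) -> p s = 0;
  tc_gt0 : {ae @lebesgue_measure R, forall s, s \in `]0, b[ -> 0 < p s};
  tc_subst : forall (G : R -> R) (r t : R), 0 <= r -> r < t -> t <= b ->
    {in `]X r, X t[, continuous G} -> {in `]X r, X t[, forall x : R, 0 <= G x} ->
    (\int[@lebesgue_measure R]_(s in `]r, t[) (G (X s) * p s)%:E =
     \int[@lebesgue_measure R]_(x in `]X r, X t[) (G x)%:E)%E }.

(** * Kernels, their semigroup law and the powers of the clock *)

Section riemann_liouville.
Context {R : realType} (b : R) (X p : R -> R).
Implicit Types (a c s t r : R) (y z : R -> R).
Local Notation mu := (@lebesgue_measure R).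

(** The cut-off [s < t], together with [p = 0] outside []0, b[], lets every integral run over the
    whole line, so that Fubini involves no moving domain. *)
Definition rlk a t s : R :=
  if s < t then (Gamma a)^-1 * (p s * (X t - X s) `^ (a - 1)) else 0.

Definition rlint a y t : R := \int[mu]_s (rlk a t s * y s).

(* The domain of definition of the total function [rlint]. *)
Definition rldef a y t : Prop :=
  mu.-integrable setT (fun s => (rlk a t s * y s)%:E).

(** The normalisation makes integration of order [a] the plain shift [c] to [a + c]. *)
Definition pw c s : R := X s `^ c / Gamma (c + 1).

Hypothesis TC : time_change b X p.

Let b0 : 0 < b. Proof. exact: tc_b_gt0 TC. Qed.

Lemma tc_ltX r t : 0 <= r -> r < t -> t <= b -> X r < X t.
Proof. by move=> r0 rt tb; apply: (tc_incr TC) => //; rewrite in_itv/=; lra. Qed.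

Lemma tc_leX r t : 0 <= r -> r <= t -> t <= b -> X r <= X t.
Proof.
by move=> r0; rewrite le_eqVlt => /predU1P[-> //|rt tb]; rewrite ltW// tc_ltX.
Qed.

Lemma tc_X_ge0 t : 0 <= t -> t <= b -> 0 <= X t.
Proof. by move=> t0 tb; rewrite -(tc_X0 TC) tc_leX. Qed.

Lemma tc_X_gt0 t : 0 < t -> t <= b -> 0 < X t.
Proof. by move=> t0 tb; rewrite -(tc_X0 TC) tc_ltX. Qed.

Lemma rlk_ge0 a t s : 0 < a -> 0 <= rlk a t s.
Proof.
move=> a0; rewrite /rlk; case: ifP => // _.
by rewrite !mulr_ge0 ?powR_ge0 ?(tc_ge0 TC)// invr_ge0 ltW// Gamma_gt0.
Qed.

Lemma rlk_out a t s : ~~ (0 < s < b) -> rlk a t s = 0.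
Proof. by move=> sb; rewrite /rlk (tc_out TC)// mul0r mulr0 if_same. Qed.

Lemma measurable_rlk2 a : measurable_fun setT (fun z : R * R => rlk a z.1 z.2).
Proof.
have mX : measurable_fun setT X by exact: continuous_measurable_fun (tc_cont TC).
apply: measurable_fun_ifT => //.
  by apply: measurable_fun_ltr; [exact: measurable_snd|exact: measurable_fst].
apply: measurable_funM => //; apply: measurable_funM => //.
  by apply: (measurableT_comp (tc_measurable TC)); exact: measurable_snd.
apply: measurable_fun_powR; apply: measurable_funB.
- by apply: (measurableT_comp mX); exact: measurable_fst.
- by apply: (measurableT_comp mX); exact: measurable_snd.
Qed.

Lemma measurable_rlk a t : measurable_fun setT (rlk a t).
Proof. exact: (measurableT_comp (measurable_rlk2 a) (pair1_measurable t)). Qed.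

Lemma eq_rlk a t y z : (forall s, 0 < s < b -> s < t -> y s = z s) ->
  forall s, rlk a t s * y s = rlk a t s * z s.
Proof.
move=> yz s; have [sb|/rlk_out ->] := boolP (0 < s < b); last by rewrite !mul0r.
by rewrite /rlk; case: ifP => [st|_]; rewrite ?mul0r// yz.
Qed.

Lemma eq_rlint a t y z : (forall s, 0 < s < b -> s < t -> y s = z s) ->
  rlint a y t = rlint a z t.
Proof. by move=> yz; apply: eq_Rintegral => s _; exact: eq_rlk. Qed.

Lemma eq_rldef a t y z : (forall s, 0 < s < b -> s < t -> y s = z s) ->
  rldef a y t -> rldef a z t.
Proof.
move=> yz; apply: eq_integrable => // s _; congr EFin; exact: eq_rlk.
Qed.

(** Measurability of [y] is only required on []0, b[]; the restriction is measurable on the line and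
    gives the same integrals. *)
Lemma rlk_patch a t y s : rlk a t s * y s = rlk a t s * (y \_ `]0, b[) s.
Proof.
apply: eq_rlk => {}s sb st.
by rewrite patchE ifT// mem_setE in_itv.
Qed.

Lemma measurable_patch_oo y : measurable_fun `]0, b[ y ->
  measurable_fun setT (y \_ `]0, b[).
Proof. by move=> my; apply/(measurable_restrictT y (measurable_itv `]0, b[)). Qed.

Lemma measurable_rlkM a t y : measurable_fun `]0, b[ y ->
  measurable_fun setT (fun s => rlk a t s * y s).
Proof.
move=> my; under eq_fun do rewrite rlk_patch.
by apply: measurable_funM; [exact: measurable_rlk|exact: measurable_patch_oo].
Qed.

Lemma measurable_rlint a y : measurable_fun `]0, b[ y ->
  measurable_fun setT (rlint a y).
Proof.
move=> my; have -> : rlint a y = fun t => \int[mu]_s (rlk a t s * (y \_ `]0, b[) s).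
  by apply/funext => t; apply: eq_Rintegral => s _; exact: rlk_patch.
apply: (measurable_Rintegral_fst (g := fun z : R * R => rlk a z.1 z.2 * (y \_ `]0, b[) z.2)).
apply: measurable_funM; first exact: measurable_rlk2.
by apply: (measurableT_comp (measurable_patch_oo my)); exact: measurable_snd.
Qed.

(** For [0 < r < t] the substitution [x = X s] turns the integral into the Beta integral between
    [X r] and [X t], whose Gamma quotient is exactly absorbed by the normalisations. *)
Lemma rlk_comp a c t r : 0 < a -> 0 < c -> t <= b ->
  (\int[mu]_s (rlk a t s * rlk c s r)%:E = (rlk (a + c) t r)%:E)%E.
Proof.
move=> a0 c0 tb.
have [rb|rb] := boolP (0 < r < b); last first.
  rewrite (rlk_out _ _ rb); apply: integral0_eq => s _.
  by rewrite (rlk_out _ _ rb) mulr0.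
have /andP[r0 _] := rb.
have [rt|rt] := ltP r t; last first.
  have -> : rlk (a + c) t r = 0 by rewrite /rlk ltNge rt.
  apply: integral0_eq => s _; rewrite /rlk.
  case: ifP => [st|_]; last by rewrite mul0r.
  by rewrite [r < s]ltNge (le_trans (ltW st) rt)/= mulr0.
have Xrt := tc_ltX (ltW r0) rt tb.
pose k := (Gamma a)^-1 * ((Gamma c)^-1 * p r).
pose G x := (X t - x) `^ (a - 1) * (x - X r) `^ (c - 1).
have k0 : 0 <= k.
  by rewrite !mulr_ge0 ?(tc_ge0 TC)// invr_ge0 ltW// Gamma_gt0.
transitivity (\int[mu]_(s in `]r, t[) (k%:E * (G (X s) * p s)%:E))%E.
  rewrite [RHS]integral_mkcond; apply: eq_integral => s _.
  rewrite patchE mem_setE in_itv/= /rlk.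
  have [rs|sr] := ltP r s => /=; last by rewrite mulr0.
  case: ifP => st; last by rewrite mul0r.
  rewrite -EFinM; congr EFin; rewrite /k /G.
  by move: (Gamma a)^-1 (Gamma c)^-1 (_ `^ (a - 1)) (_ `^ (c - 1)) => *; ring.
have mX : measurable_fun `]r, t[ X.
  by apply: measurable_funTS; exact: continuous_measurable_fun (tc_cont TC).
rewrite ge0_integralZl//=; last 2 first.
- apply/measurable_EFinP/measurable_funM; last exact: measurable_funTS (tc_measurable TC).
  by apply: measurable_funM; apply: measurable_fun_powR; apply: measurable_funB.
- by move=> s _; rewrite lee_fin !mulr_ge0 ?powR_ge0 ?(tc_ge0 TC).
rewrite (tc_subst TC)//; last 3 first.
- exact: ltW.
- move=> x; rewrite in_itv/= => /andP[Xrx xXt].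
  apply: cvgM.
    apply: (@continuous_comp _ _ _ (fun u : R => X t - u) (fun u : R => u `^ (a - 1))).
      by apply: cvgB; [exact: cvg_cst|exact: cvg_id].
    by apply: continuous_powRl; rewrite subr_gt0.
  apply: (@continuous_comp _ _ _ (fun u : R => u - X r) (fun u : R => u `^ (c - 1))).
    by apply: cvgB; [exact: cvg_id|exact: cvg_cst].
  by apply: continuous_powRl; rewrite subr_gt0.
- by move=> x _; rewrite mulr_ge0 ?powR_ge0.
rewrite integral_beta// -EFinM; congr EFin.
rewrite /rlk rt /k.
have ga : Gamma a != 0 by rewrite gt_eqF// Gamma_gt0.
have gc : Gamma c != 0 by rewrite gt_eqF// Gamma_gt0.
have gac : Gamma (a + c) != 0 by rewrite gt_eqF// Gamma_gt0// addr_gt0.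
move: (Gamma a) (Gamma c) (Gamma (a + c)) (_ `^ _) ga gc gac => u v w q ga gc gac.
by field; rewrite ga gc gac.
Qed.

(** The semigroup law. Convergence is assumed at order [a + c] and at the single time [t] only;
    convergence of the outer integral is part of the conclusion. *)
Lemma rlint_comp a c y t : 0 < a -> 0 < c -> t <= b ->
  measurable_fun `]0, b[ y -> rldef (a + c) y t ->
  rldef a (rlint c y) t /\ rlint a (rlint c y) t = rlint (a + c) y t.
Proof.
move=> a0 c0 tb my dy.
have [|||||||i1 e1] := @kernel_fubini R (rlk a t) (rlk (a + c) t) (y \_ `]0, b[) (rlk c).
- exact: measurable_rlk.
- exact: measurable_rlk2.
- exact: measurable_patch_oo.
- by move=> s; exact: rlk_ge0.
- by move=> s r; exact: rlk_ge0.
- by move=> r; exact: rlk_comp.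
- by under eq_fun do rewrite -rlk_patch.
have E : rlint c y = fun s => \int[mu]_r (rlk c s r * (y \_ `]0, b[) r).
  by apply/funext => s; apply: eq_Rintegral => r _; exact: rlk_patch.
split; first by rewrite /rldef E.
rewrite {1}/rlint E e1; apply: eq_Rintegral => r _; exact/esym/rlk_patch.
Qed.

Lemma rlk1 s : rlk 1 b s = p s.
Proof.
have [/andP[s0 sb]|sb] := boolP (0 < s < b); last by rewrite rlk_out// (tc_out TC).
by rewrite /rlk sb Gamma1 invr1 subrr powRr0 mul1r mulr1.
Qed.

Lemma rlint_at0 a y : rlint a y 0 = 0.
Proof.
rewrite /rlint (@eq_Rintegral _ _ _ _ _ (cst 0)); last first.
  move=> s _; have [/andP[s0 _]|/rlk_out ->] := boolP (0 < s < b); last by rewrite mul0r.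
  by rewrite /rlk ltNge (ltW s0)/= mul0r.
by rewrite /Rintegral integral0_eq.
Qed.

Lemma rldef_at0 a y : rldef a y 0.
Proof.
rewrite /rldef; apply: (@eq_integrable _ _ _ _ _ _ (cst 0%E)) => //; last exact: integrable0.
move=> s _; have [/andP[s0 _]|/rlk_out ->] := boolP (0 < s < b); last by rewrite mul0r.
by rewrite /rlk ltNge (ltW s0)/= mul0r.
Qed.

Lemma measurable_pw c D : measurable_fun D (pw c).
Proof.
apply: measurable_funTS; apply: measurable_funM => //; apply: measurable_fun_powR.
exact: continuous_measurable_fun (tc_cont TC).
Qed.

(** Again a Beta integral, now between 0 and [X t]. Negative [c] is included because the remainder
    involves powers with exponents in []-1, 0[]. *)
Lemma integral_rlk_pw a c t : 0 < a -> -1 < c -> 0 < t -> t <= b ->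
  (\int[mu]_s (rlk a t s * pw c s)%:E = (pw (a + c) t)%:E)%E.
Proof.
move=> a0 c1 t0 tb.
have c0 : 0 < c + 1 by lra.
have Xt := tc_X_gt0 t0 tb.
pose k := (Gamma a)^-1 * (Gamma (c + 1))^-1.
pose G x := (X t - x) `^ (a - 1) * (x - X 0) `^ (c + 1 - 1).
have k0 : 0 <= k by rewrite !mulr_ge0// invr_ge0 ltW// Gamma_gt0.
transitivity (\int[mu]_(s in `]0%R, t[) (k%:E * (G (X s) * p s)%:E))%E.
  rewrite [RHS]integral_mkcond; apply: eq_integral => s _.
  rewrite patchE mem_setE in_itv/=.
  have [s0|s0] := ltP 0 s => /=; last by rewrite rlk_out ?mul0r// ltNge s0.
  rewrite /rlk; case: ifP => st; last by rewrite mul0r.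
  rewrite -EFinM; congr EFin; rewrite /k /G /pw (tc_X0 TC) subr0 addrK.
  by move: (Gamma a)^-1 (Gamma _)^-1 (_ `^ (a - 1)) (_ `^ c) => *; ring.
have mX : measurable_fun `]0, t[ X.
  by apply: measurable_funTS; exact: continuous_measurable_fun (tc_cont TC).
rewrite ge0_integralZl//=; last 2 first.
- apply/measurable_EFinP/measurable_funM; last exact: measurable_funTS (tc_measurable TC).
  by apply: measurable_funM; apply: measurable_fun_powR; apply: measurable_funB.
- by move=> s _; rewrite lee_fin !mulr_ge0 ?powR_ge0 ?(tc_ge0 TC).
have X0t : X 0 < X t by rewrite (tc_X0 TC).
rewrite (tc_subst TC)//; last 2 first.
- move=> x; rewrite in_itv/= => /andP[Xrx xXt].
  apply: cvgM.
    apply: (@continuous_comp _ _ _ (fun u : R => X t - u) (fun u : R => u `^ (a - 1))).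
      by apply: cvgB; [exact: cvg_cst|exact: cvg_id].
    by apply: continuous_powRl; rewrite subr_gt0.
  apply: (@continuous_comp _ _ _ (fun u : R => u - X 0) (fun u : R => u `^ (c + 1 - 1))).
    by apply: cvgB; [exact: cvg_id|exact: cvg_cst].
  by apply: continuous_powRl; rewrite subr_gt0.
- by move=> x _; rewrite mulr_ge0 ?powR_ge0.
rewrite integral_beta// -EFinM; congr EFin.
rewrite /pw /k (tc_X0 TC) subr0.
have -> : a + (c + 1) - 1 = a + c by ring.
have -> : a + (c + 1) = a + c + 1 by ring.
have ga : Gamma a != 0 by rewrite gt_eqF// Gamma_gt0.
have gc : Gamma (c + 1) != 0 by rewrite gt_eqF// Gamma_gt0.
have gac : Gamma (a + c + 1) != 0 by rewrite gt_eqF// Gamma_gt0// -addrA addr_gt0.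
move: (Gamma a) (Gamma (c + 1)) (Gamma (a + c + 1)) (_ `^ _) ga gc gac
  => u v w q ga gc gac.
by field; rewrite ga gc gac.
Qed.

Lemma pw_ge0 c s : -1 < c -> 0 <= pw c s.
Proof. by move=> c1; rewrite divr_ge0 ?powR_ge0// ltW// Gamma_gt0//; lra. Qed.

Lemma pw_at0 c : 0 < c -> pw c 0 = 0.
Proof. by move=> c0; rewrite /pw (tc_X0 TC) powR0 ?mul0r// gt_eqF. Qed.

Lemma pw0 : pw 0 = cst 1.
Proof. by apply/funext => s; rewrite /pw powRr0 add0r Gamma1 divr1. Qed.

Lemma rldef_pw a c t : 0 < a -> -1 < c -> 0 <= t -> t <= b -> rldef a (pw c) t.
Proof.
move=> a0 c1; rewrite le_eqVlt => /predU1P[<- _|t0 tb]; first exact: rldef_at0.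
apply/integrableP; split.
  by apply/measurable_EFinP; apply: measurable_rlkM; exact: measurable_pw.
have -> : (\int[mu]_s `|(rlk a t s * pw c s)%:E| = \int[mu]_s (rlk a t s * pw c s)%:E)%E.
  by apply: eq_integral => s _; rewrite gee0_abs// lee_fin mulr_ge0 ?rlk_ge0 ?pw_ge0.
by rewrite integral_rlk_pw// ltry.
Qed.

(** At [t = 0] the integral is 0, whereas [pw (a + c) 0] is 1 when [a + c = 0]; hence the
    disjunction. *)
Lemma rlint_pw a c t : 0 < a -> -1 < c -> 0 <= t -> t <= b -> 0 < a + c \/ 0 < t ->
  rlint a (pw c) t = pw (a + c) t.
Proof.
move=> a0 c1; rewrite le_eqVlt => /predU1P[<- _ [ac|]|t0 tb _]; last 2 first.
- by rewrite ltxx.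
- by rewrite /rlint /Rintegral integral_rlk_pw.
by rewrite rlint_at0 pw_at0.
Qed.

End riemann_liouville.

(** * Linearity, integrability criteria and behaviour at 0 *)

Section riemann_liouville_bounds.
Context {R : realType} (b : R) (X p : R -> R).
Implicit Types (a c g s t r M : R) (y z : R -> R).
Local Notation mu := (@lebesgue_measure R).
Hypothesis TC : time_change b X p.
Local Notation rlk := (rlk X p).
Local Notation rlint := (rlint X p).
Local Notation rldef := (rldef X p).
Local Notation pw := (pw X).

Let b0 : 0 < b. Proof. exact: tc_b_gt0 TC. Qed.

Lemma rldefD a y z t : rldef a y t -> rldef a z t ->
  rldef a (fun s => y s + z s) t.
Proof.
move=> dy dz; rewrite /rldef.
have := integrableD measurableT dy dz.
by apply: eq_integrable => // s _ /=; rewrite mulrDr.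
Qed.

Lemma rlintD a y z t : rldef a y t -> rldef a z t ->
  rlint a (fun s => y s + z s) t = rlint a y t + rlint a z t.
Proof.
move=> dy dz; rewrite /rlint -RintegralD//.
by apply: eq_Rintegral => s _; rewrite mulrDr.
Qed.

Lemma rldefZ a k y t : rldef a y t -> rldef a (fun s => k * y s) t.
Proof.
move=> dy; rewrite /rldef.
have := integrableZl measurableT k dy.
by apply: eq_integrable => // s _ /=; rewrite -EFinM mulrCA.
Qed.

Lemma rlintZ a k y t : rldef a y t ->
  rlint a (fun s => k * y s) t = k * rlint a y t.
Proof.
move=> dy; rewrite /rlint -RintegralZl//.
by apply: eq_Rintegral => s _; rewrite mulrCA.
Qed.

Lemma rldefB a y z t : rldef a y t -> rldef a z t ->
  rldef a (fun s => y s - z s) t.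
Proof.
move=> dy /(rldefZ (-1)) dz; have := rldefD dy dz.
by congr rldef; apply/funext => s; rewrite mulN1r.
Qed.

Lemma rlintB a y z t : rldef a y t -> rldef a z t ->
  rlint a (fun s => y s - z s) t = rlint a y t - rlint a z t.
Proof.
move=> dy dz; rewrite -[X in _ = _ + X]mulN1r -rlintZ// -rlintD//; last exact: rldefZ.
by congr rlint; apply/funext => s; rewrite mulN1r.
Qed.

Lemma rlint_sum a (n : nat) (P : pred nat) (k : nat -> R) (y : nat -> R -> R) t :
  (forall i, (i < n)%N -> P i -> rldef a (y i) t) ->
  rldef a (fun s => \sum_(i < n | P i) k i * y i s) t /\
  rlint a (fun s => \sum_(i < n | P i) k i * y i s) t =
    \sum_(i < n | P i) k i * rlint a (y i) t.
Proof.
elim: n => [_|n IH dy].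
  under eq_fun do rewrite big_ord0.
  rewrite big_ord0 /rldef /rlint; split.
    under eq_fun do rewrite mulr0; exact: integrable0.
  by under eq_Rintegral do rewrite mulr0; rewrite /Rintegral integral0_eq.
have [|dn en] := IH; first by move=> i ni; apply: dy; rewrite ltnS ltnW.
have E s : \sum_(i < n.+1 | P i) k i * y i s =
    \sum_(i < n | P i) k i * y i s + (if P n then k n else 0) * y n s.
  by rewrite big_mkcond big_ord_recr/= -big_mkcond; case: ifP; rewrite ?mul0r.
have -> : (fun s => \sum_(i < n.+1 | P i) k i * y i s) = (fun s =>
    \sum_(i < n | P i) k i * y i s + (if P n then k n else 0) * y n s).
  exact/funext.
rewrite big_mkcond big_ord_recr/= -big_mkcond/=.
have [Pn|Pn] := boolP (P n).
  have dyn := dy n (ltnSn n) Pn.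
  by split; [apply: rldefD => //; exact: rldefZ|rewrite rlintD ?en ?rlintZ//; exact: rldefZ].
by under eq_fun do rewrite mul0r addr0; rewrite en addr0.
Qed.

Lemma rldef_dom a c t r M y z : measurable_fun `]0, b[ y ->
  (forall s, 0 < s < b -> `|rlk a t s * y s| <= M * `|rlk c r s * z s|) ->
  rldef c z r -> rldef a y t.
Proof.
move=> my le dz.
apply: (le_integrable measurableT _ _ (integrableZl measurableT M (integrable_abse dz))).
  by apply/measurable_EFinP; exact: (measurable_rlkM TC).
move=> s _; rewrite -[(abse \o _) s]/(`|rlk c r s * z s|%:E) -EFinM /= lee_fin.
have [sb|sb] := boolP (0 < s < b); first by rewrite (le_trans (le s sb))// ler_norm.
by rewrite !(rlk_out TC)// !mul0r !normr0 mulr0 normr0.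
Qed.

(** As [rlk 1 b] is [p], this is integrability with respect to [p(s) ds] on []0, b[]. *)
Definition pint y : Prop := measurable_fun `]0, b[ y /\ rldef 1 y b.

(** From order 1 on the kernel has no singularity at [s = t]. Consequently [pint] makes all
    integrals of order at least 1 converge at every time. *)
Lemma rlk_le1 a t s : 1 <= a -> 0 <= t -> t <= b ->
  rlk a t s <= X t `^ (a - 1) / Gamma a * rlk 1 b s.
Proof.
move=> a1 t0 tb; have a0 : 0 < a by rewrite (lt_le_trans ltr01).
have c0 : 0 <= X t `^ (a - 1) / Gamma a.
  by rewrite divr_ge0 ?powR_ge0// ltW// Gamma_gt0.
have [/andP[s0 sb]|sb] := boolP (0 < s < b); last by rewrite !(rlk_out TC)// mulr0.
rewrite (rlk1 TC) /rlk; case: ifP => st; last by rewrite mulr_ge0 ?(tc_ge0 TC).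
have p0 := tc_ge0 TC s.
have Xs0 : 0 <= X s by rewrite (tc_X_ge0 TC)// ltW.
have Xst : X s <= X t by rewrite (tc_leX TC)// ltW.
rewrite mulrCA [leRHS]mulrC ler_wpM2l// mulrC ler_wpM2r ?invr_ge0 ?(ltW (Gamma_gt0 a0))//.
by apply: ge0_ler_powR; rewrite ?nnegrE ?subr_ge0//; lra.
Qed.

Lemma rldef_ge1 a y t : 1 <= a -> 0 <= t -> t <= b -> pint y -> rldef a y t.
Proof.
move=> a1 t0 tb [my dy]; have a0 : 0 < a by rewrite (lt_le_trans ltr01).
apply: (rldef_dom (M := X t `^ (a - 1) / Gamma a) my _ dy) => s _.
rewrite !normrM mulrA ler_wpM2r// !ger0_norm ?(rlk_ge0 TC)//.
exact: rlk_le1.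
Qed.

Lemma rldef_bounded a y t M : 0 < a -> 0 <= t -> t <= b ->
  measurable_fun `]0, b[ y -> (forall s, 0 < s < b -> `|y s| <= M) ->
  rldef a y t.
Proof.
move=> a0 t0 tb my yM.
apply: (rldef_dom (M := M) my _ (rldef_pw TC a0 (ltrN10 R) t0 tb)) => s sb.
by rewrite pw0/= mulr1 normrM mulrC ler_wpM2r// yM.
Qed.

Lemma pint_bounded y M : measurable_fun `]0, b[ y ->
  (forall s, 0 < s < b -> `|y s| <= M) -> pint y.
Proof. by move=> my yM; split=> //; apply: rldef_bounded yM => //; exact: ltW. Qed.

Lemma pint_pw c : -1 < c -> pint (pw c).
Proof.
by move=> c1; split; [exact: (measurable_pw TC)|apply: (rldef_pw TC) => //; exact: ltW].
Qed.

Lemma pintD y z : pint y -> pint z -> pint (fun s => y s + z s).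
Proof. by move=> [my dy] [mz dz]; split; [exact: measurable_funD|exact: rldefD]. Qed.

Lemma pintZ k y : pint y -> pint (fun s => k * y s).
Proof. by move=> [my dy]; split; [exact: measurable_funM|exact: rldefZ]. Qed.

Lemma pint_sum (n : nat) (P : pred nat) (k : nat -> R) (y : nat -> R -> R) :
  (forall i, (i < n)%N -> P i -> pint (y i)) ->
  pint (fun s => \sum_(i < n | P i) k i * y i s).
Proof.
move=> dy; split; last by apply: (rlint_sum _ _).1 => i ni Pi; have [] := dy i ni Pi.
have -> : (fun s => \sum_(i < n | P i) k i * y i s) =
    (fun s => \sum_(i < n) (if P i then k i * y i s else 0)).
  by apply/funext => s; rewrite big_mkcond.
apply: measurable_sum => i; have [Pi|//] := boolP (P i).
by apply: measurable_funM => //; have [] := dy i (ltn_ord i) Pi.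
Qed.

(** One further integration has order [1 + a], at which convergence is automatic; the semigroup law
    returns it to the inner integral. *)
Lemma pint_rlint a y : 0 < a -> pint y -> pint (rlint a y).
Proof.
move=> a0 py; have [my dy] := py; split.
  by apply: measurable_funTS; exact: (measurable_rlint TC).
have [] // := rlint_comp TC ltr01 a0 (lexx b) my _.
by apply: rldef_ge1 => //; rewrite ?lerDl ltW.
Qed.

Lemma eq_pint y z : (forall s, 0 < s < b -> y s = z s) -> pint y -> pint z.
Proof.
move=> yz [my dy]; split.
  apply: eq_measurable_fun my => s; rewrite inE/= in_itv/=; exact: yz.
by apply: (eq_rldef TC) dy => s sb _; exact: yz.
Qed.

Lemma itvcc_continuous y : {within `[0, b], continuous y} ->
  measurable_fun `]0, b[ y /\ exists M, forall s, 0 <= s <= b -> `|y s| <= M.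
Proof.
move=> cy; split.
  apply: (@measurable_funS _ _ _ _ `[0, b]) => //; first exact: subset_itv_oo_cc.
  exact: subspace_continuous_measurable_fun.
have := continuous_compact cy (@segment_compact _ 0 b).
move=> /compact_bounded[M [_ /(_ (M + 1))]]; rewrite ltrDl ltr01 => /(_ isT) HM.
exists (M + 1) => s sb; apply: HM; exists s => //=.
Qed.

Lemma pint_continuous y : {within `[0, b], continuous y} -> pint y.
Proof.
move=> /itvcc_continuous[my [M yM]]; apply: (pint_bounded my (M := M)) => s sb.
by apply: yM; lra.
Qed.

Lemma rldef_continuous a y t : 0 < a -> 0 <= t -> t <= b ->
  {within `[0, b], continuous y} -> rldef a y t.
Proof.
move=> a0 t0 tb /itvcc_continuous[my [M yM]].
by apply: (rldef_bounded a0 t0 tb my (M := M)) => s sb; apply: yM; lra.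
Qed.

Lemma norm_rlint_le a y t M : 0 < a -> 0 <= t -> t <= b -> rldef a y t ->
  (forall s, 0 < s < b -> s < t -> `|y s| <= M) -> `|rlint a y t| <= M * pw a t.
Proof.
move=> a0 t0 tb dy yM.
apply: le_trans (le_normr_Rintegral measurableT dy) _.
have dM := rldefZ M (rldef_pw TC a0 (ltrN10 R) t0 tb).
move: t0; rewrite le_eqVlt => /predU1P[t0|t0].
  rewrite -t0 (pw_at0 TC)// mulr0 (@eq_Rintegral _ _ _ _ _ (cst 0)).
    by rewrite /Rintegral integral0_eq.
  move=> s _; have [/andP[s0 _]|sb] := boolP (0 < s < b).
    by rewrite /rlk ltNge (ltW s0)/= mul0r normr0.
  by rewrite (rlk_out TC)// mul0r normr0.
rewrite -{2}(addr0 a) -(rlint_pw TC a0 (ltrN10 R) (ltW t0) tb); last by left; rewrite addr0.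
rewrite -rlintZ; last exact: (rldef_pw TC a0 (ltrN10 R) (ltW t0) tb).
apply: le_Rintegral => //.
  by have := integrable_abse dy; apply: eq_integrable.
move=> s _; rewrite normrM pw0/= mulr1 ger0_norm ?(rlk_ge0 TC)//.
have [sb|sb] := boolP (0 < s < b); last by rewrite (rlk_out TC)// !mul0r.
have [st|st] := ltP s t; first by rewrite ler_wpM2l ?(rlk_ge0 TC)// yM.
by rewrite /rlk ltNge st/= !mul0r.
Qed.

(** Near 0 the function differs from the constant [y 0] by at most [e * Gamma (g + 1)], and that
    constant integrates to [y 0 * pw g]. *)
Lemma rlint_asymp_continuous g y : 0 < g -> {within `[0, b], continuous y} ->
  forall e, 0 < e -> exists2 d, 0 < d & forall t, 0 < t < d -> t <= b ->
    `|rlint g y t - y 0 * pw g t| <= e * X t `^ g.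
Proof.
move=> g0 cy e e0.
have G0 : 0 < Gamma (g + 1) by rewrite Gamma_gt0//; lra.
have /(continuous_within_itvP _ b0) [_ cy0 _] := cy.
have eG : 0 < e * Gamma (g + 1) by rewrite mulr_gt0.
have /cvgrPdist_le/(_ _ eG)[d /= d0 Hd] := cy0.
exists d => // t /andP[t0 td] tb.
have dy : rldef g y t by apply: rldef_continuous => //; exact: ltW.
have d1 : rldef g (fun s => y 0 * pw 0 s) t.
  by apply: rldefZ; apply: (rldef_pw TC) => //; exact: ltW.
have -> : rlint g y t - y 0 * pw g t = rlint g (fun s => y s - y 0 * pw 0 s) t.
  rewrite rlintB// rlintZ; last by apply: (rldef_pw TC) => //; exact: ltW.
  by rewrite (rlint_pw TC) ?addr0//; [exact: ltW|left].
have -> : e * X t `^ g = e * Gamma (g + 1) * pw g t.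
  rewrite /pw; move: (X t `^ g) (Gamma (g + 1)) G0 => q u u0.
  by field; rewrite gt_eqF.
apply: norm_rlint_le => //; [exact: ltW|exact: rldefB|].
move=> s /andP[s0 sb] st; rewrite pw0/= mulr1 distrC; apply: Hd => //=.
by rewrite sub0r normrN gtr0_norm//; exact: lt_trans td.
Qed.

(** The kernel is at most [X t ^ g / Gamma (g + 1)] times [p], and the integral of [|p y|] over
    [[0, t]] tends to 0. This yields little-o for merely integrable [y], and also for [g = 0]. *)
Lemma rlint_asymp_pint g y : 0 <= g -> pint y ->
  forall e, 0 < e -> exists2 d, 0 < d & forall t, 0 < t < d -> t <= b ->
    `|rlint (g + 1) y t| <= e * X t `^ g.
Proof.
move=> g0 [my dy] e e0.
have G0 : 0 < Gamma (g + 1) by rewrite Gamma_gt0//; lra.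
have eG : 0 < e * Gamma (g + 1) by rewrite mulr_gt0.
pose f s := `|p s * y s|.
have if_ : mu.-integrable `[0, b] (EFin \o f).
  apply: (@integrableS _ _ _ _ setT) => //.
  have := integrable_abse dy; apply: eq_integrable => // s _ /=.
  by rewrite (rlk1 TC).
have := parameterized_integral_cvg_left b0 if_.
move=> /cvgrPdist_le/(_ _ eG)[d /= d0 Hd].
exists d => // t /andP[t0 td] tb.
have /= := Hd t; rewrite sub0r normrN gtr0_norm// => /(_ td).
rewrite sub0r normrN ger0_norm; last first.
  by apply: Rintegral_ge0 => s _; exact: normr_ge0.
move=> le1.
have dgy : rldef (g + 1) y t by apply: rldef_ge1 => //; [lra|exact: ltW].
apply: le_trans (le_normr_Rintegral measurableT dgy) _.
have -> : e * X t `^ g = X t `^ g / Gamma (g + 1) * (e * Gamma (g + 1)).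
  by rewrite mulrA mulrAC divfK ?gt_eqF// mulrC.
apply: le_trans (ler_wpM2l _ le1); last by rewrite divr_ge0 ?powR_ge0// ltW.
have ift : mu.-integrable `[0, t] (EFin \o f).
  by apply: integrableS if_ => // s /=; rewrite !in_itv/=; lra.
rewrite -RintegralZl// [leRHS]Rintegral_mkcond; apply: le_Rintegral => //.
- by have := integrable_abse dgy; apply: eq_integrable.
- have m0t : measurable (`[0, t] : set (g_sigma_algebraType R.-ocitv.-measurable)).
    exact: measurable_itv.
  have /(integrable_mkcond _ m0t) := integrableZl m0t (X t `^ g / Gamma (g + 1)) ift.
  apply: eq_integrable => // s _ /=; rewrite !patchE.
  by case: ifP.
move=> s _; rewrite patchE mem_setE in_itv/= normrM ger0_norm ?(rlk_ge0 TC)//; last lra.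
have c0 : 0 <= X t `^ g / Gamma (g + 1) * f s.
  by apply: mulr_ge0; [rewrite divr_ge0 ?powR_ge0// ltW|exact: normr_ge0].
have [/andP[s0 sb]|sb] := boolP (0 < s < b); last first.
  by rewrite (rlk_out TC)// mul0r; case: ifP.
have [st|st] := ltP s t; last by rewrite /rlk ltNge st/= mul0r; case: ifP.
rewrite (ltW s0) (ltW st)/= /f normrM mulrA ler_wpM2r//.
have := @rlk_le1 (g + 1) t s; rewrite addrK (rlk1 TC) (ger0_norm (tc_ge0 TC s)).
by apply => //; [lra|exact: ltW].
Qed.

End riemann_liouville_bounds.

(** * Left differentiation of Riemann-Liouville integrals *)

Section powR_difference_quotient.
Context {R : realType}.
Implicit Types a c d x : R.

Lemma bernoulli_le x (n : nat) : 0 <= x <= 1 -> 1 - n%:R * x <= (1 - x) ^+ n.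
Proof.
move=> /andP[x0 x1]; elim: n => [|n IH]; first by rewrite mul0r subr0 expr0.
rewrite exprS; have x1' : 0 <= 1 - x by lra.
apply: le_trans (ler_wpM2l x1' IH).
have : 0 <= n%:R * x * x by rewrite !mulr_ge0.
rewrite -[n.+1]addn1 natrD; move: (n%:R : R) => m; lra.
Qed.

(* An integer n >= a makes the Bernoulli bound valid on both sides of a = 1. *)
Lemma powR_diff_le a c d : 0 < a -> 0 <= d <= c -> 0 < c ->
  c `^ a - (c - d) `^ a <= (Num.truncn a).+1%:R * d * c `^ (a - 1).
Proof.
move=> a0 /andP[d0 dc] c0; set n := (Num.truncn a).+1.
have x0 : 0 <= d / c by rewrite divr_ge0// ltW.
have x1 : d / c <= 1 by rewrite ler_pdivrMr// mul1r.
have le1 : 1 - n%:R * (d / c) <= (1 - d / c) `^ a.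
  have [dcE|dcE] := eqVneq (d / c) 1.
    by rewrite dcE mulr1; apply: le_trans (powR_ge0 _ _); rewrite subr_le0 ler1n.
  apply: (le_trans (@bernoulli_le _ n _)); first by rewrite x0.
  have x1' : 0 < 1 - d / c by rewrite subr_gt0 lt_neqAle dcE.
  rewrite -powR_mulrn ?(ltW x1')//; apply: ger_powR; first by lra.
  exact/ltW/truncnS_gt.
have -> : c - d = c * (1 - d / c) by rewrite mulrBr mulr1 mulrCA divff ?gt_eqF// mulr1.
rewrite powRM ?(ltW c0)//; last lra.
have -> : n%:R * d * c `^ (a - 1) = c `^ a * (n%:R * (d / c)).
  rewrite -(mulr_powRB1 (ltW c0) a0); move: (c `^ _) (n%:R : R) => q m.
  by field; rewrite gt_eqF.
by rewrite -{1}(mulr1 (c `^ a)) -mulrBr ler_wpM2l ?powR_ge0//; lra.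
Qed.

Lemma powR_quot_cvg a c (d : nat -> R) : 0 < c -> (forall k, 0 < d k) ->
  d k @[k --> \oo] --> 0 ->
  (c `^ a - (c - d k) `^ a) / d k @[k --> \oo] --> a * c `^ (a - 1).
Proof.
move=> c0 d0 dc.
have [dv dE] := is_derive1_powR a c0.
have := dv; rewrite /derivable => /cvg_ex[l L].
have lE : l = a * c `^ (a - 1) by rewrite -dE; apply/esym/cvg_lim.
have dk : (forall k, - d k != 0) /\ - d k @[k --> \oo] --> (0 : R).
  split; last by rewrite -oppr0; exact: cvgN.
  by move=> k; rewrite oppr_eq0 gt_eqF.
rewrite -lE.
have := (cvgr_dnbhsP (fun h : R => h^-1 *: (((@powR R)^~ a \o shift c) (h *: 1)
  - c `^ a)) 0 l).1 L _ dk.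
apply: cvg_trans; apply: near_eq_cvg; apply: nearW => k /=.
by rewrite /GRing.scale/= mulr1 (addrC (- _)) invrN mulNr -mulrN opprB mulrC.
Qed.

End powR_difference_quotient.

Section left_derivative.
Context {R : realType} (b : R) (X p : R -> R).
Implicit Types (a c g s t r M : R) (y z : R -> R).
Local Notation mu := (@lebesgue_measure R).
Hypothesis TC : time_change b X p.
Local Notation rlk := (rlk X p).
Local Notation rlint := (rlint X p).
Local Notation rldef := (rldef X p).
Local Notation pint := (pint b X p).

Lemma Rintegral_dominated (q_ : nat -> R -> R) (q g : R -> R) :
  (forall n, measurable_fun setT (q_ n)) -> measurable_fun setT q ->
  (forall s, q_ n s @[n --> \oo] --> q s) ->
  mu.-integrable setT (EFin \o g) -> (forall n s, `|q_ n s| <= g s) ->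
  (\int[mu]_s q_ n s) @[n --> \oo] --> \int[mu]_s q s.
Proof.
move=> mq_ mq cq ig qg.
have [||||| iq _ cv] := @dominated_convergence _ _ R mu setT measurableT
  (fun n s => (q_ n s)%:E) (EFin \o q) (EFin \o g).
- by move=> n; apply/measurable_EFinP; exact: mq_.
- by apply/measurable_EFinP; exact: mq.
- by apply: aeW => s _; apply: cvg_EFin; [exact: nearW|exact: cq].
- exact: ig.
- by apply: aeW => s n _; rewrite lee_fin.
have fq : (\int[mu]_s (q s)%:E)%E \is a fin_num by exact: integrable_fin_num.
by apply: fine_cvg; rewrite fineK.
Qed.

(** A sequence, as dominated convergence requires; [k.+2] makes it start at [t / 2], inside []0,
    t[]. *)
Definition leftseq t (k : nat) : R := t - t / k.+2%:R.

Lemma leftseq_itv t k : 0 < t -> 0 < leftseq t k < t.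
Proof.
move=> t0; have : 0 < t / k.+2%:R by rewrite divr_gt0.
have : t / k.+2%:R < t by rewrite ltr_pdivrMr// ltr_pMr// ltr1n.
by rewrite /leftseq; move: (t / _) => d; lra.
Qed.

Lemma leftseq_cvg t : leftseq t k @[k --> \oo] --> t.
Proof.
rewrite -[X in _ --> X]subr0 -(mulr0 t); apply: cvgB; first exact: cvg_cst.
apply: cvgM; first exact: cvg_cst.
by rewrite (@cvg_shiftS _ (fun n : nat => n.+1%:R^-1 : R)); exact: cvg_harmonic.
Qed.

(** The majorant for dominated convergence: difference quotients in [X] of the kernel of order
    [a + 1] are bounded, uniformly in [u], by a multiple of the kernel of order [a] at [t]. *)
Lemma rlk_diff_le a u t s : 0 < a -> 0 <= u -> u < t -> t <= b ->
  `|rlk (a + 1) t s - rlk (a + 1) u s| <=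
    (X t - X u) * ((Num.truncn a).+1%:R / a * rlk a t s).
Proof.
move=> a0 u0 ut tb; have ga : 0 < Gamma a by rewrite Gamma_gt0.
have Xut : 0 < X t - X u by rewrite subr_gt0 (tc_ltX TC).
have n1 : 1 <= (Num.truncn a).+1%:R :> R by rewrite ler1n.
set n : R := (Num.truncn a).+1%:R in n1 *.
have rhs0 s' : 0 <= (X t - X u) * (n / a * rlk a t s').
  apply: mulr_ge0; first exact: ltW.
  apply: mulr_ge0; last exact: (rlk_ge0 TC).
  by rewrite divr_ge0 ?ler0n// ltW.
have [/andP[s0 sb]|sb] := boolP (0 < s < b); last first.
  by rewrite !(rlk_out TC)// subrr normr0 !mulr0.
have [st|st] := ltP s t; last first.
  rewrite /rlk !ltNge st (le_trans (ltW ut) st)/= subrr normr0 !mulr0//.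
have Xst : 0 < X t - X s by rewrite subr_gt0 (tc_ltX TC)// ltW.
have p0 := tc_ge0 TC s.
rewrite /rlk st addrK GammaD1//.
(* For [u <= s < t] only the first kernel survives, and [X t - X s <= X t - X u] supplies the small
   factor. For [s < u] it comes from [powR_diff_le]. *)
have [su|us] := ltP s u; last first.
  have le1 : (X t - X s) <= X t - X u by rewrite lerD2l lerN2 (tc_leX TC)// ltW.
  rewrite subr0 ger0_norm ?mulr_ge0 ?powR_ge0 ?invr_ge0 ?mulr_ge0 ?(ltW a0) ?(ltW ga)//.
  rewrite -(mulr_powRB1 (ltW Xst) a0).
  have := powR_ge0 (X t - X s) (a - 1).
  move: (_ `^ _) (Gamma a) ga Xst le1 Xut => q G G0 Xst le1 Xut q0.
  have -> : (a * G)^-1 * (p s * ((X t - X s) * q)) = (X t - X s) * (p s * q / G / a).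
    by field; rewrite !gt_eqF.
  have -> : (X t - X u) * (n / a * (G^-1 * (p s * q))) = (X t - X u) * n * (p s * q / G / a).
    by field; rewrite !gt_eqF.
  apply: ler_wpM2r; first by rewrite !divr_ge0 ?mulr_ge0// ltW.
  by rewrite (le_trans le1)// ler_peMr// ltW.
have Xsu : X s <= X u by rewrite (tc_leX TC)// ltW// ?(lt_le_trans ut).
have q1 := @powR_diff_le R a (X t - X s) (X t - X u) a0.
have q2 : (X u - X s) `^ a <= (X t - X s) `^ a.
  by apply: ge0_ler_powR; rewrite ?nnegrE ?subr_ge0 ?(ltW a0) ?(ltW Xst)//; lra.
have -> : (a * Gamma a)^-1 * (p s * (X t - X s) `^ a) - (a * Gamma a)^-1 * (p s * (X u - X s) `^ a)
    = p s / (a * Gamma a) * ((X t - X s) `^ a - (X u - X s) `^ a).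
  by move: (_ `^ _) (_ `^ _) (_^-1) => *; ring.
have pg : 0 <= p s / (a * Gamma a) by rewrite divr_ge0// ltW// mulr_gt0.
rewrite ger0_norm; last by rewrite mulr_ge0// subr_ge0.
have {}q1 : (X t - X s) `^ a - (X u - X s) `^ a <= n * (X t - X u) * (X t - X s) `^ (a - 1).
  have -> : X u - X s = X t - X s - (X t - X u) by ring.
  by apply: q1 => //; lra.
apply: le_trans (ler_wpM2l pg q1) _.
move: (_ `^ (a - 1)) (Gamma a) ga => q G G0.
rewrite le_eqVlt; apply/orP; left; apply/eqP; field.
by rewrite !gt_eqF.
Qed.

(** Approaching [t] from the left keeps all quotients dominated by the kernel [rlk a t], against
    which [y] is integrable by hypothesis; nothing is assumed about later times. *)
Lemma rlint_left_derivative a y t : 0 < a -> 0 < t -> t <= b -> pint y ->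
  rldef a y t ->
  (rlint (a + 1) y t - rlint (a + 1) y (leftseq t k)) / (X t - X (leftseq t k))
    @[k --> \oo] --> rlint a y t.
Proof.
move=> a0 t0 tb py dy; have [my _] := py.
have utk k := leftseq_itv k t0.
have Xu k : 0 < X t - X (leftseq t k).
  by have := utk k => /andP[/ltW u0 ut]; rewrite subr_gt0 (tc_ltX TC).
have du k : rldef (a + 1) y (leftseq t k).
  by apply: (rldef_ge1 TC) => //; have := utk k; lra.
have dt : rldef (a + 1) y t by apply: (rldef_ge1 TC) => //; lra.
pose q k s := (rlk (a + 1) t s - rlk (a + 1) (leftseq t k) s) / (X t - X (leftseq t k)) * y s.
have qE k : \int[mu]_s (q k s) =
    (rlint (a + 1) y t - rlint (a + 1) y (leftseq t k)) / (X t - X (leftseq t k)).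
  have -> : rlint (a + 1) y t - rlint (a + 1) y (leftseq t k) =
      \int[mu]_s (rlk (a + 1) t s * y s - rlk (a + 1) (leftseq t k) s * y s).
    by rewrite RintegralB//; exact: (du k).
  rewrite -RintegralZr//; last first.
    by have := integrableB measurableT dt (du k); apply: eq_integrable.
  by apply: eq_Rintegral => s _; rewrite /q; move: (_^-1) => *; ring.
under eq_fun do rewrite -qE.
pose C : R := (Num.truncn a).+1%:R / a.
apply: (@Rintegral_dominated q _ (fun s => C * `|rlk a t s * y s|)).
- move=> k; have := measurable_funB (measurable_rlkM TC (a + 1) t my)
    (measurable_rlkM TC (a + 1) (leftseq t k) my).
  move=> /(measurable_funM (measurable_cst (X t - X (leftseq t k))^-1)).
  by congr measurable_fun; apply/funext => s; rewrite /q/=; move: (_^-1) => *; ring.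
- exact: (measurable_rlkM TC).
- move=> s; rewrite /q; apply: cvgM; last exact: cvg_cst.
  have [/andP[s0 sb]|sb] := boolP (0 < s < b); last first.
    have -> : rlk a t s = 0 by exact: (rlk_out TC).
    apply: cvg_near_cst; apply: nearW => k /=.
    by rewrite !(rlk_out TC)// subrr mul0r.
  have [st|st] := ltP s t; last first.
    have -> : rlk a t s = 0 by rewrite /rlk ltNge st.
    apply: cvg_near_cst; apply: nearW => k /=.
    have := utk k => /andP[_ ut].
    by rewrite /rlk !ltNge st (le_trans (ltW ut) st)/= subrr mul0r.
  have Xst : 0 < X t - X s by rewrite subr_gt0 (tc_ltX TC)// ltW.
  have ga : 0 < Gamma a by rewrite Gamma_gt0.
  have X0 : X t - X (leftseq t k) @[k --> \oo] --> 0.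
    rewrite -(subrr (X t)); apply: cvgB; first exact: cvg_cst.
    exact: (cvg_comp (leftseq t) X (@leftseq_cvg t) (@tc_cont _ _ _ _ TC t)).
  have Q := powR_quot_cvg (a := a) Xst Xu X0.
  have -> : rlk a t s = (a * Gamma a)^-1 * p s * (a * (X t - X s) `^ (a - 1)).
    rewrite /rlk st; move: (_ `^ _) (Gamma a) ga => u G G0; field.
    by rewrite !gt_eqF.
  apply: cvg_trans (cvgM (cvg_cst ((a * Gamma a)^-1 * p s)) Q).
  apply: near_eq_cvg; near=> k.
  have su : s < leftseq t k.
    by near: k; apply: (cvgr_gt t (@leftseq_cvg t)).
  rewrite /rlk st su addrK GammaD1//=.
  have -> : X t - X s - (X t - X (leftseq t k)) = X (leftseq t k) - X s by ring.
  by move: (_ `^ _) (_ `^ _) (_^-1) (_^-1) => *; ring.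
- by have := integrableZl measurableT C (integrable_abse dy); apply: eq_integrable.
- move=> k s; rewrite /q normrM normrM normfV (gtr0_norm (Xu k)).
  have /andP[/ltW u0 ut] := utk k.
  have := @rlk_diff_le a (leftseq t k) t s a0 u0 ut tb.
  rewrite -ler_pdivrMl// mulrC => le1.
  rewrite normrM (ger0_norm (rlk_ge0 TC t s a0)) mulrA.
  by apply: ler_wpM2r => //.
Unshelve. all: by end_near. Qed.

(* The limiting case a = 0 of [rlint_left_derivative]. *)
Lemma rlint1_left_derivative y t : 0 < t -> t <= b -> pint y ->
  {for t, continuous y} \/ y s @[s --> t^'-] --> y t ->
  (rlint 1 y t - rlint 1 y (leftseq t k)) / (X t - X (leftseq t k))
    @[k --> \oo] --> y t.
Proof.
move=> t0 tb py cy.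
have {}cy : y s @[s --> t^'-] --> y t by case: cy => // /cvg_at_left_filter.
have utk k := leftseq_itv k t0.
have Xu k : 0 < X t - X (leftseq t k).
  by have := utk k => /andP[/ltW u0 ut]; rewrite subr_gt0 (tc_ltX TC).
apply/cvgrPdist_le => e e0.
have /cvgrPdist_le/(_ _ e0)[d /= d0 Hd] := cy.
near=> k.
have /andP[u0 ut] := utk k; have u0' := ltW u0; have t0' := ltW t0.
have ub : leftseq t k <= b := ltW (lt_le_trans ut tb).
have tu : t - leftseq t k < d.
  rewrite ltrBlDl -ltrBlDr; near: k.
  by apply: (cvgr_gt t (@leftseq_cvg t)); rewrite gtrBl.
have dyt r : 0 <= r -> r <= b -> rldef 1 y r by move=> *; exact: (rldef_ge1 TC).
have dct r : 0 <= r -> r <= b -> rldef 1 (pw X 0) r.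
  by move=> *; apply: (rldef_pw TC).
have E1 r : 0 <= r -> r <= b -> rlint 1 (fun s => y s - y t * pw X 0 s) r =
    rlint 1 y r - y t * X r.
  move=> r0 rb; rewrite rlintB ?rlintZ//; [|exact: dct|exact: dyt|by apply: rldefZ; exact: dct].
  rewrite (rlint_pw TC) ?addr0//; last by left.
  by rewrite /pw (GammaD1 ltr01) Gamma1 mulr1 divr1 powRr1// (tc_X_ge0 TC).
have E2 : y t - (rlint 1 y t - rlint 1 y (leftseq t k)) / (X t - X (leftseq t k)) =
    - (rlint 1 (fun s => y s - y t * pw X 0 s) t -
       rlint 1 (fun s => y s - y t * pw X 0 s) (leftseq t k)) / (X t - X (leftseq t k)).
  have Xn : X t - X (leftseq t k) != 0 by rewrite gt_eqF.
  rewrite !E1//; move: (rlint _ _ _) (rlint _ _ _) (y t) (X t) (X _) Xn => A B C D E Xn.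
  by field.
rewrite E2 mulNr normrN normrM normfV (gtr0_norm (Xu k)) ler_pdivrMr ?Xu//.
pose w s := y s - y t * pw X 0 s.
have dw r : 0 <= r -> r <= b -> rldef 1 w r.
  by move=> r0 rb; apply: rldefB; [exact: dyt|apply: rldefZ; exact: dct].
(* This is [p] on [[leftseq t k, t[] and 0 elsewhere, so its integral is the increment of [X] and
   only values of [y] close to [t] enter. *)
pose q s := rlk 1 t s - rlk 1 (leftseq t k) s.
have q0 s : 0 <= q s.
  rewrite /q subr_ge0 /rlk; have [su|us] := ltP s (leftseq t k).
    by rewrite (lt_trans su ut) !subrr !powRr0.
  by case: ifP => // _; rewrite Gamma1 invr1 mul1r subrr powRr0 mulr1 (tc_ge0 TC).
have iqw : mu.-integrable setT (fun s => (q s * w s)%:E).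
  have := integrableB measurableT (dw t t0' tb) (dw _ u0' ub).
  by apply: eq_integrable => // s _; rewrite /= -EFinB -mulrBl.
have iq : mu.-integrable setT (fun s => (e * q s)%:E).
  have := integrableB measurableT (dct t t0' tb) (dct _ u0' ub).
  move=> /(integrableZl measurableT e).
  by apply: eq_integrable => // s _; rewrite /= -EFinB -mulrBl pw0/= mulr1 -EFinM.
have -> : rlint 1 w t - rlint 1 w (leftseq t k) = \int[mu]_s (q s * w s).
  under eq_Rintegral do rewrite mulrBl.
  by rewrite RintegralB//; exact: dw.
apply: le_trans (le_normr_Rintegral measurableT iqw) _.
have -> : e * (X t - X (leftseq t k)) = \int[mu]_s (e * q s).
  have X1 r : 0 <= r -> r <= b -> X r = rlint 1 (pw X 0) r.
    move=> r0 rb; rewrite (rlint_pw TC) ?addr0//; last by left.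
    by rewrite /pw (GammaD1 ltr01) Gamma1 mulr1 divr1 powRr1// (tc_X_ge0 TC).
  rewrite (X1 t)// (X1 (leftseq t k))//.
  have -> : rlint 1 (pw X 0) t - rlint 1 (pw X 0) (leftseq t k) = \int[mu]_s q s.
    rewrite /rlint (_ : \int[mu]_s q s = \int[mu]_s (rlk 1 t s * pw X 0 s -
      rlk 1 (leftseq t k) s * pw X 0 s)); last first.
      by apply: eq_Rintegral => s _; rewrite -mulrBl pw0/= mulr1.
    by rewrite RintegralB//; exact: dct.
  rewrite RintegralZl//.
  have := integrableB measurableT (dct t t0' tb) (dct _ u0' ub).
  by apply: eq_integrable => // s _; rewrite /= -EFinB -mulrBl pw0/= mulr1.
apply: le_Rintegral => //.
  by have := integrable_abse iqw; apply: eq_integrable.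
move=> s _; rewrite normrM (ger0_norm (q0 s)) mulrC.
have [su|us] := ltP s (leftseq t k).
  by rewrite /q /rlk su (lt_trans su ut) !subrr !powRr0 subrr !mulr0.
have [st|st] := ltP s t; last first.
  by rewrite /q /rlk !ltNge st us/= subrr !mulr0.
rewrite ler_wpM2r// /w pw0/= mulr1 distrC; apply: Hd => //=.
by rewrite gtr0_norm ?subr_gt0//; apply: le_lt_trans tu; rewrite lerD2l lerN2.
Unshelve. all: by end_near. Qed.

(** Each left differentiation lowers both orders by one. Down to orders [1 + a] and 1 this works at
    all times; the last one takes place at [t] alone, and there it uses convergence at order [a] and
    left continuity of [h]. *)
Lemma rlint_injective a y h (n : nat) t : 0 < a -> pint y -> pint h ->
  (forall t, 0 <= t -> t <= b -> rlint (n.+1%:R + a) y t = rlint n.+1%:R h t) ->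
  0 < t -> t <= b -> rldef a y t -> h s @[s --> t^'-] --> h t ->
  rlint a y t = h t.
Proof.
move=> a0 py ph; elim: n => [|n IH] yh t0 tb dy ch.
  have := rlint_left_derivative a0 t0 tb py dy.
  have hL := rlint1_left_derivative t0 tb ph (or_intror ch).
  move=> yL; apply: (cvg_unique _ yL) => //; apply: cvg_trans hL.
  apply: near_eq_cvg; apply: nearW => k /=; have := leftseq_itv k t0 => /andP[u0 ut].
  rewrite [a + 1]addrC -!yh ?(ltW t0) ?(ltW u0)//.
  exact: (ltW (lt_le_trans ut tb)).
apply: IH; rewrite ?t0 ?tb // => r; rewrite le_eqVlt => /predU1P[<- _|r0 rb].
  by rewrite !(rlint_at0 TC).
have n0 : 0 < n.+1%:R :> R by rewrite ltr0n.
have n1 : 1 <= n.+1%:R :> R by rewrite ler1n.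
have dyr : rldef (n.+1%:R + a) y r by apply: (rldef_ge1 TC) => //; [lra|exact: ltW].
have dhr : rldef n.+1%:R h r by apply: (rldef_ge1 TC) => //; exact: ltW.
have yL := rlint_left_derivative (addr_gt0 n0 a0) r0 rb py dyr.
have hL := rlint_left_derivative n0 r0 rb ph dhr.
apply: (cvg_unique _ yL) => //; apply: cvg_trans hL.
apply: near_eq_cvg; apply: nearW => k /=; have := leftseq_itv k r0 => /andP[u0 ur].
have -> : n.+1%:R + a + 1 = n.+2%:R + a by rewrite -[n.+2]addn1 natrD; ring.
have -> : n.+1%:R + 1 = n.+2%:R :> R by rewrite -[n.+2]addn1 natrD.
rewrite -!yh ?(ltW r0) ?(ltW u0)//.
exact: (ltW (lt_le_trans ur rb)).
Qed.

End left_derivative.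

(** * The exponential weight *)

Section exponential_weight.
Context {R : realType} (b : R) (X p : R -> R) (lam : R).
Implicit Types (a c g s t r M u v : R) (y z : R -> R).
Local Notation mu := (@lebesgue_measure R).
Hypothesis TC : time_change b X p.
Local Notation rlk := (rlk X p).
Local Notation rlint := (rlint X p).
Local Notation rldef := (rldef X p).
Local Notation pint := (pint b X p).
Local Notation pw := (pw X).

Let b0 : 0 < b. Proof. exact: tc_b_gt0 TC. Qed.

Definition expw t : R := expR (lam * X t).

Lemma continuous_expRM : continuous (fun x : R => expR (lam * x)).
Proof.
move=> x; apply: (@continuous_comp _ _ _ (fun x : R => lam * x) expR).
  by apply: cvgM; [exact: cvg_cst|exact: cvg_id].
exact: continuous_expR.
Qed.

Lemma continuous_expw : continuous expw.
Proof.
move=> t; apply: (@continuous_comp _ _ _ X (fun x : R => expR (lam * x))).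
  exact: (tc_cont TC).
exact: continuous_expRM.
Qed.

Lemma expw_gt0 t : 0 < expw t. Proof. exact: expR_gt0. Qed.

Lemma expw0 : expw 0 = 1. Proof. by rewrite /expw (tc_X0 TC) mulr0 expR0. Qed.

Lemma measurable_expwT : measurable_fun setT expw.
Proof. exact: continuous_measurable_fun continuous_expw. Qed.

Lemma measurable_expw (D : set R) : measurable_fun D expw.
Proof. by apply: measurable_funTS; exact: measurable_expwT. Qed.

Definition expw_bound : R := expR (`|lam| * X b).

Lemma expw_le t : 0 <= t <= b -> expw t <= expw_bound.
Proof.
move=> /andP[t0 tb]; rewrite ler_expR.
have Xt := tc_X_ge0 TC t0 tb; have Xtb := tc_leX TC t0 tb (lexx b).
by apply: le_trans (ler_wpM2l (normr_ge0 lam) Xtb); rewrite ler_wpM2r// ler_norm.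
Qed.

(** Stating the value as [lam * J] instead of dividing by [lam] covers [lam = 0] without a case
    distinction. *)
Lemma integral_expR_itvoo u v : u < v -> exists2 J : R,
  (\int[mu]_(x in `]u, v[) (expR (lam * x))%:E = J%:E)%E &
  lam * J = expR (lam * v) - expR (lam * u).
Proof.
move=> uv.
have cE : {within `[u, v], continuous (fun x : R => expR (lam * x))}.
  exact/continuous_subspaceT/continuous_expRM.
have iE : mu.-integrable `[u, v] (EFin \o (fun x : R => expR (lam * x))).
  by apply: continuous_compact_integrable => //; exact: segment_compact.
have iEo : mu.-integrable `]u, v[ (EFin \o (fun x : R => expR (lam * x))).
  by apply: integrableS iE => //; exact: subset_itv_oo_cc.
pose J := \int[mu]_(x in `]u, v[) expR (lam * x).
exists J; first by rewrite /J /Rintegral fineK//; exact: integrable_fin_num.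
have dE (x : R) : is_derive x 1 (fun x : R => expR (lam * x)) (expR (lam * x) * lam).
  have d1 : is_derive x 1 (fun x : R => lam * x) lam.
    by apply: is_derive_eq; rewrite /GRing.scale/= mulr1 ?mulr0 ?addr0.
  by have := is_derive1_comp (f := expR) (g := fun x : R => lam * x) (x := x); apply.
have := @continuous_FTC2 R (fun x => expR (lam * x) * lam) (fun x => expR (lam * x)) u v uv.
have -> : (\int[mu]_(x in `[u, v]) (expR (lam * x) * lam)%:E = (lam * J)%:E)%E.
  rewrite (@integral_itv_bndoo _ u v (fun x => (expR (lam * x) * lam)%:E) true false); last first.
    apply/measurable_EFinP; apply: measurable_funTS; apply: measurable_funM => //.
    exact: continuous_measurable_fun continuous_expRM.
  rewrite /J -RintegralZl// /Rintegral fineK.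
    by apply: eq_integral => x _; rewrite mulrC.
  apply: integrable_fin_num => //.
  have muv : measurable (`]u, v[ : set (g_sigma_algebraType R.-ocitv.-measurable)).
    exact: measurable_itv.
  by have := integrableZl muv lam iEo; apply: eq_integrable.
move=> FTC; apply: EFin_inj; rewrite FTC//.
- apply: continuous_subspaceT => x; apply: cvgM; last exact: cvg_cst.
  exact: continuous_expRM.
- split; first by move=> x _; have [] := dE x.
  + exact/cvg_at_right_filter/continuous_expRM.
  + exact/cvg_at_left_filter/continuous_expRM.
- by move=> x _; rewrite derive1E; have [_ ->] := dE x.
Qed.

Lemma integral_expw_itvoo r t : 0 <= r -> r < t -> t <= b -> exists2 J : R,
  (\int[mu]_(s in `]r, t[) (expw s * p s)%:E = J%:E)%E & lam * J = expw t - expw r.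
Proof.
move=> r0 rt tb; have [J JE lJ] := integral_expR_itvoo (tc_ltX TC r0 rt tb).
exists J => //; rewrite -JE -(tc_subst TC r0 rt tb)//.
by move=> x _; exact: continuous_expRM.
Qed.

Lemma pint_expwM z : pint z -> pint (fun s => expw s * z s).
Proof.
move=> [mz dz].
have mE : measurable_fun `]0, b[ (fun s => expw s * z s).
  by apply: measurable_funM => //; exact: measurable_expw.
split=> //; apply: (rldef_dom TC (M := expw_bound) mE _ dz) => s sb.
rewrite mulrCA [leLHS]normrM ler_wpM2r// ger0_norm ?(ltW (expw_gt0 s))//.
by rewrite expw_le//; lra.
Qed.

Lemma rldef_expw a t : 0 < a -> 0 <= t -> t <= b -> rldef a expw t.
Proof.
move=> a0 t0 tb; have mE : measurable_fun (`]0, b[ : set R) expw by exact: measurable_expw.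
apply: (rldef_bounded TC (M := expw_bound) a0 t0 tb mE).
by move=> s sb; rewrite ger0_norm ?(ltW (expw_gt0 s))// expw_le//; lra.
Qed.

Lemma rlint1_expw t : 0 <= t -> t <= b -> lam * rlint 1 expw t = expw t - 1.
Proof.
rewrite le_eqVlt => /predU1P[<- _|t0 tb].
  by rewrite (rlint_at0 TC) expw0 subrr mulr0.
have [J JE lJ] := integral_expw_itvoo (lexx 0) t0 tb.
rewrite -{2}expw0 -lJ; congr (_ * _); apply: EFin_inj; rewrite -JE.
rewrite /rlint /Rintegral fineK; last first.
  by apply: integrable_fin_num => //; exact: (rldef_expw ltr01 (ltW t0) tb).
rewrite [RHS]integral_mkcond; apply: eq_integral => s _.
rewrite patchE mem_setE in_itv/=.
have [s0|s0] := ltP 0 s => /=; last by rewrite (rlk_out TC) ?mul0r// ltNge s0.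
rewrite /rlk; case: ifP => st; last by rewrite mul0r.
by rewrite Gamma1 invr1 subrr powRr0 mulr1 mul1r mulrC.
Qed.

(** The kernel of [z |-> I^1 (E I^1 z)]. For [0 < r < t] it is [p r] times the integral of [E p]
    over []r, t[], whence the closed form of [lam * expk t r]. *)
Definition expk t r : R := \int[mu]_s (rlk 1 t s * expw s * rlk 1 s r).

Lemma expk_le t r : t <= b ->
  (\int[mu]_s (rlk 1 t s * expw s * rlk 1 s r)%:E <= (expw_bound * rlk (1 + 1) t r)%:E)%E.
Proof.
move=> tb; rewrite EFinM -(rlk_comp TC r ltr01 ltr01 tb) -ge0_integralZl//=; last 3 first.
- apply/measurable_EFinP/measurable_funM; first exact: (measurable_rlk TC).
  exact: (measurableT_comp (measurable_rlk2 TC 1) (pair2_measurable r)).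
- by move=> s _; rewrite lee_fin mulr_ge0 ?(rlk_ge0 TC).
- by rewrite lee_fin expR_ge0.
apply: ge0_le_integral => //=.
- by move=> s _; rewrite lee_fin !mulr_ge0 ?(rlk_ge0 TC)// ltW// expw_gt0.
- apply/measurable_EFinP/measurable_funM; first apply: measurable_funM.
  + exact: (measurable_rlk TC).
  + exact: measurable_expw.
  + exact: (measurableT_comp (measurable_rlk2 TC 1) (pair2_measurable r)).
- apply: emeasurable_funM => //; apply/measurable_EFinP/measurable_funM.
    exact: (measurable_rlk TC).
  exact: (measurableT_comp (measurable_rlk2 TC 1) (pair2_measurable r)).
move=> s _; rewrite -EFinM lee_fin.
have [sb|sb] := boolP (0 < s < b); last by rewrite (rlk_out TC 1 t sb) !mul0r mulr0.
rewrite mulrA [_ * rlk 1 t s]mulrC; apply: ler_wpM2r; first exact: (rlk_ge0 TC).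
by apply: ler_wpM2l; [exact: (rlk_ge0 TC)|rewrite expw_le//; lra].
Qed.

Lemma expkE t r : t <= b ->
  (\int[mu]_s (rlk 1 t s * expw s * rlk 1 s r)%:E = (expk t r)%:E)%E.
Proof.
move=> tb; rewrite /expk /Rintegral fineK// ge0_fin_numE.
  exact: le_lt_trans (expk_le r tb) (ltry _).
by apply: integral_ge0 => s _; rewrite lee_fin !mulr_ge0 ?(rlk_ge0 TC)// ltW// expw_gt0.
Qed.

Lemma expk_closed t r : t <= b -> lam * expk t r = rlk 1 t r * (expw t - expw r).
Proof.
move=> tb; have [rb|rb] := boolP (0 < r < b); last first.
  rewrite (rlk_out TC)// mul0r /expk /Rintegral integral0_eq ?mulr0//.
  by move=> s _; rewrite (rlk_out TC 1 s rb) mulr0.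
have [rt|tr] := ltP r t; last first.
  have -> : rlk 1 t r = 0 by rewrite /rlk ltNge tr.
  rewrite mul0r /expk /Rintegral integral0_eq ?mulr0// => s _.
  rewrite /rlk; have [st|] := ltP s t; last by rewrite !mul0r.
  by rewrite [r < s]ltNge (le_trans (ltW st) tr)/= mulr0.
have /andP[r0 _] := rb.
have [J JE lJ] := integral_expw_itvoo (ltW r0) rt tb.
have -> : expk t r = p r * J.
  apply: EFin_inj; rewrite -expkE// EFinM -JE -ge0_integralZl//=; last 3 first.
  - apply/measurable_EFinP/measurable_funM; first exact: measurable_expw.
    exact: measurable_funTS (tc_measurable TC).
  - by move=> s _; rewrite lee_fin mulr_ge0 ?(tc_ge0 TC)// ltW// expw_gt0.
  - by rewrite lee_fin (tc_ge0 TC).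
  rewrite [RHS]integral_mkcond; apply: eq_integral => s _.
  rewrite patchE mem_setE in_itv/= /rlk !Gamma1 !invr1 !subrr !powRr0.
  have [rs|sr] := ltP r s => /=; last by rewrite mulr0.
  case: ifP => st; last by rewrite !mul0r.
  by rewrite -EFinM; congr EFin; ring.
rewrite mulrCA lJ /rlk rt Gamma1 invr1 subrr powRr0; ring.
Qed.

(** Integration by parts, carried out by Fubini: with respect to [X] the derivative of [E] is
    [lam * E], and [I^1 z] need not be differentiated. *)
Lemma rlint1_expwM z t : pint z -> 0 <= t -> t <= b ->
  rldef 1 (fun s => expw s * rlint 1 z s) t /\
  lam * rlint 1 (fun s => expw s * rlint 1 z s) t =
    expw t * rlint 1 z t - rlint 1 (fun s => expw s * z s) t.
Proof.
move=> pz t0 tb; have [mz dz] := pz.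
have dz1 : rldef 1 z t by exact: (rldef_ge1 TC).
have dEz : rldef 1 (fun s => expw s * z s) t by apply: (rldef_ge1 TC) => //; exact: pint_expwM.
have dz2 : rldef (1 + 1) z t by apply: (rldef_ge1 TC) => //; rewrite lerDl.
have iCz : mu.-integrable setT (fun r => (expk t r * (z \_ `]0, b[) r)%:E).
  apply: (le_integrable measurableT _ _
    (integrableZl measurableT expw_bound (integrable_abse dz2))).
    apply/measurable_EFinP/measurable_funM; last exact: measurable_patch_oo.
    apply: (measurable_Rintegral_fst (g := fun w : R * R => rlk 1 t w.2 * expw w.2 * rlk 1 w.2 w.1)).
    apply: measurable_funM; first apply: measurable_funM.
    - exact: (measurableT_comp (measurable_rlk TC 1 t) measurable_snd).
    - exact: (measurableT_comp measurable_expwT measurable_snd).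
    - exact: (measurableT_comp (measurable_rlk2 TC 1) (measurable_fun_pair measurable_snd measurable_fst)).
  move=> r _; rewrite -[(abse \o _) r]/(`|rlk (1 + 1) t r * z r|%:E) -EFinM /= lee_fin.
  rewrite [leRHS]ger0_norm ?mulr_ge0 ?expR_ge0//.
  have ge0k : 0 <= expk t r.
    apply: Rintegral_ge0 => s _.
    by rewrite !mulr_ge0 ?(rlk_ge0 TC)// ltW// expw_gt0.
  rewrite (rlk_patch TC) !normrM mulrA; apply: ler_wpM2r => //.
  rewrite !ger0_norm ?(rlk_ge0 TC) ?addr_gt0//.
  by rewrite -lee_fin -expkE// expk_le.
have [|||||||i1 e1] := @kernel_fubini R (fun s => rlk 1 t s * expw s) (expk t) (z \_ `]0, b[)
  (rlk 1).
- by apply: measurable_funM; [exact: (measurable_rlk TC)|exact: measurable_expw].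
- exact: (measurable_rlk2 TC).
- exact: measurable_patch_oo.
- by move=> s; rewrite mulr_ge0 ?(rlk_ge0 TC)// ltW// expw_gt0.
- by move=> s r; exact: (rlk_ge0 TC).
- by move=> r; exact: expkE.
- exact: iCz.
have E s : \int[mu]_r (rlk 1 s r * (z \_ `]0, b[) r) = rlint 1 z s.
  by apply: eq_Rintegral => r _; rewrite -(rlk_patch TC).
split.
  by move: i1; apply: eq_integrable => // s _; rewrite E mulrA.
have -> : rlint 1 (fun s => expw s * rlint 1 z s) t =
    \int[mu]_r (expk t r * (z \_ `]0, b[) r).
  by rewrite -e1; apply: eq_Rintegral => s _; rewrite E mulrA.
rewrite -RintegralZl//.
rewrite -rlintZ// -rlintB//; last exact: rldefZ.
apply: eq_Rintegral => r _; rewrite mulrA expk_closed//.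
have [rb|rb] := boolP (0 < r < b).
  by rewrite patchE ifT ?mem_setE ?in_itv//; ring.
by rewrite !(rlk_out TC 1 t rb) !mul0r.
Qed.

(* [expw] is an integrating factor: it turns (1/p) d/dt + lam into (1/p) d/dt. *)
Lemma expw_primitive (Y : R -> R) z (y0 : R) : pint z ->
  (forall t, 0 <= t -> t <= b -> Y t = y0 + rlint 1 z t) ->
  forall t, 0 <= t -> t <= b ->
    expw t * Y t = y0 + rlint 1 (fun s => expw s * (z s + lam * Y s)) t.
Proof.
move=> pz YE t t0 tb; have [d1 e1] := rlint1_expwM pz t0 tb.
have dE : rldef 1 expw t by exact: rldef_expw.
have dEz : rldef 1 (fun s => expw s * z s) t by apply: (rldef_ge1 TC) => //; exact: pint_expwM.
have -> : rlint 1 (fun s => expw s * (z s + lam * Y s)) t =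
    rlint 1 (fun s => expw s * z s + (lam * y0 * expw s + lam * (expw s * rlint 1 z s))) t.
  apply: (eq_rlint TC) => s /andP[s0 sb] st; rewrite YE ?(ltW s0) ?(ltW sb)//; ring.
rewrite rlintD//; last by apply: rldefD; exact: rldefZ.
rewrite rlintD; [|exact: rldefZ|exact: rldefZ].
rewrite !rlintZ// e1 mulrAC rlint1_expw// YE//; ring.
Qed.

Lemma GammaS (n : nat) : Gamma (n%:R + 1) = n`!%:R :> R.
Proof.
elim: n => [|n IH]; first by rewrite add0r Gamma1.
rewrite GammaD1 ?ltr0n//.
have -> : Gamma n.+1%:R = n`!%:R :> R by rewrite -IH -natr1.
by rewrite factS natrM.
Qed.

Lemma pw_nat (j : nat) s : 0 <= s <= b -> pw j%:R s = X s ^+ j / j`!%:R.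
Proof.
by move=> /andP[s0 sb]; rewrite /pw GammaS powR_mulrn// (tc_X_ge0 TC).
Qed.

Lemma exp_series_le x (n : nat) : `|\sum_(j < n) x ^+ j / j`!%:R| <= expR `|x| :> R.
Proof.
apply: le_trans (ler_norm_sum _ _ _) _.
have -> : \sum_(i < n) `|x ^+ i / i`!%:R| = series (exp_coeff `|x|) n.
  rewrite /series/= big_mkord; apply: eq_bigr => i _.
  by rewrite normrM normrX normfV (ger0_norm (ler0n _ _)).
apply: nondecreasing_cvgn_le; last exact: is_cvg_series_exp_coeff.
apply/nondecreasing_seqP => k; rewrite seriesSr/= lerDl exp_coeff_ge0//.
Qed.

(** Termwise integration of the exponential series, whose term [lam^j X^j / j!] is [lam^j pw j]. Its
    partial sums are dominated by [exp (|lam| X b)]. *)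
Lemma rlint_expw g t : 0 < g -> 0 < t -> t <= b ->
  rlint g expw t = X t `^ g * mittag_leffler 1 (g + 1) (lam * X t).
Proof.
move=> g0 t0 tb; have Xt := tc_X_gt0 TC t0 tb.
pose q n s := rlk g t s * \sum_(j < n) lam ^+ j * pw j%:R s.
have pwN (j : nat) : -1 < j%:R :> R by rewrite (lt_le_trans (ltrN10 R)).
have dpw (j : nat) : rldef g (pw j%:R) t.
  by apply: (rldef_pw TC) => //; exact: ltW.
have qE n : \int[mu]_s q n s =
    X t `^ g * series (fun j => (lam * X t) ^+ j / Gamma (1 * j%:R + (g + 1))) n.
  have [_ e] := @rlint_sum R X p g n xpredT (fun j => lam ^+ j) (fun j => pw j%:R) t
    (fun i _ _ => dpw i).
  rewrite [LHS]e /series/= big_mkord mulr_sumr; apply: eq_bigr => j _.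
  rewrite (rlint_pw TC g0 (pwN j) (ltW t0) tb (or_intror t0)).
  have -> : 1 * j%:R + (g + 1) = g + j%:R + 1 by ring.
  have Xn : X t != 0 by rewrite gt_eqF.
  rewrite /pw (@powRD _ (X t) g j%:R) ?Xn ?implybT// powR_mulrn ?(ltW Xt)// exprMn.
  by move: (_ `^ _) (_^-1) => *; ring.
have sumE n s : 0 <= s <= b ->
    \sum_(j < n) lam ^+ j * pw j%:R s = \sum_(j < n) (lam * X s) ^+ j / j`!%:R.
  by move=> sb; apply: eq_bigr => j _; rewrite pw_nat// mulrA exprMn.
have cv : (\int[mu]_s q n s) @[n --> \oo] --> rlint g expw t.
  apply: (@Rintegral_dominated R q _ (fun s => expw_bound * rlk g t s)).
  - move=> n; apply: measurable_funM; first exact: (measurable_rlk TC).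
    apply: measurable_sum => j; apply: measurable_funM => //.
    exact: (measurable_pw TC).
  - by apply: measurable_funM; [exact: (measurable_rlk TC)|exact: measurable_expw].
  - move=> s; have [sb|sb] := boolP (0 < s < b); last first.
      rewrite (rlk_out TC)// mul0r; apply: cvg_near_cst; apply: nearW => n.
      by rewrite /q (rlk_out TC)// mul0r.
    apply: cvgM; first exact: cvg_cst.
    have sb' : 0 <= s <= b by lra.
    under eq_fun do rewrite sumE//.
    have -> : (fun n => \sum_(j < n) (lam * X s) ^+ j / j`!%:R) =
        series (exp_coeff (lam * X s)).
      by apply/funext => n; rewrite /series/= big_mkord.
    exact: is_cvg_series_exp_coeff.
  - have d1 := rldef_pw TC g0 (ltrN10 R) (ltW t0) tb.
    have := integrableZl measurableT expw_bound d1.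
    by apply: eq_integrable => // s _; rewrite pw0/= mulr1 -EFinM.
  - move=> n s; have [sb|sb] := boolP (0 < s < b); last first.
      by rewrite /q (rlk_out TC)// mul0r mulr0 normr0.
    have sb' : 0 <= s <= b by lra.
    rewrite /q normrM ger0_norm ?(rlk_ge0 TC)// mulrC ler_wpM2r ?(rlk_ge0 TC)// sumE//.
    apply: le_trans (exp_series_le _ _) _; rewrite ler_expR normrM.
    have /andP[s0 sb1] := sb'.
    by rewrite (ger0_norm (tc_X_ge0 TC s0 sb1)) ler_wpM2l// (tc_leX TC).
have Xg : X t `^ g != 0 by rewrite gt_eqF// powR_gt0.
(* The same limit proves that the Mittag-Leffler series converges, which [limn] by itself does not
   guarantee. *)
have cs : series (fun j => (lam * X t) ^+ j / Gamma (1 * j%:R + (g + 1))) n @[n --> \oo] -->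
    (X t `^ g)^-1 * rlint g expw t.
  apply: cvg_trans (cvgM (cvg_cst (X t `^ g)^-1) cv).
  by apply: near_eq_cvg; apply: nearW => n /=; rewrite qE mulKf.
by rewrite /mittag_leffler (cvg_lim _ cs)// mulVKf.
Qed.

End exponential_weight.

(** * Sums of real powers *)

Section power_sums.
Context {R : realType}.
Implicit Types (g d c x : R) (F : R -> R) (s : seq (R * R)).

(** [F x = o(x^g)] as [x] tends to 0 from the right. *)
Definition negligible0 g F : Prop :=
  forall e, 0 < e -> exists2 d, 0 < d & forall x, 0 < x < d -> `|F x| <= e * x `^ g.

(** Entries are pairs (coefficient, exponent). Exponents may repeat, as a multiple of [al] can be an
    integer. *)
Definition powsum s x : R := \sum_(q <- s) q.1 * x `^ q.2.

Lemma eq_negligible0 g F F' : (forall x, 0 < x -> F x = F' x) ->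
  negligible0 g F -> negligible0 g F'.
Proof.
move=> FF' sF e e0; have [d d0 Hd] := sF e e0; exists d => // x /andP[x0 xd].
by rewrite -FF'// Hd// x0.
Qed.

Definition dilate d F x : R := F (2 * x) - 2 `^ d * F x.

Lemma negligible0_dilate g d F : negligible0 g F -> negligible0 g (dilate d F).
Proof.
move=> sF e e0.
have k0 : 0 < 2 `^ g + 2 `^ d :> R by rewrite addr_gt0// powR_gt0.
have [d1 d10 Hd] := sF _ (divr_gt0 e0 k0).
exists (d1 / 2); first by rewrite divr_gt0.
move=> x /andP[x0 xd]; rewrite /dilate; apply: le_trans (ler_normB _ _) _.
rewrite normrM (ger0_norm (powR_ge0 _ _)).
have H1 : `|F (2 * x)| <= e / (2 `^ g + 2 `^ d) * (2 * x) `^ g.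
  by apply: Hd; apply/andP; split; lra.
have H2 : `|F x| <= e / (2 `^ g + 2 `^ d) * x `^ g.
  by apply: Hd; apply/andP; split; lra.
rewrite powRM ?(ltW x0)// in H1.
apply: le_trans (lerD H1 (ler_wpM2l (powR_ge0 2 d) H2)) _.
rewrite le_eqVlt; apply/orP; left; apply/eqP.
move: (2 `^ g) (2 `^ d) (x `^ g) k0 => u v w k0; field.
by rewrite gt_eqF.
Qed.

Definition dilate_seq d s : seq (R * R) :=
  [seq (q.1 * (2 `^ q.2 - 2 `^ d), q.2) | q <- s].

Lemma dilate_powsum c d s x : 0 < x ->
  dilate d (powsum ((c, d) :: s)) x = powsum (dilate_seq d s) x.
Proof.
move=> x0; rewrite /dilate /powsum big_map !big_cons/=.
rewrite powRM ?(ltW x0)// mulrDr opprD addrACA.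
have -> : c * (2 `^ d * x `^ d) - 2 `^ d * (c * x `^ d) = 0 by ring.
rewrite add0r mulr_sumr -sumrB; apply: eq_bigr => q _.
by rewrite powRM ?(ltW x0)//; ring.
Qed.

(* The dilation F(2x) - 2^d F(x) removes the exponent d and keeps F negligible;
   no distinctness of the exponents is needed. *)
Lemma powsum_negligible0_eq0 g s : all (fun q => q.2 <= g) s ->
  negligible0 g (powsum s) -> forall x, 0 < x -> powsum s x = 0.
Proof.
move: {2}(size s) (leqnn (size s)) => n; elim: n s => [|n IH] s.
  by rewrite leqn0 size_eq0 => /eqP -> _ _ x _; rewrite /powsum big_nil.
case: s => [|[c d] s] /=; first by move=> _ _ _ x _; rewrite /powsum big_nil.
rewrite ltnS => sn /andP[dg sg] sF x x0.
have Q0 y : 0 < y -> powsum (dilate_seq d s) y = 0.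
  move=> y0; apply: (IH (dilate_seq d s)) => //.
  - by rewrite size_map.
  - by rewrite all_map.
  - apply: eq_negligible0 (negligible0_dilate d sF) => z z0.
    exact: dilate_powsum.
set P := powsum _ in sF *.
(* Homogeneity under doubling expresses [P x] by the values at [x / 2^k], where negligibility makes
   them smaller than the factor [2^(d k)] can compensate, as [d <= g]. *)
have P2 y : 0 < y -> P (2 * y) = 2 `^ d * P y.
  by move=> y0; apply/eqP; rewrite -subr_eq0; apply/eqP; rewrite -(Q0 y y0) -(dilate_powsum c d s y0).
have Pk (k : nat) : P x = (2 `^ d) ^+ k * P (x / 2 ^+ k).
  elim: k => [|k IHk]; first by rewrite !expr0 mul1r divr1.
  have y0 : 0 < x / 2 ^+ k.+1 by rewrite divr_gt0// exprn_gt0.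
  rewrite IHk exprSr -mulrA -P2//; congr (_ * P _).
  by rewrite exprS; field; rewrite expf_neq0.
apply/eqP; rewrite -normr_le0; apply/ler_addgt0Pl => e e0; rewrite addr0.
have xg : 0 < x `^ g by rewrite powR_gt0.
have [d1 d10 Hd] := sF _ (divr_gt0 e0 xg).
(* Large enough since [2^k >= k + 1 > x / d1]. *)
pose k := Num.truncn (x / d1).
have kd : x / 2 ^+ k < d1.
  rewrite ltr_pdivrMr ?exprn_gt0// mulrC -ltr_pdivrMr//.
  apply: lt_le_trans (truncnS_gt _) _.
  by rewrite -natrX ler_nat ltn_expl.
have y0 : 0 < x / 2 ^+ k by rewrite divr_gt0// exprn_gt0.
rewrite (Pk k) normrM ger0_norm ?exprn_ge0 ?powR_ge0//.
apply: le_trans (ler_wpM2l _ (Hd (x / 2 ^+ k) _)) _; first by rewrite exprn_ge0 ?powR_ge0.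
  by rewrite y0.
rewrite powRM ?(ltW x0) ?invr_ge0 ?exprn_ge0//.
have -> : (2 ^+ k)^-1 `^ g = ((2 `^ g) ^+ k)^-1 :> R.
  have -> : (2 ^+ k)^-1 = 2 `^ (- k%:R) :> R by rewrite powR_invn.
  by rewrite -powRrM mulNr powRN [k%:R * g]mulrC powRrM powR_mulrn ?powR_ge0.
have le2 : (2 `^ d) ^+ k <= (2 `^ g) ^+ k :> R.
  by rewrite lerXn2r ?nnegrE ?powR_ge0// ler_powR//; lra.
have g0 : 0 < (2 `^ g) ^+ k :> R by rewrite exprn_gt0// powR_gt0.
have -> : (2 `^ d) ^+ k * (e / x `^ g * (x `^ g * ((2 `^ g) ^+ k)^-1)) =
    e * ((2 `^ d) ^+ k / (2 `^ g) ^+ k).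
  move: (x `^ g) ((2 `^ g) ^+ k) ((2 `^ d) ^+ k) xg g0 => u v w u0 v0.
  by field; rewrite !gt_eqF.
by rewrite ler_piMr ?(ltW e0)// ler_pdivrMr// mul1r.
Qed.

(** Each dilation removes one lower power and multiplies the leading coefficient by [2^g - 2^d],
    which is nonzero as [d < g]. The induction ends with [c * x^g] alone. *)
Lemma powsum_lead_eq0 g s c : all (fun q => q.2 < g) s ->
  negligible0 g (fun x => powsum s x + c * x `^ g) -> c = 0.
Proof.
move: {2}(size s) (leqnn (size s)) => n; elim: n s c => [|n IH] s c.
  rewrite leqn0 size_eq0 => /eqP -> _ sF.
  apply/eqP; rewrite -normr_le0; apply/ler_addgt0Pl => e e0; rewrite addr0.
  have [d d0 /(_ (d / 2))] := sF e e0.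
  have d2 : 0 < d / 2 by rewrite divr_gt0.
  have d3 : 0 < d / 2 < d by lra.
  move=> /(_ d3); rewrite /powsum big_nil add0r normrM (ger0_norm (powR_ge0 _ _)).
  by rewrite ler_pM2r// powR_gt0.
case: s => [|[k d] s]; first by move=> _; exact: IH.
rewrite /= ltnS => sn /andP[dg sg] sF.
have : c * (2 `^ g - 2 `^ d) = 0.
  apply: (IH (dilate_seq d s)); [by rewrite size_map|by rewrite all_map|].
  apply: eq_negligible0 (negligible0_dilate d sF) => x x0.
  rewrite -(dilate_powsum k)// /dilate powRM ?(ltW x0)//; ring.
move/eqP; rewrite mulf_eq0 => /orP[/eqP//|]; rewrite subr_eq0 => /eqP gd.
have := @gt0_ltr_powR R.
have : 2 `^ d < 2 `^ g :> R.
  by rewrite /powR gt_eqF// ltr_expR ltr_pM2r// ln_gt0// ltr1n.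
by rewrite gd ltxx.
Qed.

Lemma negligible0D g F F' : negligible0 g F -> negligible0 g F' ->
  negligible0 g (fun x => F x + F' x).
Proof.
move=> sF sF' e e0; have e2 : 0 < e / 2 by rewrite divr_gt0.
have [d d0 Hd] := sF _ e2; have [d' d'0 Hd'] := sF' _ e2.
exists (Num.min d d'); first by rewrite lt_min d0.
move=> x; rewrite lt_min => /and3P[x0 xd xd'].
apply: le_trans (ler_normD _ _) _.
have := Hd x; have := Hd' x; rewrite x0 xd xd' => /(_ isT) H1 /(_ isT) H2.
apply: le_trans (lerD H2 H1) _.
by rewrite -mulrDl -splitr.
Qed.

Lemma negligible0Z g k F : negligible0 g F -> negligible0 g (fun x => k * F x).
Proof.
move=> sF e e0; have k0 : 0 < `|k| + 1 by rewrite ltr_wpDl.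
have [d d0 Hd] := sF _ (divr_gt0 e0 k0); exists d => // x xd.
rewrite normrM; apply: le_trans (ler_wpM2l (normr_ge0 k) (Hd x xd)) _.
rewrite mulrA; apply: ler_wpM2r; first exact: powR_ge0.
rewrite mulrCA ler_piMr ?(ltW e0)// ler_pdivrMr// mul1r; lra.
Qed.

Lemma negligible0_powR g d c : g < d -> negligible0 g (fun x => c * x `^ d).
Proof.
move=> gd; apply: negligible0Z => e e0.
(* The solution of [x^(d - g) = e]. *)
exists (e `^ (d - g)^-1); first by rewrite powR_gt0.
move=> x /andP[x0 xe]; rewrite ger0_norm ?powR_ge0//.
have dg : 0 < d - g by rewrite subr_gt0.
have -> : x `^ d = x `^ (d - g) * x `^ g.
  by rewrite -powRD ?subrK// (gt_eqF x0) implybT.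
rewrite ler_wpM2r ?powR_ge0//.
have -> : e = (e `^ (d - g)^-1) `^ (d - g).
  by rewrite -powRrM mulVf ?gt_eqF// powRr1// ltW.
by apply: ge0_ler_powR; rewrite ?nnegrE ?powR_ge0 ?ltW.
Qed.

Lemma negligible0_sum g (n : nat) (P : pred nat) (F : nat -> R -> R) :
  (forall i, P i -> negligible0 g (F i)) ->
  negligible0 g (fun x => \sum_(i < n | P i) F i x).
Proof.
move=> sF; elim: n => [|n IH].
  move=> e e0; exists 1 => // x _; rewrite big_ord0 normr0.
  by rewrite mulr_ge0 ?powR_ge0// ltW.
have [Pn|Pn] := boolP (P n).
  apply: eq_negligible0 (negligible0D IH (sF n Pn)) => x _.
  by rewrite [RHS]big_mkcond big_ord_recr/= Pn -big_mkcond.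
apply: eq_negligible0 IH => x _.
by rewrite [RHS]big_mkcond big_ord_recr/= (negPf Pn) addr0 -big_mkcond.
Qed.

End power_sums.

(** * Comparison of expansions at 0 *)

Section fractional_expansion.
Context {R : realType} (b : R) (X p : R -> R).
Implicit Types (a c g s t r M : R) (y z v : R -> R).
Local Notation mu := (@lebesgue_measure R).
Hypothesis TC : time_change b X p.
Local Notation rlk := (rlk X p).
Local Notation rlint := (rlint X p).
Local Notation rldef := (rldef X p).
Local Notation pint := (pint b X p).
Local Notation pw := (pw X).

Let b0 : 0 < b. Proof. exact: tc_b_gt0 TC. Qed.

Lemma tc_IVT r x : 0 < r -> r <= b -> 0 < x < X r -> exists2 t, 0 < t < r & X t = x.
Proof.
move=> r0 rb /andP[x0 xr].
have [t trb Xt] : exists2 t, t \in `[0, r] & X t = x.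
  apply: IVT; [exact: ltW|exact: continuous_subspaceT (tc_cont TC)|].
  rewrite (tc_X0 TC) minEle maxEle (ltW (tc_X_gt0 TC r0 rb)).
  by rewrite (ltW x0) (ltW xr).
exists t => //; move: trb; rewrite in_itv/= !le_eqVlt => /andP[/predU1P[t0|->] /predU1P[tr|tr]].
- by move: r0; rewrite -tr -t0 ltxx.
- by move: x0; rewrite -Xt -t0 (tc_X0 TC) ltxx.
- by move: xr; rewrite -Xt tr ltxx.
- by rewrite tr.
Qed.

(** The clock runs continuously through all small positive values, so an estimate in [t] is one in
    the variable [x = X t], to which the results on power sums apply. *)
Lemma negligible0_tc g (P : R -> R) :
  (forall e, 0 < e -> exists2 d, 0 < d & forall t, 0 < t < d -> t <= b ->
    `|P (X t)| <= e * X t `^ g) ->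
  negligible0 g P.
Proof.
move=> H e e0; have [d d0 Hd] := H e e0.
pose r := Num.min (d / 2) b.
have r0 : 0 < r by rewrite lt_min divr_gt0.
have rb : r <= b by rewrite ge_min lexx orbT.
have rd : r <= d / 2 by rewrite ge_min lexx.
exists (X r); first exact: (tc_X_gt0 TC).
move=> x /(tc_IVT r0 rb)[t /andP[t0 tr] <-]; apply: Hd; last by lra.
by rewrite t0/=; lra.
Qed.

Lemma tc_negligible0 g (P : R -> R) : negligible0 g P ->
  forall e, 0 < e -> exists2 d, 0 < d & forall t, 0 < t < d -> t <= b ->
    `|P (X t)| <= e * X t `^ g.
Proof.
move=> sP e e0; have [d d0 Hd] := sP e e0.
have cX : X t @[t --> (0 : R)^'+] --> X 0.
  exact/cvg_at_right_filter/(@tc_cont _ _ _ _ TC).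
have /cvgrPdist_lt/(_ _ d0)[r /= r0 Hr] := cX.
exists r => // t /andP[t0 tr] tb; apply: Hd; rewrite (tc_X_gt0 TC)//=.
have := Hr t; rewrite /= sub0r normrN gtr0_norm// => /(_ tr t0).
by rewrite (tc_X0 TC) sub0r normrN gtr0_norm// (tc_X_gt0 TC).
Qed.



Definition coef_seq (n : nat) (P : pred nat) (c e : nat -> R) : seq (R * R) :=
  [seq (c i / Gamma (e i + 1), e i) | i <- index_iota 0 n & P i].

Lemma coef_seqE (n : nat) (P : pred nat) (c e : nat -> R) (x : R) :
  powsum (coef_seq n P c e) x = \sum_(i < n | P i) c i / Gamma (e i + 1) * x `^ e i.
Proof.
by rewrite /powsum /coef_seq big_map big_filter big_mkord.
Qed.

Lemma powsum_cat (s1 s2 : seq (R * R)) x : powsum (s1 ++ s2) x = powsum s1 x + powsum s2 x.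
Proof. by rewrite /powsum big_cat. Qed.

Lemma sum_pwE n (P : pred nat) (c e : nat -> R) t :
  \sum_(i < n | P i) c i * pw (e i) t = powsum (coef_seq n P c e) (X t).
Proof.
rewrite coef_seqE; apply: eq_bigr => i _; rewrite /pw.
by rewrite mulrAC mulrA.
Qed.

Lemma all_coef_seq (n : nat) (P : pred nat) (c e : nat -> R) (T : pred R) :
  (forall i, (i < n)%N -> P i -> T (e i)) ->
  all (fun q => T q.2) (coef_seq n P c e).
Proof.
move=> H; rewrite /coef_seq all_map; apply/allP => i.
by rewrite mem_filter mem_index_iota => /andP[Pi /andP[_ ni]]; exact: H.
Qed.

(** In the difference of the two expansions both remainders are known up to [o(X^g)]: the first
    contributes [v 0 * pw g], the second nothing. All other powers have exponents below [g], so the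
    coefficient of [X^g] must vanish. *)
Lemma leading_coef_eq (F v z : R -> R) (m k : nat) (a w : nat -> R) (g al wk : R) :
  0 < g -> (forall j, (j < m)%N -> j%:R < g) -> (forall i, (i < k)%N -> i%:R * al < g) ->
  {within `[0, b], continuous v} -> pint z ->
  (forall t, 0 < t -> t <= b -> F t = \sum_(j < m) a j * pw j%:R t + rlint g v t) ->
  (forall t, 0 < t -> t <= b -> F t =
     \sum_(i < k) w i * pw (i%:R * al) t + wk * pw g t + rlint (g + 1) z t) ->
  wk = v 0.
Proof.
move=> g0 jg ig cv pz F1 F2.
pose s := coef_seq k xpredT w (fun i => i%:R * al) ++
          coef_seq m xpredT (fun j => - a j) (fun j => j%:R).
have Gg : Gamma (g + 1) != 0 by rewrite gt_eqF// Gamma_gt0//; lra.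
have : (wk - v 0) / Gamma (g + 1) = 0.
  apply: (@powsum_lead_eq0 R g s).
    rewrite all_cat; apply/andP; split.
    - by apply: (@all_coef_seq _ _ _ _ (fun x => x < g)) => i ik _; exact: ig.
    - by apply: (@all_coef_seq _ _ _ _ (fun x => x < g)) => i ik _; exact: jg.
  apply: negligible0_tc => e e0; have e2 : 0 < e / 2 by rewrite divr_gt0.
  have [d1 d10 H1] := rlint_asymp_continuous TC g0 cv e2.
  have [d2 d20 H2] := rlint_asymp_pint TC (ltW g0) pz e2.
  exists (Num.min d1 d2); first by rewrite lt_min d10.
  move=> t; rewrite lt_min => /and3P[t0 td1 td2] tb.
  have -> : powsum s (X t) + (wk - v 0) / Gamma (g + 1) * X t `^ g =
      (rlint g v t - v 0 * pw g t) - rlint (g + 1) z t.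
    rewrite powsum_cat -!sum_pwE.
    have -> : \sum_(i < m) - a i * pw i%:R t = - \sum_(i < m) a i * pw i%:R t.
      by rewrite -sumrN; apply: eq_bigr => i _; rewrite mulNr.
    have := F1 t t0 tb; rewrite (F2 t t0 tb) => E.
    have -> : (wk - v 0) / Gamma (g + 1) * X t `^ g = wk * pw g t - v 0 * pw g t.
      by rewrite -mulrBl /pw mulrA mulrAC.
    move: E; move: (\sum_(i < k) _) (\sum_(i < m) _) (rlint _ _ _) (rlint _ _ _) (_ * _) (_ * _).
    by move=> *; lra.
  apply: le_trans (ler_normB _ _) _.
  have h1 : `|rlint g v t - v 0 * pw g t| <= e / 2 * X t `^ g by apply: H1 => //; rewrite t0.
  have h2 : `|rlint (g + 1) z t| <= e / 2 * X t `^ g by apply: H2 => //; rewrite t0.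
  by apply: le_trans (lerD h1 h2) _; rewrite -mulrDl -splitr.
move/eqP; rewrite mulf_eq0 invr_eq0 (negPf Gg) orbF subr_eq0.
by move/eqP.
Qed.

Lemma continuous_sum_ord (n : nat) (P : pred nat) (F : nat -> R -> R) t :
  (forall j, {for t, continuous (F j)}) ->
  {for t, continuous (fun u => \sum_(j < n | P j) F j u)}.
Proof.
move=> cF; elim: n => [|n IH].
  rewrite (_ : (fun u => _) = cst 0); first exact: cvg_cst.
  by apply/funext => u; rewrite big_ord0.
have -> : (fun u => \sum_(j < n.+1 | P j) F j u) =
    (fun u => \sum_(j < n | P j) F j u + (if P n then F n u else 0)).
  by apply/funext => u; rewrite big_mkcond big_ord_recr/= -big_mkcond.
apply: cvgD; first exact: IH.
by case: (P n); [exact: cF|exact: cvg_cst].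
Qed.

(* Matching the two expansions of F at 0 leaves only the integer powers in ]n al, be[,
   each of which is a fractional integral of order be of an integrable power. *)
Lemma remainder_continuous_version (F v z w : R -> R) (m n : nat) (a c : nat -> R) (al : R) :
  let be := n%:R * al + al in
  0 < al < 1 -> (forall j, (j < m)%N -> j%:R < be) ->
  {within `[0, b], continuous v} -> pint z ->
  (forall t, 0 < t -> t <= b -> F t = \sum_(j < m) a j * pw j%:R t + rlint be v t) ->
  (forall t, 0 < t -> t <= b -> F t =
     \sum_(i < n.+1) c i * pw (i%:R * al) t + rlint (n%:R * al + 1) z t) ->
  (forall t, 0 < t -> t <= b -> rldef (1 - al) z t /\ w t = rlint (1 - al) z t) ->
  [/\ {in `]0, b[, continuous w}, pint w &
      forall t, 0 < t -> t <= b ->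
        F t = \sum_(i < n.+1) c i * pw (i%:R * al) t + rlint be w t].
Proof.
move=> be /andP[al0 al1] jbe cv pz F1 F2 wz.
set g := n%:R * al in be jbe F1 F2 *.
have g0 : 0 <= g by rewrite mulr_ge0// ltW.
have be0 : 0 < be by rewrite /be; lra.
(* Difference of the two expansions, restricted to exponents at most [g]; the integer powers above
   [g] are kept apart in [L]. *)
pose s := coef_seq n.+1 xpredT c (fun i => i%:R * al) ++
          coef_seq m (fun j => j%:R <= g) (fun j => - a j) (fun j => j%:R).
pose L (t : R) := \sum_(j < m | g < j%:R) a j * pw j%:R t.
have jL j : g < j%:R -> -1 < j%:R - be :> R by rewrite /be; lra.
have sE t : 0 < t -> t <= b -> powsum s (X t) = L t + rlint be v t - rlint (g + 1) z t.
  move=> t0 tb; rewrite powsum_cat -!sum_pwE.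
  have := F1 t t0 tb; rewrite (F2 t t0 tb) (bigID (fun j : 'I_m => g < j%:R))/= -/(L t).
  have -> : \sum_(i < m | i%:R <= g) - a i * pw i%:R t =
      - \sum_(i < m | ~~ (g < i%:R)) a i * pw i%:R t.
    rewrite -sumrN; apply: eq_big => [i|i _]; first by rewrite leNgt.
    by rewrite mulNr.
  move: (\sum_(i < n.+1) _) (\sum_(i < m | _) _) (L t) (rlint _ _ _) (rlint _ _ _).
  by move=> *; lra.
have pv := pint_continuous TC cv.
have [mv [Mv vM]] := itvcc_continuous cv.
(* By [sE] the sum equals three terms that are each [o(X^g)]: [L] and the integral of order [be]
   have orders above [g], the last one is covered by [rlint_asymp_pint]. *)
have s0 : forall x, 0 < x -> powsum s x = 0.
  apply: (@powsum_negligible0_eq0 R g).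
    rewrite all_cat; apply/andP; split.
    - apply: (@all_coef_seq _ _ _ _ (fun x => x <= g)) => i ik _.
      by rewrite /g ler_pM2r// ler_nat -ltnS.
    - exact: (@all_coef_seq _ _ _ _ (fun x => x <= g)).
  apply: negligible0_tc => e e0; have e3 : 0 < e / 3 by rewrite divr_gt0.
  have sL : negligible0 g (fun x => \sum_(j < m | g < j%:R) a j / Gamma (j%:R + 1) * x `^ j%:R).
    by apply: (@negligible0_sum R g m (fun j => g < j%:R)
      (fun j x => a j / Gamma (j%:R + 1) * x `^ j%:R)) => j gj; exact: negligible0_powR.
  have [d1 d10 H1] := tc_negligible0 sL e3.
  have sv : negligible0 g (fun x => Mv / Gamma (be + 1) * x `^ be).
    by apply: negligible0_powR; rewrite /be ltrDl.
  have [d2 d20 H2] := tc_negligible0 sv e3.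
  have [d3 d30 H3] := rlint_asymp_pint TC g0 pz e3.
  exists (Num.min d1 (Num.min d2 d3)); first by rewrite !lt_min d10 d20.
  move=> t; rewrite !lt_min => /and4P[t0 td1 td2 td3] tb.
  rewrite sE//; apply: le_trans (ler_normB _ _) _.
  have h1 : `|L t| <= e / 3 * X t `^ g.
    have -> : L t = \sum_(j < m | g < j%:R) a j / Gamma (j%:R + 1) * X t `^ j%:R.
      by apply: eq_bigr => j _; rewrite /pw mulrA mulrAC.
    by apply: H1 => //; rewrite t0.
  have h2 : `|rlint be v t| <= e / 3 * X t `^ g.
    apply: (@le_trans _ _ (Mv * pw be t)).
      apply: (norm_rlint_le TC) => //; [exact: ltW| |].
        by apply: (rldef_continuous TC) => //; exact: ltW.
      by move=> r /andP[r0 rb] _; apply: vM; rewrite !ltW.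
    apply: le_trans (ler_norm _) _.
    have -> : Mv * pw be t = Mv / Gamma (be + 1) * X t `^ be by rewrite /pw mulrA mulrAC.
    by apply: H2 => //; rewrite t0.
  have h3 : `|rlint (g + 1) z t| <= e / 3 * X t `^ g by apply: H3 => //; rewrite t0.
  apply: le_trans (lerD (ler_normD _ _) h3) _.
  apply: le_trans (lerD (lerD h1 h2) (lexx _)) _.
  rewrite -!mulrDl; apply: ler_wpM2r; [exact: powR_ge0|lra].
(* The explicit candidate for [w]: [j - be] exceeds -1 because [j > g] and [al < 1], and integration
   of order [be] sends [pw (j - be)] back to [pw j]. *)
pose h (t : R) := v t + \sum_(j < m | g < j%:R) a j * pw (j%:R - be) t.
have ph : pint h.
  apply: pintD => //.
  apply: (@pint_sum _ _ _ _ m (fun j => g < j%:R) a (fun j => pw (j%:R - be))) => j _ gj.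
  by apply: (pint_pw TC); exact: jL.
have hE t : 0 < t -> t <= b -> rldef be h t /\ rlint be h t = rlint (g + 1) z t.
  move=> t0 tb; have t0' := ltW t0.
  have dv : rldef be v t by exact: (rldef_continuous TC).
  have [dL eL] := @rlint_sum _ X p be m (fun j => g < j%:R) a (fun j => pw (j%:R - be)) t
    (fun j _ gj => rldef_pw TC be0 (jL j gj) t0' tb).
  split; first exact: rldefD.
  rewrite rlintD// eL.
  have -> : \sum_(i < m | g < i%:R) a i * rlint be (pw (i%:R - be)) t = L t.
    apply: eq_bigr => j gj; rewrite (rlint_pw TC be0 (jL j gj) t0' tb); last by right.
    by rewrite addrCA subrr addr0.
  by have := sE t t0 tb; rewrite s0 ?(tc_X_gt0 TC)//; lra.
have ch : {in `]0, b[, continuous h}.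
  have /(continuous_within_itvP _ b0)[cv' _ _] := cv.
  move=> t tb; apply: cvgD; first exact: cv'.
  move: tb; rewrite in_itv/= => /andP[t0 tb].
  have cpw j : {for t, continuous (fun u => a j * pw (j%:R - be) u)}.
    apply: cvgM; first exact: cvg_cst.
    apply: cvgM; last exact: cvg_cst.
    apply: (@continuous_comp _ _ _ X (fun x => x `^ (j%:R - be))).
      exact: (tc_cont TC).
    by apply: continuous_powRl; rewrite (tc_X_gt0 TC)// ltW.
  exact: (@continuous_sum_ord m (fun j => g < j%:R)
    (fun j u => a j * pw (j%:R - be) u)).
(* At [t = b] only left continuity is available, and it suffices for [rlint_injective]. *)
have lh t : 0 < t -> t <= b -> h r @[r --> t^'-] --> h t.
  move=> t0 tb; have /(continuous_within_itvP _ b0)[cv' _ cvb] := cv.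
  apply: cvgD.
    move: tb; rewrite le_eqVlt => /predU1P[->//|tb].
    by apply: cvg_at_left_filter; apply: cv'; rewrite in_itv/= t0.
  apply: cvg_at_left_filter.
  have cpw j : {for t, continuous (fun u => a j * pw (j%:R - be) u)}.
    apply: cvgM; first exact: cvg_cst.
    apply: cvgM; last exact: cvg_cst.
    apply: (@continuous_comp _ _ _ X (fun x => x `^ (j%:R - be))).
      exact: (tc_cont TC).
    by apply: continuous_powRl; rewrite (tc_X_gt0 TC).
  exact: (@continuous_sum_ord m (fun j => g < j%:R)
    (fun j u => a j * pw (j%:R - be) u)).
(* A further integration of order [q + 1 - be > 0] raises the order of [h] to the integer [q + 1]
   and that of [z] to [q + 1 + (1 - al)], the form that [rlint_injective] inverts. *)
pose q := Num.truncn be.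
have qbe : be < q.+1%:R := truncnS_gt be.
have wh t : 0 < t -> t <= b -> w t = h t.
  move=> t0 tb; have [dz ->] := wz t t0 tb.
  have al1' : 0 < 1 - al by rewrite subr_gt0.
  apply: (rlint_injective TC (n := q) al1' pz ph _ t0 tb dz (lh t t0 tb)) => {t0 tb dz} t t0 tb.
  have qb0 : 0 < q.+1%:R - be by rewrite subr_gt0.
  have q1 : 1 <= q.+1%:R :> R by rewrite ler1n.
  have [mz _] := pz; have [mh _] := ph.
  have e1 : q.+1%:R - be + (g + 1) = q.+1%:R + (1 - al) by rewrite /be; ring.
  have e2 : q.+1%:R - be + be = q.+1%:R by ring.
  have [|_ E1] := rlint_comp TC qb0 (ltr_wpDl g0 ltr01) tb mz.
    by rewrite e1; apply: (rldef_ge1 TC) => //; lra.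
  have [|_ E2] := rlint_comp TC qb0 be0 tb mh.
    by rewrite e2; apply: (rldef_ge1 TC).
  rewrite -e1 -E1 -{2}e2 -E2; apply: (eq_rlint TC) => r /andP[r0 rb] _.
  exact/esym/(hE r r0 (ltW rb)).2.
split.
- apply: (@eq_continuous_itvoo R w h) => // t; rewrite in_itv/= => /andP[t0 tb].
  by apply: wh => //; exact: ltW.
- by apply: (eq_pint TC) ph => t /andP[t0 tb]; rewrite wh// ltW.
- move=> t t0 tb; rewrite F2//; congr (_ + _).
  have [_ <-] := hE t t0 tb; apply: (eq_rlint TC) => r /andP[r0 rb] _.
  by rewrite wh// ltW.
Qed.

(** The kernel is positive at almost every [s] in []0, t[], since [p] is. *)
Lemma rlint_gt0 a y t : 0 < a -> 0 < t -> t <= b -> measurable_fun `]0, b[ y ->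
  rldef a y t -> (forall s, 0 < s < t -> 0 < y s) -> 0 < rlint a y t.
Proof.
move=> a0 t0 tb my dy y0.
have fE : (\int[mu]_s (rlk a t s * y s)%:E = \int[mu]_(s in `]0%R, t[) (rlk a t s * y s)%:E)%E.
  rewrite [RHS]integral_mkcond; apply: eq_integral => s _.
  rewrite patchE mem_setE in_itv/=.
  have [s0|s0] := ltP 0 s => /=; last by rewrite (rlk_out TC) ?mul0r// ltNge s0.
  by case: ifPn => // st; rewrite /rlk (negPf st) mul0r.
rewrite -lte_fin /rlint /Rintegral fineK; last exact: integrable_fin_num.
rewrite fE; apply: integral_gt0_itvoo => //.
- by apply: measurable_funTS; exact: (measurable_rlkM TC).
- by move=> s st; rewrite mulr_ge0 ?(rlk_ge0 TC)// ltW// y0.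
- apply: negligibleS (tc_gt0 TC) => s /=; apply: contra_not => ps.
  rewrite in_itv/= => st; have /andP[s0 st'] := st.
  apply: mulr_gt0; last exact: y0.
  rewrite /rlk st' !mulr_gt0 ?invr_gt0 ?Gamma_gt0//.
  + by apply: ps; rewrite in_itv/= s0 (lt_le_trans st' tb).
  + by rewrite powR_gt0// subr_gt0 (tc_ltX TC)// ltW.
Qed.

Lemma rlint_mean_value a y z t : 0 < a -> 0 < t -> t <= b ->
  {in `]0, b[, continuous y} -> {in `]0, b[, continuous z} ->
  (forall s, 0 < s < t -> 0 < z s) -> rldef a y t -> rldef a z t ->
  exists2 c, 0 < c < t & rlint a y t = rlint a z t * (y c / z c).
Proof.
move=> a0 t0 tb cy cz z0 dy dz.
have mc (u : R -> R) : {in `]0, b[, continuous u} -> measurable_fun (`]0, b[ : set R) u.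
  by move=> cu; apply: open_continuous_measurable_fun => // x; rewrite inE => /cu.
have Iz : 0 < rlint a z t by apply: rlint_gt0 => //; exact: mc.
pose M := rlint a y t / rlint a z t.
pose u s := y s - M * z s.
have du : rldef a u t by apply: rldefB => //; exact: rldefZ.
have Iu : rlint a u t = 0.
  by rewrite rlintB ?rlintZ//; [rewrite /M divfK ?gt_eqF// subrr|exact: rldefZ].
have cu : {in `]0, b[, continuous u}.
  move=> s sb; apply: cvgB; first exact: cy.
  by apply: cvgM; [exact: cvg_cst|exact: cz].
have [c ct uc] : exists2 c, 0 < c < t & u c = 0.
  apply: contrapT => nex.
  have un s : 0 < s < t -> u s != 0.
    by move=> st; apply/eqP => us; apply: nex; exists s.
  have IVTu r s : 0 < r -> r <= s -> s < t ->
      ~ (Num.min (u r) (u s) <= 0 <= Num.max (u r) (u s)).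
    move=> r0 rs st H; have [|c] := IVT rs _ H.
      apply: continuous_in_subspaceT => c; rewrite inE/= in_itv/= => /andP[rc cs].
      by apply: cu; rewrite in_itv/=; lra.
    rewrite in_itv/= => /andP[rc cs]; apply/eqP/un.
    by rewrite (lt_le_trans r0 rc) (le_lt_trans cs st).
  have sgn r s : 0 < r < t -> 0 < s < t -> 0 < u r -> 0 < u s.
    move=> /andP[r0 rt] /andP[s0 st] ur.
    have := un s; rewrite s0 st => /(_ isT); rewrite neq_lt => /orP[us|//].
    have [rs|/ltW sr] := leP r s.
      by case: (IVTu r s r0 rs st); rewrite ge_min le_max (ltW us) (ltW ur) orbT.
    by case: (IVTu s r s0 sr rt); rewrite ge_min le_max (ltW us) (ltW ur) orbT.
  have t2 : 0 < t / 2 < t by lra.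
  have := un _ t2; rewrite neq_lt => /orP[ut|ut].
    have un' s : 0 < s < t -> 0 < - u s.
      move=> st; rewrite oppr_gt0 lt_neqAle un//= leNgt; apply/negP => us.
      by have := sgn _ _ st t2 us; rewrite ltNge (ltW ut).
    suff : 0 < rlint a (fun s => -1 * u s) t by rewrite rlintZ// Iu mulr0 ltxx.
    apply: rlint_gt0 => //.
    + by apply: measurable_funM => //; exact: mc.
    + exact: rldefZ.
    + by move=> s st; rewrite mulN1r un'.
  suff : 0 < rlint a u t by rewrite Iu ltxx.
  apply: rlint_gt0 => //; first exact: mc.
  by move=> s st; exact: sgn ut.
exists c => //; have zc := z0 c ct.
have -> : y c / z c = M.
  by move/eqP: uc; rewrite /u subr_eq0 => /eqP ->; rewrite mulfK// gt_eqF.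
by rewrite /M mulrC divfK// gt_eqF.
Qed.

End fractional_expansion.

(** * The clock of an admissible function *)

Section admissible_time_change.
Context {R : realType} (b : R) (Psi : R -> R).
Implicit Types (r s t : R).
Local Notation mu := (@lebesgue_measure R).
Hypotheses (b0 : 0 < b) (adm : admissible b Psi).

(** The projection of the line onto [[0, b]]; composing with it turns continuity of [Psi] within
    [[0, b]] into continuity on the whole line. *)
Definition clamp t : R := Num.max 0 (Num.min t b).

Definition clock t : R := Psi (clamp t) - Psi 0.

Definition speed : R -> R := derive1 Psi \_ `]0, b[.

Lemma clamp_itv t : 0 <= clamp t <= b.
Proof. by rewrite /clamp le_max lexx ge_max (ltW b0) ge_min lexx orbT. Qed.

Lemma clamp_id t : 0 <= t <= b -> clamp t = t.
Proof. by move=> /andP[t0 tb]; rewrite /clamp min_l// max_r. Qed.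

Lemma clockE t : 0 <= t <= b -> clock t = Psi t - Psi 0.
Proof. by move=> tb; rewrite /clock clamp_id. Qed.

Lemma speedE s : 0 < s < b -> speed s = derive1 Psi s.
Proof. by move=> sb; rewrite /speed patchE ifT// mem_setE in_itv. Qed.

Lemma speed_out s : ~~ (0 < s < b) -> speed s = 0.
Proof. by move=> sb; rewrite /speed patchE ifF// mem_setE in_itv/=; exact/negbTE. Qed.

Lemma continuous_clamp : continuous clamp.
Proof.
move=> t; apply: (@continuous_comp _ _ _ (fun t => Num.min t b) (fun t => Num.max 0 t)).
  by apply: continuous_min; [exact: cvg_id|exact: cvg_cst].
by apply: continuous_max; [exact: cvg_cst|exact: cvg_id].
Qed.

Lemma continuous_clock : continuous clock.
Proof.
have [[cPsi _] _ _] := adm.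
move=> t; apply: cvgB; last exact: cvg_cst.
have Act : `[0, b]%classic (clamp t) by rewrite /= in_itv/= clamp_itv.
move=> S HS.
have : nbhs_subspace (clamp t : subspace `[0, b]) (Psi @^-1` S) := cPsi (clamp t) S HS.
rewrite -nbhs_subspace_in// => /(@continuous_clamp t).
move=> N; suff : nbhs t (fun s => S (Psi (clamp s))) by [].
have {}N : nbhs t (fun s => `[0, b]%classic (clamp s) -> S (Psi (clamp s))) := N.
by apply: filterS N => s /=; apply; rewrite in_itv/= clamp_itv.
Qed.

Lemma derivable_Psi s : 0 < s < b -> derivable Psi s 1.
Proof. by have [[_ /(_ 0%N)[d _]] _ _] := adm => sb; apply: d; rewrite in_itv. Qed.

Lemma continuous_derive1_Psi : {in `]0, b[, continuous (derive1 Psi)}.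
Proof.
have [[_ /(_ 1%N)[d _]] _ _] := adm => s sb.
by apply/differentiable_continuous/derivable1_diffP; exact: d.
Qed.

(** Equal values would make the monotone [Psi] constant between [r] and [t], with derivative 0 on a
    set of positive measure. *)
Lemma Psi_lt r t : 0 <= r -> r < t -> t <= b -> Psi r < Psi t.
Proof.
move=> r0 rt tb; have [_ hPsi aePsi] := adm.
have rb : r \in `[0, b] by rewrite in_itv/=; lra.
have tb' : t \in `[0, b] by rewrite in_itv/=; lra.
rewrite lt_neqAle hPsi ?(ltW rt)// andbT; apply/eqP => Prt.
have Pc s : r <= s <= t -> Psi s = Psi r.
  move=> /andP[rs st]; have sb : s \in `[0, b] by rewrite in_itv/=; lra.
  by apply/eqP; rewrite eq_le {1}Prt !hPsi.
have : mu `]r, t[%classic = 0%E.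
  apply/negligibleP; first exact: measurable_itv.
  apply: negligibleS aePsi => s /=; rewrite in_itv/= => /andP[rs st].
  have sb : s \in `]0, b[ by rewrite in_itv/=; lra.
  move=> /(_ sb); rewrite derive1E.
  rewrite (@near_eq_derive _ _ _ Psi (cst (Psi r)))//.
    by rewrite derive_cst ltxx.
  have srt : s \in `]r, t[ by rewrite in_itv/= rs.
  near=> u; apply: Pc.
  have : u \in `]r, t[ by near: u; exact: near_in_itvoo srt.
  by rewrite in_itv/=; lra.
rewrite lebesgue_measure_itv/= lte_fin rt.
by move/eqP; rewrite -EFinB eqe subr_eq0 gt_eqF.
Unshelve. all: by end_near. Qed.

Lemma clock_derive s : 0 < s < b ->
  derivable clock s 1 /\ derive1 clock s = derive1 Psi s.
Proof.
move=> sb; have sb' : s \in `]0, b[ by rewrite in_itv.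
have E : \forall u \near s, clock u = Psi u - Psi 0.
  near=> u; apply: clockE.
  have : u \in `]0, b[ by near: u; exact: near_in_itvoo sb'.
  by rewrite in_itv/=; lra.
have dP := derivable_Psi sb.
have dPc : derivable (fun u => Psi u - Psi 0) s 1 by exact: derivableB dP (derivable_cst _ _ _).
split; first by apply: near_eq_derivable dPc => //; apply: filterS E.
rewrite !derive1E (near_eq_derive _ E)//.
by rewrite (deriveB dP (derivable_cst _ _ _)) derive_cst subr0.
Unshelve. all: by end_near. Qed.

Lemma admissible_time_change : time_change b clock speed.
Proof.
have incr : {in `[0, b] &, {homo clock : s t / s < t}}.
  move=> s t; rewrite !in_itv/= => sb tb st; rewrite !clockE// ltrD2r Psi_lt//; lra.
have [_ hPsi aePsi] := adm.
split => //.
- by rewrite clockE ?subrr// lexx ltW.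
- exact: continuous_clock.
- apply/(measurable_restrictT _ (measurable_itv `]0, b[)).
  apply: open_continuous_measurable_fun => // x; rewrite inE/=.
  exact: continuous_derive1_Psi.
- move=> s; have [sb|sb] := boolP (0 < s < b); last by rewrite speed_out.
  rewrite speedE//.
  (* Positivity of [Psi'] holds only almost everywhere; monotonicity gives nonnegativity at every
     point. *)
  have [_ <-] := clock_derive sb.
  apply: (@incr_derive1_ge0_itv R clock true false 0 b s _ incr); last by rewrite in_itv.
  by move=> u; rewrite inE/= in_itv/= => /clock_derive[].
- exact: speed_out.
- apply: negligibleS aePsi => s /=; apply: contra_not => H sb.
  by rewrite speedE ?H//; move: sb; rewrite in_itv.
- move=> G r t r0 rt tb cG G0.
  have rtb s : s \in `]r, t[ -> 0 < s < b by rewrite in_itv/=; lra.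
  rewrite -(@ge0_integration_by_substitution_itvoo R clock G r t)//.
  + apply: eq_integral => s; rewrite inE/= => /rtb sb.
    by have [_ ->] := clock_derive sb; rewrite speedE.
  + exact: continuous_subspaceT continuous_clock.
  + by move=> x y; rewrite !in_itv/= => xr yr; apply: incr; rewrite in_itv/=; lra.
  + by move=> x /rtb/clock_derive[].
  + apply: (@eq_continuous_itvoo R _ (derive1 Psi)) => x /rtb xb.
      by have [] := clock_derive xb.
    by apply: continuous_derive1_Psi; rewrite in_itv.
Qed.

End admissible_time_change.

(** * Tempered derivatives as Riemann-Liouville integrals *)

Section tempered_representation.
Context {R : realType} (b : R) (Psi : R -> R) (lam : R).
Implicit Types (a c g s t r : R) (y z w : R -> R).
Local Notation mu := (@lebesgue_measure R).
Hypotheses (b0 : 0 < b) (adm : admissible b Psi).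

Let X := clock b Psi.
Let p := speed b Psi.
Let TC : time_change b X p := admissible_time_change b0 adm.
Local Notation rlk := (rlk X p).
Local Notation rlint := (rlint X p).
Local Notation rldef := (rldef X p).
Local Notation pint := (pint b X p).
Local Notation pw := (pw X).
Local Notation E := (expw X lam).

Lemma ae_eq_integrable_Rintegral (f g : R -> R) : mu.-integrable setT (EFin \o f) ->
  measurable_fun setT g -> {ae mu, forall s, f s = g s} ->
  mu.-integrable setT (EFin \o g) /\ \int[mu]_s f s = \int[mu]_s g s.
Proof.
move=> if_ mg fg.
have mf : measurable_fun setT (EFin \o f) := measurable_int mu if_.
have mge : measurable_fun setT (EFin \o g) by exact/measurable_EFinP.
have aeE : ae_eq mu setT (EFin \o f) (EFin \o g).
  by apply: negligibleS fg => s /=; apply: contra_not => -> _.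
split.
  apply/integrableP; split => //.
  have <- : (\int[mu]_s `|(EFin \o f) s| = \int[mu]_s `|(EFin \o g) s|)%E.
    apply: ge0_ae_eq_integral => //.
    - exact: measurableT_comp.
    - exact: measurableT_comp.
    - exact: ae_eq_abse.
  by case/integrableP : if_.
by rewrite /Rintegral; congr fine; exact: ae_eq_integral.
Qed.

Lemma ae_rlint a y z t : measurable_fun `]0, b[ z -> rldef a y t ->
  {ae mu, forall s, s \in `]0, b[ -> y s = z s} ->
  rldef a z t /\ rlint a y t = rlint a z t.
Proof.
move=> mz dy yz; apply: ae_eq_integrable_Rintegral => //.
  exact: (measurable_rlkM TC).
apply: negligibleS yz => s /=; apply: contra_not => H.
have [sb|sb] := boolP (0 < s < b); first by rewrite H// in_itv.
by rewrite !(rlk_out TC a t sb) !mul0r.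
Qed.

(** Reconciles integrals over the closed [[0, t]] with kernels supported in [0 < s < t]. *)
Lemma negligible_endpoints t (P : R -> Prop) :
  {ae mu, forall s, s != 0 -> s != t -> P s} -> {ae mu, forall s, P s}.
Proof.
move=> aeP; have n1 r : mu.-negligible [set r].
  by apply/negligibleP; [exact: measurable_set1|exact: lebesgue_measure_set1].
apply: negligibleS (negligibleU (negligibleU (n1 0) (n1 t)) aeP) => s /= nP.
have [->|s0] := eqVneq s 0; first by left; left.
have [->|st] := eqVneq s t; first by left; right.
by right => H; exact: nP (H isT isT).
Qed.

Lemma tc_XE t : 0 <= t -> t <= b -> X t = Psi t - Psi 0.
Proof. by move=> t0 tb; rewrite /X clockE// t0. Qed.

(** Almost everywhere [p > 0], hence [p u] is the derivative of [y]; where [p = 0] the convention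
    [0^-1 = 0] gives [p u = 0], so [|p u|] is at most [|y'|] on []0, b[]. *)
Lemma ac_primitive y : abs_continuous b y ->
  let u s := (p s)^-1 * derive1 y s in
  pint u /\ forall t, 0 <= t -> t <= b -> y t = y 0 + rlint 1 u t.
Proof.
move=> [_ iy yE] u.
have my : measurable_fun `]0, b[ (derive1 y).
  apply: (@measurable_funS _ _ _ _ `[0, b]) => //; first exact: subset_itv_oo_cc.
  by apply/measurable_EFinP; exact: measurable_int iy.
have mp : measurable_fun setT (fun s => (p s)^-1).
  (* The inverse is written as a real power, whose measurability is known. *)
  have -> : (fun s => (p s)^-1) = (fun s => p s `^ (-1)).
    by apply/funext => s; rewrite powR_inv1// (tc_ge0 TC).
  by apply: measurable_fun_powR; exact: (tc_measurable TC).
have mu_ : measurable_fun `]0, b[ u.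
  by apply: measurable_funM => //; exact: measurable_funTS.
have iyT : mu.-integrable setT ((EFin \o derive1 y) \_ `[0, b]).
  exact/(integrable_mkcond _ _).1.
have pu : pint u.
  split=> //; apply: (le_integrable measurableT _ _ iyT).
    by apply/measurable_EFinP; exact: (measurable_rlkM TC).
  move=> s _; rewrite /= (rlk1 TC) /u mulrA.
  have [sb|sb] := boolP (0 < s < b); last first.
    by rewrite (tc_out TC sb) mul0r mul0r normr0; exact: abse_ge0.
  rewrite patchE ifT; last by rewrite mem_setE in_itv/=; lra.
  rewrite /= lee_fin normrM ler_piMl//.
  have [->|ps] := eqVneq (p s) 0; first by rewrite mul0r normr0.
  by rewrite divff// normr1.
split=> // t; rewrite le_eqVlt => /predU1P[<- _|t0 tb].
  by rewrite (rlint_at0 TC) addr0.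
apply/eqP; rewrite -subr_eq0 opprD addrA subr_eq0; apply/eqP.
rewrite yE; last by rewrite in_itv/= tb ltW.
have if_ : mu.-integrable setT (EFin \o ((derive1 y) \_ `[0, t])).
  have : mu.-integrable `[0, t] (EFin \o derive1 y).
    by apply: integrableS iy => //; apply: subset_itvl; rewrite bnd_simp.
  move=> /(integrable_mkcond _ _)/=; rewrite restrict_EFin.
  by apply; exact: measurable_itv.
rewrite Rintegral_mkcond.
apply: (ae_eq_integrable_Rintegral if_ _ _).2; first exact: (measurable_rlkM TC).
apply: (@negligible_endpoints t).
apply: negligibleS (tc_gt0 TC) => s /=; apply: contra_not => H s0 st.
rewrite patchE mem_setE in_itv/= /rlk.
have [{}s0|s0'] := ltP 0 s; last first.
  rewrite ifF; last by apply/negbTE; rewrite negb_and -ltNge lt_neqAle s0 s0'.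
  by rewrite (tc_out TC) ?mul0r ?mulr0 ?if_same ?mul0r// ltNge s0'.
have [{}st|ts] := ltP s t; last first.
  rewrite ifF ?mul0r//; apply/negbTE; rewrite negb_and -!ltNge orbC.
  by rewrite lt_neqAle eq_sym st ts.
rewrite (ltW s0) (ltW st)/= Gamma1 invr1 mul1r subrr powRr0 mulr1 /u mulVKf// gt_eqF//.
by apply: H; rewrite in_itv/= s0 (lt_le_trans st tb).
Qed.

(** As [w] is prescribed only almost everywhere, [z] is introduced as an explicit measurable version
    of [E w]. *)
Lemma ac_tempered_primitive y w : abs_continuous b y ->
  {ae mu, forall t, t \in `]0, b[ -> w t = (derive1 Psi t)^-1 * derive1 y t + lam * y t} ->
  exists2 z, pint z /\ {ae mu, forall t, t \in `]0, b[ -> z t = E t * w t} &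
    forall t, 0 <= t -> t <= b -> E t * y t = y 0 + rlint 1 z t.
Proof.
move=> ac aew; have [pu yE] := ac_primitive ac.
set u := fun s => _ in pu yE.
have py : pint y.
  apply: (eq_pint TC (y := fun s => y 0 * pw 0 s + rlint 1 u s)).
    by move=> s /andP[s0 sb]; rewrite pw0/= mulr1 -yE// ltW.
  apply: pintD; last exact: (pint_rlint TC).
  by apply: pintZ; exact: (pint_pw TC (ltrN10 R)).
exists (fun s => E s * (u s + lam * y s)).
  split; first by apply: (pint_expwM lam TC); apply: pintD => //; exact: pintZ.
  apply: negligibleS aew => s /=; apply: contra_not => H sb.
  by rewrite H// /u /p speedE//; move: sb; rewrite in_itv.
exact: (expw_primitive lam TC pu yE).
Qed.

(** The tempering is absorbed by the weight: [E t * exp (- lam (X t - X s)) = E s]. *)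
Lemma tempered_integral_rlint g y z t : 0 < g -> 0 < t -> t <= b ->
  tempered_integrable Psi lam g y t -> measurable_fun `]0, b[ z ->
  {ae mu, forall s, s \in `]0, b[ -> z s = E s * y s} ->
  rldef g z t /\ E t * tempered_integral Psi lam g y t = rlint g z t.
Proof.
move=> g0 t0 tb iy mz zy; have Gg := Gamma_gt0 g0.
have Et := expw_gt0 X lam t.
pose f s := tempered_kernel Psi lam g t s * y s.
have m0t : measurable (`[0, t] : set (g_sigma_algebraType R.-ocitv.-measurable)).
  exact: measurable_itv.
have iF : mu.-integrable setT (EFin \o (f \_ `[0, t])).
  by move: iy => /(integrable_mkcond _ m0t); rewrite restrict_EFin.
pose k := E t / Gamma g.
have ikF : mu.-integrable setT (EFin \o (fun s => k * (f \_ `[0, t]) s)).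
  by have := integrableZl measurableT k iF; apply: eq_integrable.
have [] := @ae_eq_integrable_Rintegral _ (fun s => rlk g t s * z s) ikF.
- exact: (measurable_rlkM TC).
- apply: (@negligible_endpoints t).
  apply: negligibleS zy => s /=; apply: contra_not => H s0 st.
  rewrite patchE mem_setE in_itv/=.
  have [{}s0|s0'] := ltP 0 s; last first.
    rewrite ifF; last by apply/negbTE; rewrite negb_and -ltNge lt_neqAle s0 s0'.
    by rewrite (rlk_out TC) ?mul0r ?mulr0// ltNge s0'.
  have [{}st|ts] := ltP s t; last first.
    rewrite ifF; last by apply/negbTE; rewrite negb_and -!ltNge orbC lt_neqAle eq_sym st ts.
    by rewrite /rlk ltNge ts/= mulr0 mul0r.
  have sb : 0 < s < b by rewrite s0 (lt_le_trans st tb).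
  rewrite (ltW s0) (ltW st)/= H ?in_itv//= /f /tempered_kernel /rlk st /k.
  have -> : derive1 Psi s = p s by rewrite /p speedE.
  have -> : Psi t - Psi s = X t - X s.
    by rewrite !tc_XE ?(ltW s0) ?(ltW t0)//; [ring|exact: (ltW (lt_le_trans st tb))].
  have -> : E t = E s * expR (lam * (X t - X s)).
    by rewrite /expw -expRD; congr expR; ring.
  rewrite mulNr expRN.
  move: (expR_gt0 (lam * (X t - X s))); move: (expR _) (E s) (_ `^ _) (Gamma g) Gg.
  by move=> e1 e2 q G G0 e10; field; rewrite !gt_eqF.
move=> d e; split=> //; rewrite /rlint -e RintegralZl// -Rintegral_mkcond.
by rewrite /tempered_integral mulrA.
Qed.

(** Each differentiation is undone by one integration, which shifts the coefficients found for [w]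
    by one place and puts [y 0] in front. *)
Lemma tempered_derivn_expansion (m : nat) y z : is_tempered_derivn b Psi lam m.+1 y z ->
  exists (a : nat -> R) (h : R -> R),
    [/\ pint h, {ae mu, forall s, s \in `]0, b[ -> h s = E s * z s} &
      forall t, 0 <= t -> t <= b ->
        E t * y t = \sum_(j < m.+1) a j * pw j%:R t + rlint m.+1%:R h t].
Proof.
elim: m y => [|m IH] y.
  move=> /= [ac [w aew zw]]; have [h [ph aeh] yE] := ac_tempered_primitive ac aew.
  exists (fun=> y 0), h; split => //.
    apply: negligibleS aeh => s /=; apply: contra_not => H sb.
    by rewrite H// zw//; exact: subset_itv_oo_cc sb.
  by move=> t t0 tb; rewrite big_ord1 pw0/= mulr1 yE.
move=> [ac [w aew /IH[a [h [ph aeh wE]]]]].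
have [h0 [ph0 aeh0] yE] := ac_tempered_primitive ac aew.
exists (fun j => if j is j'.+1 then a j' else y 0), h; split; [exact: ph|exact: aeh|move=> t t0 tb].
have m0 : 0 < m.+1%:R :> R by rewrite ltr0n.
have m1 : 1 <= m.+1%:R :> R by rewrite ler1n.
have pN (j : nat) : -1 < j%:R :> R by rewrite (lt_le_trans (ltrN10 R)).
(* [h0] is a version of [E w] and agrees with this expansion only almost everywhere, which is enough
   under the integral. *)
pose Z s := \sum_(j < m.+1) a j * pw j%:R s + rlint m.+1%:R h s.
have pZ : pint Z.
  apply: pintD; last exact: (pint_rlint TC).
  by apply: (@pint_sum _ _ _ _ m.+1 xpredT a (fun j => pw j%:R)) => j _ _; exact: (pint_pw TC).
have [mZ _] := pZ.
have [|_ e0] := @ae_rlint 1 h0 Z t mZ (rldef_ge1 TC (lexx 1) t0 tb ph0).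
  apply: negligibleS aeh0 => s /=; apply: contra_not => H sb.
  rewrite H// wE//; move: sb; rewrite in_itv/= => /andP[s0 sb]; exact: ltW.
have dp (j : nat) : rldef 1 (pw j%:R) t by exact: (rldef_pw TC).
have [dS eS] := @rlint_sum _ X p 1 m.+1 xpredT a (fun j => pw j%:R) t (fun j _ _ => dp j).
have [mh _] := ph.
have [|dh eh] := rlint_comp TC ltr01 m0 tb mh.
  by apply: (rldef_ge1 TC) => //; rewrite lerDl ltW.
rewrite yE// e0 rlintD// eS eh [in RHS]big_ord_recl.
have -> : pw (@ord0 m.+1)%:R t = 1 by rewrite /= pw0.
rewrite mulr1 -addrA; congr (_ + (_ + _)).
  apply: eq_bigr => j _; have j1 : 0 < 1 + j%:R :> R by rewrite ltr_wpDr.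
  rewrite (rlint_pw TC ltr01 (pN j) t0 tb (or_introl j1)).
  by rewrite lift0 -[j.+1]add1n natrD.
Qed.

(** For non-integer [g] the semigroup law splits the order [m + 1] into [g] and [m + 1 - g], and the
    inner integral is [E D]. For integer [g] the remainder is already of order [g]. *)
Lemma tc_derive_expansion g f D : 0 < g -> is_tc_derive b Psi lam g f D ->
  {within `[0, b], continuous D} ->
  exists (m : nat) (a : nat -> R), (forall j, (j < m)%N -> j%:R < g) /\
    forall t, 0 < t -> t <= b ->
      E t * f t = \sum_(j < m) a j * pw j%:R t + rlint g (fun s => E s * D s) t.
Proof.
move=> g0 dD cD.
have cED : {within `[0, b], continuous (fun s => E s * D s)}.
  have cE : {within `[0, b], continuous E}.
    by apply: continuous_subspaceT; move=> s; exact: (continuous_expw TC).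
  by move=> s; apply: cvgM; [exact: cE|exact: cD].
have [mED _] := itvcc_continuous cED.
case: dD => [[[|m] gE dn]|[m [/andP[mg gm] [z dn zD]]]].
- by move: g0; rewrite gE ltxx.
- have [a [h [ph aeh fE]]] := tempered_derivn_expansion dn.
  exists m.+1, a; split; first by move=> j jm; rewrite gE ltr_nat.
  move=> t t0 tb; rewrite fE// ?(ltW t0)//; congr (_ + _); rewrite gE.
  have dh : rldef m.+1%:R h t by apply: (rldef_ge1 TC); rewrite ?ler1n// ltW.
  exact: (ae_rlint mED dh aeh).2.
- have [a [h [ph aeh fE]]] := tempered_derivn_expansion dn.
  exists m.+1, a; split.
    by move=> j jm; apply: le_lt_trans mg; rewrite ler_nat -ltnS.
  move=> t t0 tb; rewrite fE// ?(ltW t0)//; congr (_ + _).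
  have mg0 : 0 < m.+1%:R - g by rewrite subr_gt0.
  have [mh _] := ph.
  have [|_ eh] := rlint_comp TC g0 mg0 tb mh.
    rewrite addrC subrK; apply: (rldef_ge1 TC); rewrite ?ler1n//; exact: ltW.
  rewrite -{1}(subrK g m.+1%:R) addrC -eh.
  apply: (eq_rlint TC) => s /andP[s0 /ltW sb] _.
  have [|iz ->] := zD s; first by rewrite in_itv/= s0.
  exact/esym/(tempered_integral_rlint mg0 s0 sb iz mh aeh).2.
Qed.

(** An order in []0, 1[] leaves only one differentiation followed by an integral of order [1 - al].
    The same [h] then represents both [y] and its derivative, which is what links successive
    iterates. *)
Lemma tc_derive_step al y w : 0 < al < 1 -> is_tc_derive b Psi lam al y w ->
  exists2 h, pint h &
    (forall t, 0 <= t -> t <= b -> E t * y t = y 0 + rlint 1 h t) /\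
    (forall t, 0 < t -> t <= b ->
      rldef (1 - al) h t /\ E t * w t = rlint (1 - al) h t).
Proof.
move=> /andP[al0 al1] [[m alE _]|[m [/andP[mal alm] [z [ac [w0 aew0 zw0]] zw]]]].
  by exfalso; move: al0 al1; rewrite alE ltr0n ltrn1; case: m {alE}.
have m0 : m = 0%N.
  by apply/eqP; rewrite -leqn0 -ltnS -(ltr_nat R); exact: lt_trans al1.
subst m.
have [h [ph aeh] yE] := ac_tempered_primitive ac aew0.
have [mh _] := ph.
exists h => //; split=> // t t0 tb.
have [|iz ->] := zw t; first by rewrite in_itv/= t0.
apply: (tempered_integral_rlint _ t0 tb iz mh); first by rewrite subr_gt0.
apply: negligibleS aeh => s /=; apply: contra_not => H sb.
by rewrite H// zw0//; exact: subset_itv_oo_cc sb.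
Qed.

End tempered_representation.

(** * Expansion along the iterates and the remainder in mean value form *)

Section tempered_taylor.
Context {R : realType} (b : R) (Psi : R -> R) (lam al : R).
Implicit Types (a c g s t r : R) (y z w : R -> R).
Local Notation mu := (@lebesgue_measure R).
Hypotheses (b0 : 0 < b) (adm : admissible b Psi) (al01 : 0 < al < 1).

Let X := clock b Psi.
Let p := speed b Psi.
Let TC : time_change b X p := admissible_time_change b0 adm.
Local Notation rlint := (rlint X p).
Local Notation rldef := (rldef X p).
Local Notation pint := (pint b X p).
Local Notation pw := (pw X).
Local Notation E := (expw X lam).

(** Since [I^1 z = I^al I^(1 - al) z = I^al (E w)], an expansion of [E w] yields one of [E y] with
    one more term. All lengths [k <= n] are recorded because the coefficients are identified one
    order at a time. *)
Lemma tc_derive_iter_expansion (n : nat) y h :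
  is_tc_derive_iter b Psi lam al n.+1 y h ->
  exists (W : nat -> R) (Z : nat -> R -> R),
    [/\ W 0%N = y 0,
      forall k, (k <= n)%N -> pint (Z k) /\ forall t, 0 < t -> t <= b ->
        E t * y t = \sum_(i < k.+1) W i * pw (i%:R * al) t + rlint (k%:R * al + 1) (Z k) t &
      forall t, 0 < t -> t <= b ->
        rldef (1 - al) (Z n) t /\ E t * h t = rlint (1 - al) (Z n) t].
Proof.
have /andP[al0 al1] := al01.
have al0' : 0 < 1 - al by rewrite subr_gt0.
elim: n y => [|n IH] y [w dw iw];
  have [z pz [yE wE]] := tc_derive_step b0 adm al01 dw.
  exists (fun=> y 0), (fun=> z); split=> //.
    move=> k; rewrite leqn0 => /eqP ->; split=> // t t0 tb.
    by rewrite big_ord1 !mul0r pw0 mulr1 add0r yE// ltW.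
  by move=> t t0 tb; rewrite iw; [exact: wE|rewrite in_itv/= tb ltW].
have [W [Z [W0 WE hE]]] := IH _ iw.
exists (fun i => if i is j.+1 then W j else y 0), (fun i => if i is j.+1 then Z j else z).
split=> // -[_|k /WE[pZ kE]].
  split=> // t t0 tb.
  by rewrite big_ord1 !mul0r pw0 mulr1 add0r yE// ltW.
split; [exact: pZ|move=> t t0 tb; have t0' := ltW t0].
have [mz _] := pz; have [mZ _] := pZ.
have k0 : 0 <= k%:R * al by rewrite mulr_ge0// ltW.
have [|_ e1] := rlint_comp TC al0 al0' tb mz.
  by apply: (rldef_ge1 TC) => //; rewrite addrC subrK.
have e2 : rlint 1 z t = rlint al
    (fun s => \sum_(i < k.+1) W i * pw (i%:R * al) s + rlint (k%:R * al + 1) (Z k) s) t.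
  rewrite -[in LHS](subrK al 1) [1 - al + al]addrC -e1.
  apply: (eq_rlint TC) => s /andP[s0 /ltW sb] _.
  by rewrite -(wE s s0 sb).2 kE.
have pN (j : nat) : -1 < j%:R * al.
  by apply: (lt_le_trans (ltrN10 R)); rewrite mulr_ge0// ltW.
have [dS eS] := @rlint_sum _ X p al k.+1 xpredT W (fun j => pw (j%:R * al)) t
  (fun j _ _ => rldef_pw TC al0 (pN j) t0' tb).
have k1 : 0 < k%:R * al + 1 by rewrite ltr_wpDl.
have [|dZ eZ] := rlint_comp TC al0 k1 tb mZ.
  by apply: (rldef_ge1 TC) => //; rewrite addrA lerDr addr_ge0// ltW.
rewrite yE// e2 rlintD// eS eZ [in RHS]big_ord_recl.
have -> : pw ((@ord0 k.+1)%:R * al) t = 1 by rewrite mul0r pw0.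
have kS (j : nat) : al + j%:R * al = j.+1%:R * al by rewrite -[j.+1]add1n natrD mulrDl mul1r.
rewrite mulr1 [al + (_ + 1)]addrA kS -[RHS]addrA; congr (_ + (_ + _)).
apply: eq_bigr => j _; rewrite (rlint_pw TC al0 (pN j) t0' tb (or_intror t0)).
by rewrite lift0 kS.
Qed.

Lemma tc_derive0_at0 y w : is_tc_derive b Psi lam 0 y w -> w 0 = y 0.
Proof.
move=> [[m m0 H]|[m [/andP[+ _] _]]]; last by rewrite ltNge ler0n.
move: m0 H => /esym/eqP; rewrite pnatr_eq0 => /eqP -> /= -> //.
by rewrite in_itv/= lexx ltW.
Qed.

Lemma tempered_mean_value_expansion (n : nat) f (D : nat -> R -> R) h t :
  (forall k, (k <= n.+1)%N -> is_tc_derive b Psi lam (k%:R * al) f (D k) /\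
     {within `[0, b], continuous (D k)}) ->
  is_tc_derive_iter b Psi lam al n.+1 f h -> 0 < t -> t <= b ->
  exists2 c, 0 < c < t & E t * f t = \sum_(i < n.+1) D i 0 * pw (i%:R * al) t +
    X t `^ (n.+1%:R * al) * mittag_leffler 1 (n.+1%:R * al + 1) (lam * X t) * h c.
Proof.
move=> dD hf t0 tb; have /andP[al0 al1] := al01.
have [W [Z [W0 WE hE]]] := tc_derive_iter_expansion hf.
have cE : {within `[0, b], continuous E}.
  by apply: continuous_subspaceT => s; exact: (continuous_expw TC).
have cED i : {within `[0, b], continuous (D i)} ->
    {within `[0, b], continuous (fun s => E s * D i s)}.
  by move=> cD s; apply: cvgM; [exact: cE|exact: cD].
have WD i : (i <= n)%N -> W i = D i 0.
  (* Index 0 is separate: [leading_coef_eq] requires a positive order, and at order 0 the derivative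
     is [f] itself. *)
  case: i => [_|i ilt].
    by have [+ _] := dD 0%N isT; rewrite mul0r W0 => /tc_derive0_at0->.
  have [di ci] := dD i.+1 (leqW ilt).
  have i0 : 0 < i.+1%:R * al by rewrite mulr_gt0// ltr0n.
  have [m [a [ma fE]]] := tc_derive_expansion b0 adm i0 di ci.
  have [pZ fE'] := WE _ ilt.
  (* As [E 0 = 1], the value [D i.+1 0] is that of the weighted function at 0. *)
  rewrite -[RHS]mul1r -(expw0 lam TC).
  apply: (leading_coef_eq TC (F := fun s => E s * f s) (v := fun s => E s * D i.+1 s)
    (w := W) (k := i.+1) (al := al) i0 ma _ (cED _ ci) pZ fE).
    by move=> j ji; rewrite ltr_pM2r// ltr_nat.
  by move=> s s0 sb; rewrite fE'// big_ord_recr.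
have [dn cn] := dD n.+1 (leqnn _).
have beE : n.+1%:R * al = n%:R * al + al by rewrite -natr1 mulrDl mul1r.
have be0 : 0 < n%:R * al + al by rewrite -beE mulr_gt0// ltr0n.
have [|m [a [ma fE]]] := tc_derive_expansion b0 adm _ dn cn; first by rewrite beE.
rewrite beE in ma fE *.
have [pZ fE'] := WE _ (leqnn n).
have [cEh pEh EfE] := remainder_continuous_version TC al01 ma (cED _ cn) pZ fE fE' hE.
have [mZ _] := pZ.
have al0' : 0 < 1 - al by rewrite subr_gt0.
(* On []0, b]] the function [E h] is an integral of order [1 - al], so the composed order is
   [n al + 1 >= 1], where convergence is automatic. *)
have dEh : rldef (n%:R * al + al) (fun s => E s * h s) t.
  apply: (eq_rldef TC (y := rlint (1 - al) (Z n))).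
    by move=> s /andP[s0 /ltW sb] _; rewrite (hE s s0 sb).2.
  apply: (rlint_comp TC be0 al0' tb mZ _).1.
  apply: (rldef_ge1 TC _ (ltW t0) tb pZ).
  have -> : n%:R * al + al + (1 - al) = n%:R * al + 1 by ring.
  by rewrite lerDr mulr_ge0// ltW.
have dE : rldef (n%:R * al + al) E t by apply: (rldef_expw lam TC be0 (ltW t0) tb).
have cE0 : {in `]0, b[, continuous E} by move=> s _; exact: (continuous_expw TC).
have E0 s : 0 < s < t -> 0 < E s by move=> _; exact: expw_gt0.
(* Comparing [E h] with [E] itself makes the quotient at [c] equal to [h c], without a stray
   weight. *)
have [c c0t eR] := rlint_mean_value TC be0 t0 tb cEh cE0 E0 dEh dE.
exists c => //; rewrite EfE// eR (rlint_expw lam TC be0 t0 tb); congr (_ + _).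
  by apply: eq_bigr => i _; rewrite WD// -ltnS.
by rewrite mulrC [E c * _]mulrC mulfK ?gt_eqF ?expw_gt0// mulrC.
Qed.

End tempered_taylor.

Theorem theorem4p5 (R : realType) (b : R) (Psi : R -> R) (alpha lambda : R)
    (n : nat) (f : R -> R) (D : nat -> R -> R) (h : R -> R)
    (b_gt0 : 0 < b) (Psi_adm : admissible b Psi)
    (alpha01 : 0 < alpha < 1)
    (D_deriv : forall k : nat, (k <= n.+1)%N ->
       is_tc_derive b Psi lambda (k%:R * alpha) f (D k) /\
       {within `[0, b], continuous (D k)})
    (h_iter : is_tc_derive_iter b Psi lambda alpha n.+1 f h) :
  forall t : R, t \in `[0, b] ->
  exists c : R, (0 < t -> c \in `]0, t[) /\
    f t = expR (- lambda * (Psi t - Psi 0)) *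
      (\sum_(k < n.+1)
         (Psi t - Psi 0) `^ (k%:R * alpha) / Gamma (k%:R * alpha + 1) * D k 0
       + (Psi t - Psi 0) `^ (n.+1%:R * alpha)
         * mittag_leffler 1 (n.+1%:R * alpha + 1) (lambda * (Psi t - Psi 0))
         * h c).
Proof.
move=> t; rewrite in_itv/= => /andP[].
rewrite le_eqVlt => /predU1P[<- _|t0 tb].
  have al0 (k : nat) : k.+1%:R * alpha != 0 by rewrite mulf_neq0 ?gt_eqF; case/andP: alpha01.
  (* At [t = 0] the remainder carries a factor 0, so any point serves; the sum reduces to its term
     [k = 0], where [0^0 = 1]. *)
  exists 0; split; first by rewrite ltxx.
  rewrite subrr mulr0 expR0 mul1r powR0// !mul0r addr0 big_ord_recl.
  rewrite [X in _ + X]big1 => [|i _]; last by rewrite lift0 powR0 ?mul0r.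
  have [+ _] := D_deriv 0%N isT; rewrite !mul0r => /(tc_derive0_at0 b_gt0)->.
  by rewrite powRr0 add0r Gamma1 divr1 mul1r addr0.
have [c c0t] := tempered_mean_value_expansion b_gt0 Psi_adm alpha01 D_deriv h_iter t0 tb.
have -> : clock b Psi t = Psi t - Psi 0 by rewrite clockE ?(ltW t0).
move=> fE; exists c; split; first by rewrite in_itv.
(* Multiplying by the weight cancels the exponential prefactor. *)
apply: (mulfI (lt0r_neq0 (expw_gt0 (clock b Psi) lambda t))); rewrite {}fE.
rewrite /expw clockE ?(ltW t0)// mulrA -expRD mulNr subrr expR0 mul1r; congr (_ + _).
by apply: eq_bigr => i _; rewrite mulrC /pw clockE ?(ltW t0).
Qed.
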